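(* Let $Z_1,\dots,Z_n$ be i.i.d. with distribution $Q$ on a measurable space $\mathcal Z$, $Z\sim Q$, let $\psi:\mathcal Z\to\mathbb R^r$ be measurable with $\int\|\psi\|^2dQ<\infty$ and $\theta=\int\psi\,dQ$. Let $m\ge1$ be fixed and $u:\mathcal Z\to\mathbb R^m$ measurable with $\int\|u\|^2dQ<\infty$, $\int u\,dQ=0$ and $W=\int uu^\top dQ$ nonsingular. Let $\hat u$ be an estimator of $u$ (a random function $\mathcal Z\to\mathbb R^m$ which may depend on $Z_1,\dots,Z_n$), and set $\hat W=\frac1n\sum_{j=1}^n\hat u(Z_j)\hat u(Z_j)^\top$. Assume: (i) $\max_{1\le j\le n}\|\hat u(Z_j)\|=o_p(n^{1/2})$; (ii) $|\hat W-W|_o=o_p(1)$; (iii) $\frac1n\sum_{j=1}^n\big(\psi(Z_j)\hat u(Z_j)^\top-E[\psi(Z_j)\hat u(Z_j)^\top]\big)=o_p(1)$; and that there is a measurable $v:\mathcal Z\to\mathbb R^m$ with $\int\|v\|^2dQ<\infty$, $\int v\,dQ=0$, $\int vv^\top dQ$ nonsingular, such that (iv) $\frac1n\sum_{j=1}^nE\big(\|\hat u(Z_j)-v(Z_j)\|^2\big)=o(1)$; (v) $\frac1n\sum_{j=1}^n\hat u(Z_j)=\frac1n\sum_{j=1}^n v(Z_j)+o_p(n^{-1/2})$. Then, with probability tending to one, there is a unique $\hat\zeta\in\mathbb R^m$ with $1+\hat u(Z_j)^\top\hat\zeta>0$ for all $j$ and $\frac1n\sum_{j=1}^n\hat u(Z_j)/(1+\hat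 u(Z_j)^\top\hat\zeta)=0$, and the estimator $$\hat\theta=\frac1n\sum_{j=1}^n\frac{\psi(Z_j)}{1+\hat u(Z_j)^\top\hat\zeta}$$ satisfies $\hat\theta=\bar\psi-\bar\phi+o_p(n^{-1/2})$, where $\bar\psi=\frac1n\sum_j\psi(Z_j)$, $\phi=E(\psi(Z)v(Z)^\top)\big(E(v(Z)v(Z)^\top)\big)^{-1}v$ is the componentwise $L_2(Q)$-projection of $\psi$ onto the linear span of the components of $v$, and $\bar\phi=\frac1n\sum_j\phi(Z_j)$. Consequently, if $\Sigma=\mathrm{Var}(\psi(Z))-\mathrm{Var}(\phi(Z))$ is nonsingular, then $\sqrt n(\hat\theta-\theta)\Rightarrow N(0,\Sigma)$.
   Context: $|A|_o$ denotes the spectral (operator) norm of a matrix $A$, i.e. its largest eigenvalue for a symmetric positive semidefinite matrix. Expectations involving $\hat u$ are taken with respect to the joint distribution of the sample. $o_p$, $O_p$ are the usual stochastic order symbols; $\Rightarrow$ denotes convergence in distribution. *)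

(* Defs.v *)
From HB Require Import structures.
From mathcomp Require Import all_boot all_order all_algebra.
From mathcomp Require Import all_classical all_reals all_analysis.
Set Implicit Arguments. Unset Strict Implicit. Unset Printing Implicit Defensive.
Import Order.TTheory GRing.Theory Num.Theory.
Import numFieldNormedType.Exports.
Local Open Scope classical_set_scope.
Local Open Scope ring_scope.

Definition dotv (R : realType) (m : nat) (x y : 'cV[R]_m) : R :=
  \sum_(i < m) x i 0 * y i 0.
Definition enorm (R : realType) (m : nat) (x : 'cV[R]_m) : R := Num.sqrt (dotv x x).

Definition opnorm (R : realType) (m : nat) (A : 'M[R]_m) : R :=
  sup [set enorm (A *m x) | x in [set x : 'cV[R]_m | enorm x <= 1]].

(* X n = o_p(a n): for every eps > 0, P(|X n| <= eps * a n) -> 1.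
   Stated with measurable "good" events B n (outer-probability form), so that it
   makes sense also for possibly non-measurable X n; equivalent to the usual
   definition when X n is measurable. *)
Definition small_op (d : measure_display) (T : measurableType d) (R : realType)
  (P : probability T R) (X : nat -> T -> R) (a : nat -> R) : Prop :=
  forall eps : R, 0 < eps ->
    exists B : nat -> set T, (forall n, measurable (B n)) /\
      ((fun n => P (B n)) @ \oo --> 1%:E)%E /\
      (forall n w, B n w -> `|X n w| <= eps * a n).

Definition iid_law (d : measure_display) (T : measurableType d)
  (dZ : measure_display) (Zs : measurableType dZ) (R : realType)
  (P : probability T R) (Q : probability Zs R) (Z : nat -> T -> Zs) : Prop :=
  (forall j, measurable_fun setT (Z j)) /\
  (forall j (A : set Zs), measurable A -> P (Z j @^-1` A) = Q A) /\
  (forall (J : seq nat) (A : nat -> set Zs), uniq J ->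
     (forall j, measurable (A j)) ->
     P (\bigcap_(j in [set j | j \in J]) (Z j @^-1` A j)) =
       (\prod_(j <- J) P (Z j @^-1` A j))%E).

Definition meas_vec (d : measure_display) (T : measurableType d) (R : realType)
  (k : nat) (f : T -> 'cV[R]_k) : Prop :=
  forall i, measurable_fun setT (fun z => f z i 0).

Definition sq_int (d : measure_display) (T : measurableType d) (R : realType)
  (Q : probability T R) (k : nat) (f : T -> 'cV[R]_k) : Prop :=
  (\int[Q]_z ((enorm (f z)) ^+ 2)%:E < +oo)%E.

Definition covQ (d : measure_display) (T : measurableType d) (R : realType)
  (Q : probability T R) (f g : T -> R) : R :=
  fine (\int[Q]_z (f z * g z)%:E) - fine (\int[Q]_z (f z)%:E) * fine (\int[Q]_z (g z)%:E).

Definition emean (R : realType) (k : nat) (n : nat) (f : nat -> 'cV[R]_k) : 'cV[R]_k :=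
  n%:R^-1 *: \sum_(j < n) f j.

(* zeta solves the empirical-likelihood equations for the values uh j = \hat u(Z_j), j < n *)
Definition EL_solves (R : realType) (m : nat) (n : nat) (uh : nat -> 'cV[R]_m)
  (zeta : 'cV[R]_m) : Prop :=
  (forall j, (j < n)%N -> 0 < 1 + dotv (uh j) zeta) /\
  n%:R^-1 *: \sum_(j < n) ((1 + dotv (uh j) zeta)^-1 *: uh j) = 0.

Definition EL_theta (R : realType) (r m : nat) (n : nat) (ps : nat -> 'cV[R]_r)
  (uh : nat -> 'cV[R]_m) (zeta : 'cV[R]_m) : 'cV[R]_r :=
  n%:R^-1 *: \sum_(j < n) ((1 + dotv (uh j) zeta)^-1 *: ps j).

(* Y ~ N(0, S): characteristic function E exp(i t'Y) = exp(- t'St/2) *)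
Definition gaussian_vec (d : measure_display) (T : measurableType d) (R : realType)
  (P : probability T R) (r : nat) (Y : T -> 'cV[R]_r) (S : 'M[R]_r) : Prop :=
  meas_vec Y /\
  forall t : 'cV[R]_r,
    ('E_P[fun w => cos (dotv t (Y w))] = (expR (- (dotv t (S *m t)) / 2))%:E)%E /\
    ('E_P[fun w => sin (dotv t (Y w))] = 0)%E.

Definition cvg_dist_normal (d : measure_display) (T : measurableType d) (R : realType)
  (P : probability T R) (r : nat) (X : nat -> T -> 'cV[R]_r) (S : 'M[R]_r) : Prop :=
  exists (d' : measure_display) (T' : measurableType d') (P' : probability T' R)
         (Y : T' -> 'cV[R]_r),
    gaussian_vec P' Y S /\
    forall f : 'cV[R]_r -> R, continuous f -> (exists M : R, forall x, `|f x| <= M) ->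
      ((fun n => ('E_P[fun w => f (X n w)])%E) @ \oo --> ('E_P'[fun w => f (Y w)])%E).

(* Main.v *)
(**
  Let s = sqrt n.  If the u_j := uhat(Z_j) are at most e s, if ubar = O(1/s), and if
  n^-1 sum u_j u_j^T is e-close to V, then 1/(1+x) = 1 - x + x^2/(1+x) turns the
  likelihood equation into a fixed-point equation for a contraction of a ball of radius
  O(1/s): the solution is zeta = V^-1 ubar + O(e/s), and inserting it in the estimator
  gives theta-hat = psi-bar - C V^-1 v-bar + O(e/s).  Since V is also the limit of
  n^-1 sum u_j u_j^T by (iv) and the law of large numbers, the probability of these events
  tends to one by (i), (iv), (v), the law of large numbers (by truncation) and Chebyshev's
  inequality.

  For the limit distribution, the characteristic functions of the projections of
  s^-1 sum (psi - theta - C V^-1 v)(Z_j) converge by independence and a second-order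
  expansion.  Together with tightness, this gives weak convergence because a bounded
  continuous function is uniformly approximated on a box, without increasing its bound, by
  trigonometric polynomials (Bernstein polynomials in the sines of the coordinates).  The
  Gaussian limit is a Cholesky factor applied to a product of standard normal laws.
*)
Require Import Defs.
From HB Require Import structures.
From mathcomp Require Import all_boot all_order all_algebra.
From mathcomp Require Import all_classical all_reals all_analysis.
From mathcomp Require Import measurable_realfun ring lra.
Set Implicit Arguments. Unset Strict Implicit. Unset Printing Implicit Defensive.
Import Order.TTheory GRing.Theory Num.Theory.
Import numFieldNormedType.Exports.
Local Open Scope classical_set_scope.
Local Open Scope ring_scope.

(** [uhat] may depend on the whole sample, so the vectors [uhat n w (Z j w)] need be neither
    independent nor identically distributed. Limit theorems are therefore applied to [psi] and [v]
    only, and what concerns the estimator is a statement without probability about [n] fixed vectors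
    ([EL_perturbation]), with one error level [e]. Condition (iv) enters at level [e ^+ 2], which
    leaves cross terms with [v] of order [e]. The bound [K] on the normalized sum of the [v (Z j)]
    is available only with probability close to one, and the admissible [e] depends on [K]; so [K]
    is fixed for a given failure probability before [e], which is the purpose of [whp_bounded]. The
    event in the conclusion has to serve every accuracy and every selection [zeta], measurable or
    not. This is why the expansion is proved for all solutions at once and why events are handled
    through inner probabilities. Characteristic functions are kept real: cosines with an arbitrary
    phase contain the sines as well. *)

(* Lets [cV] be recognized as a [completeNormedModType], for [banach_fixed_point]. *)
HB.instance Definition _ (R : realType) m := Complete.on (matrix R m 1).

(** This is the norm of the normed module of matrices, so the fixed point theorem applies to it
    directly; being read off the entries, it also suits limit theorems proved componentwise. The
    price is a dimension factor in products and in the comparison with [enorm]. *)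
Definition mnorm {R : realType} m n (A : 'M[R]_(m, n)) : R := mx_norm A.

Section mnorm_theory.
Variable R : realType.
Implicit Types m n p : nat.

Lemma mnorm_entry m n (A : 'M[R]_(m, n)) i j : `|A i j| <= mnorm A.
Proof. by rewrite /mnorm mx_normrE; apply/bigmax_geP; right => /=; exists (i, j). Qed.

Lemma mnorm_le m n (A : 'M[R]_(m, n)) c :
  0 <= c -> (forall i j, `|A i j| <= c) -> mnorm A <= c.
Proof.
move=> c0 H; rewrite /mnorm mx_normrE.
by apply/bigmax_leP; split => // -[i j] _; exact: H.
Qed.

Lemma mnorm_ge0 m n (A : 'M[R]_(m, n)) : 0 <= mnorm A.
Proof. by rewrite /mnorm mx_normE. Qed.

Lemma mnorm0 m n : mnorm (0 : 'M[R]_(m, n)) = 0.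
Proof. exact: mx_norm0. Qed.

Lemma mnorm0_eq0 m n (A : 'M[R]_(m, n)) : mnorm A <= 0 -> A = 0.
Proof.
move=> A0; apply/mx_norm_eq0/eqP.
by rewrite eq_le; apply/andP; split => //; exact: mnorm_ge0.
Qed.

Lemma ler_mnormD m n (A B : 'M[R]_(m, n)) : mnorm (A + B) <= mnorm A + mnorm B.
Proof. exact: ler_mx_norm_add. Qed.

Lemma mnormN m n (A : 'M[R]_(m, n)) : mnorm (- A) = mnorm A.
Proof. exact: mx_normN. Qed.

Lemma ler_mnormB m n (A B : 'M[R]_(m, n)) : mnorm (A - B) <= mnorm A + mnorm B.
Proof. by rewrite (le_trans (ler_mnormD _ _))// mnormN. Qed.

Lemma mnormZ m n a (A : 'M[R]_(m, n)) : mnorm (a *: A) = `|a| * mnorm A.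
Proof. exact: mx_normZ. Qed.

Lemma ler_mnorm_sum m n (I : Type) (s : seq I) (P : pred I) (F : I -> 'M[R]_(m, n)) :
  mnorm (\sum_(i <- s | P i) F i) <= \sum_(i <- s | P i) mnorm (F i).
Proof.
elim/big_ind2 : _ => [|x1 x2 y1 y2 h1 h2|//]; first by rewrite mnorm0.
by rewrite (le_trans (ler_mnormD _ _))// lerD.
Qed.

Lemma mnorm_mul m n p (A : 'M[R]_(m, n)) (B : 'M[R]_(n, p)) :
  mnorm (A *m B) <= n%:R * mnorm A * mnorm B.
Proof.
apply: mnorm_le => [|i j]; first by rewrite !mulr_ge0 ?mnorm_ge0.
rewrite mxE (le_trans (ler_norm_sum _ _ _))//.
rewrite (@le_trans _ _ (\sum_(k < n) mnorm A * mnorm B))//; last first.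
  by rewrite sumr_const card_ord -[leLHS]mulr_natl mulrA.
by apply: ler_sum => k _; rewrite normrM ler_pM// mnorm_entry.
Qed.

Lemma mnorm_tr m n (A : 'M[R]_(m, n)) : mnorm A^T = mnorm A.
Proof.
have le p q (B : 'M[R]_(p, q)) : mnorm B^T <= mnorm B.
  by apply: mnorm_le => [|i j]; rewrite ?mnorm_ge0// mxE mnorm_entry.
by apply/eqP; rewrite eq_le le/= -{1}(trmxK A) le.
Qed.

Lemma dotvE m (x y : 'cV[R]_m) : dotv x y = (x^T *m y) 0 0.
Proof. by rewrite mxE; apply: eq_bigr => i _; rewrite mxE. Qed.

Lemma normr_dotv m (x y : 'cV[R]_m) : `|dotv x y| <= m%:R * mnorm x * mnorm y.
Proof. by rewrite dotvE -(mnorm_tr x) (le_trans (mnorm_entry _ _ _))// mnorm_mul. Qed.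

Lemma dotvDr m (x y z : 'cV[R]_m) : dotv x (y + z) = dotv x y + dotv x z.
Proof. by rewrite !dotvE mulmxDr !mxE. Qed.

Lemma dotvZr m (x y : 'cV[R]_m) a : dotv x (a *: y) = a * dotv x y.
Proof. by rewrite !dotvE -scalemxAr mxE. Qed.

Lemma dotvBr m (x y z : 'cV[R]_m) : dotv x (y - z) = dotv x y - dotv x z.
Proof. by rewrite -scaleN1r dotvDr dotvZr mulN1r. Qed.

Lemma dotv_sumr m (I : Type) (s : seq I) (P : pred I) (x : 'cV[R]_m)
    (F : I -> 'cV[R]_m) :
  dotv x (\sum_(i <- s | P i) F i) = \sum_(i <- s | P i) dotv x (F i).
Proof. by rewrite dotvE mulmx_sumr summxE; apply: eq_bigr => i _; rewrite dotvE. Qed.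

Lemma dotvC m (x y : 'cV[R]_m) : dotv x y = dotv y x.
Proof. by apply: eq_bigr => i _; rewrite mulrC. Qed.

Lemma enorm_sqr k (x : 'cV[R]_k) : enorm x ^+ 2 = dotv x x.
Proof. by rewrite sqr_sqrtr// sumr_ge0// => i _; rewrite -expr2 sqr_ge0. Qed.

Lemma mnorm_le_enorm m (x : 'cV[R]_m) : mnorm x <= enorm x.
Proof.
apply: mnorm_le => [|i j]; first exact: sqrtr_ge0.
rewrite ord1 -sqrtr_sqr ler_wsqrtr// /dotv (bigD1 i)//= expr2 lerDl.
by apply: sumr_ge0 => k _; rewrite -expr2 sqr_ge0.
Qed.

Lemma enorm_le_mnorm m (x : 'cV[R]_m) : enorm x <= m%:R * mnorm x.
Proof.
have mx0 : 0 <= m%:R * mnorm x by rewrite mulr_ge0 ?mnorm_ge0.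
rewrite -[leRHS]ger0_norm// -sqrtr_sqr ler_wsqrtr//.
case: m x mx0 => [|m] x mx0; first by rewrite /dotv big_ord0 mul0r expr0n.
rewrite (le_trans (ler_norm _))// (le_trans (normr_dotv _ _))//.
rewrite -mulrA -expr2 exprMn ler_wpM2r ?sqr_ge0// expr2 ler_peMl//.
by rewrite ler1n.
Qed.

Lemma mnorm_emean_le k n (f : nat -> 'cV[R]_k) :
  mnorm (emean n f) <= n%:R^-1 * \sum_(j < n) mnorm (f j).
Proof.
rewrite mnormZ ger0_norm ?invr_ge0// ler_wpM2l ?invr_ge0//.
exact: ler_mnorm_sum.
Qed.

End mnorm_theory.

#[global] Hint Extern 0 (is_true (0 <= mnorm _)) => solve [apply: mnorm_ge0] : core.

(** * Solving the empirical likelihood equation *)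

Lemma mean_le_mul {R : realType} n (a b : nat -> R) c K :
  0 <= c -> (forall j, (j < n)%N -> a j <= c * b j) ->
  n%:R^-1 * \sum_(j < n) b j <= K -> n%:R^-1 * \sum_(j < n) a j <= c * K.
Proof.
move=> c0 H bK; rewrite (le_trans _ (ler_wpM2l c0 bK))// mulrCA ler_wpM2l ?invr_ge0//.
by rewrite mulr_sumr; apply: ler_sum => j _; exact: H.
Qed.

(* [1 / (1 + x) = 1 - x + geom_rem x] *)
Definition geom_rem {R : realType} (x : R) : R := x ^+ 2 / (1 + x).

(** The difference is x - y times (x + y + x y) / ((1 + x) (1 + y)). For [b] at most 1/2 the
    numerator is at most 5 b / 2 and the denominator at least 1/4, hence the constant 10. *)
Lemma geom_rem_lipschitz {R : realType} (b x y : R) : b <= 2^-1 -> `|x| <= b ->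
  `|y| <= b -> `|geom_rem x - geom_rem y| <= 10 * b * `|x - y|.
Proof.
move=> b2 xb yb.
have [x1 x2] : - b <= x /\ x <= b by apply/andP; rewrite -ler_norml.
have [y1 y2] : - b <= y /\ y <= b by apply/andP; rewrite -ler_norml.
have px : 2^-1 <= 1 + x by lra.
have py : 2^-1 <= 1 + y by lra.
have -> : geom_rem x - geom_rem y = (x - y) * ((x + y + x * y) / ((1 + x) * (1 + y))).
  have nx : 1 + x != 0 by rewrite gt_eqF//; lra.
  have ny : 1 + y != 0 by rewrite gt_eqF//; lra.
  by rewrite /geom_rem; field; rewrite nx ny.
rewrite normrM mulrC ler_wpM2r// normrM normfV [X in _ / X]ger0_norm; last first.
  by rewrite mulr_ge0//; lra.
rewrite ler_pdivrMr; last by rewrite mulr_gt0//; lra.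
have xy : `|x * y| <= b * 2^-1 by rewrite normrM ler_pM//; lra.
have [z1 z2] : - (b * 2^-1) <= x * y /\ x * y <= b * 2^-1.
  by apply/andP; rewrite -ler_norml.
have p4 : 4^-1 <= (1 + x) * (1 + y).
  rewrite (_ : 4^-1 = 2^-1 * 2^-1 :> R) ?ler_pM//; by [lra|field].
apply: (@le_trans _ _ (10 * b * 4^-1)).
  by rewrite ler_norml; apply/andP; split; lra.
by rewrite ler_wpM2l//; lra.
Qed.

Section empirical_likelihood.
Local Notation g := geom_rem.
(* [B] bounds the dimension and all matrices and moments involved, [e] all the
   errors; the powers of [B] and the numerical constants are far from optimal. *)
Variables (R : realType) (r m : nat) (V : 'M[R]_m) (C : 'M[R]_(r, m)) (B : R).
Hypotheses (Vu : V \in unitmx) (B1 : 1 <= B) (mB : m%:R <= B)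
  (LB : mnorm (invmx V) <= B) (CB : mnorm C <= B).
Variables (e : R) (n : nat) (u : nat -> 'cV[R]_m) (ps : nat -> 'cV[R]_r)
  (vbar : 'cV[R]_m).
Hypotheses (e0 : 0 < e) (eB : e * (100 * B ^+ 10) <= 1) (n0 : (0 < n)%N).
Let s : R := Num.sqrt n%:R.
Let What : 'M[R]_m := n%:R^-1 *: \sum_(j < n) (u j *m (u j)^T).
Let CH : 'M[R]_(r, m) := n%:R^-1 *: \sum_(j < n) (ps j *m (u j)^T).
Hypotheses (ubarB : mnorm (emean n u) <= 2 * B / s)
  (uje : forall j, (j < n)%N -> mnorm (u j) <= e * s)
  (WV : mnorm (What - V) <= e)
  (uuB : n%:R^-1 * \sum_(j < n) mnorm (u j) ^+ 2 <= B)
  (puB : n%:R^-1 * \sum_(j < n) (mnorm (ps j) * mnorm (u j)) <= B)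
  (CC : mnorm (CH - C) <= e)
  (uv : mnorm (emean n u - vbar) <= e / s).

Let B0 : 0 <= B. Proof. exact: le_trans B1. Qed.
Let s0 : 0 < s. Proof. by rewrite sqrtr_gt0 ltr0n. Qed.
(** [rho] is twice the bound B * B * (2 * B / s) on the image of 0 under the fixed point map, and
    [b] = B * (e * s) * rho bounds the products [dotv (u j) z] on the ball of radius [rho].
    Variables with a defining equation do not unfold; [erefl] instantiates them. *)
Variable rho : R.
Hypothesis rhoE : rho = 4 * B ^+ 3 / s.
Let rho0 : 0 <= rho. Proof. by rewrite rhoE divr_ge0 ?mulr_ge0 ?exprn_ge0// ltW. Qed.
Variable b : R.
Hypothesis bE : b = 4 * B ^+ 4 * e.
Let b0 : 0 <= b. Proof. by rewrite bE !mulr_ge0 ?exprn_ge0// ltW. Qed.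

Let mulB p q (A : 'M[R]_(p, m)) (x : 'M[R]_(m, q)) : mnorm (A *m x) <= B * mnorm A * mnorm x.
Proof. by rewrite (le_trans (mnorm_mul _ _))// -!mulrA ler_wpM2r// mulr_ge0. Qed.

Let dotB (x y : 'cV[R]_m) : `|dotv x y| <= B * mnorm x * mnorm y.
Proof. by rewrite (le_trans (normr_dotv _ _))// -!mulrA ler_wpM2r// mulr_ge0. Qed.

(** The form in which the smallness of [e] is used: each product [B ^+ k * e] becomes one unknown
    for linear arithmetic. *)
Let expB k : (k <= 10)%N -> B ^+ k * e * 100 <= 1.
Proof.
move=> k10; apply: le_trans eB; rewrite [leRHS]mulrCA [leLHS]mulrC ler_pM2l//.
by rewrite mulrC ler_pM2l// ler_weXn2l.
Qed.

Let b2 : b <= 2^-1.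
Proof. have := @expB 4 isT; rewrite bE -mulrA; move: (B ^+ 4 * e) => q; lra. Qed.

Let xb j z : (j < n)%N -> mnorm z <= rho -> `|dotv (u j) z| <= b.
Proof.
move=> jn zr; rewrite (le_trans (dotB _ _))//.
apply: (@le_trans _ _ (B * (e * s) * rho)).
  by rewrite ler_pM// ?mulr_ge0// ler_wpM2l// uje.
rewrite le_eqVlt; apply/orP; left; apply/eqP; rewrite rhoE bE; field.
by rewrite gt_eqF.
Qed.

Let x1 j z : (j < n)%N -> mnorm z <= rho -> 2^-1 <= 1 + dotv (u j) z.
Proof.
move=> jn zr; have := xb jn zr; rewrite ler_norml => /andP[+ _].
by move: b2; lra.
Qed.

(** The weight [p] is arbitrary because the same remainder occurs in the likelihood equation, with
    [p] equal to [u], and in the estimator, with [p] equal to [ps]. *)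
Let rem k (p : nat -> 'cV[R]_k) (z : 'cV[R]_m) : 'cV[R]_k :=
  emean n (fun j => g (dotv (u j) z) *: p j).

(** The constant is of order [e] because [b] is. With 0 as second point this also bounds [rem p z]
    itself, by a quantity of order [e] times [rho]. *)
Let rem_lip k (p : nat -> 'cV[R]_k) z z' :
  n%:R^-1 * \sum_(j < n) (mnorm (p j) * mnorm (u j)) <= B ->
  mnorm z <= rho -> mnorm z' <= rho ->
  mnorm (rem p z - rem p z') <= 10 * b * B * mnorm (z - z') * B.
Proof.
move=> pB zr zr'.
have -> : rem p z - rem p z' =
    emean n (fun j => (g (dotv (u j) z) - g (dotv (u j) z')) *: p j).
  rewrite /rem /emean -scalerBr -sumrB; congr (_ *: _).
  by apply: eq_bigr => j _; rewrite -scalerBl.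
apply: (le_trans (mnorm_emean_le _ _)).
apply: (@mean_le_mul _ _ (fun j => mnorm ((g (dotv (u j) z) - g (dotv (u j) z')) *: p j))
  (fun j => mnorm (p j) * mnorm (u j))) pB => [|j jn].
  by rewrite mulr_ge0// mulr_ge0// mulr_ge0.
rewrite mnormZ [mnorm (p j) * _]mulrC !mulrA ler_wpM2r//.
apply: (le_trans (geom_rem_lipschitz b2 (xb jn zr) (xb jn zr'))).
rewrite -dotvBr -!mulrA ler_wpM2l// ler_wpM2l//.
by rewrite (le_trans (dotB _ _))// -!mulrA ler_wpM2l// mulrC.
Qed.

Let rem0 k (p : nat -> 'cV[R]_k) : rem p 0 = 0.
Proof.
rewrite /rem /emean big1 ?scaler0// => j _.
by rewrite dotvE mulmx0 mxE /g expr0n mul0r scale0r.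
Qed.

(* The likelihood equation reads [What *m z = emean n u + rem u z]; multiplied by
   the inverse of [V], it says that [z] is a fixed point of [Tf]. *)
Let Tf z := invmx V *m (emean n u - (What - V) *m z + rem u z).

(** As b = 4 B^4 e, the remainder contributes 40 B^8 e to the constant and the error of [What]
    contributes B^3 e; by [eB] their sum is below 1/2. *)
Let Tf_lip z z' : mnorm z <= rho -> mnorm z' <= rho ->
  mnorm (Tf z - Tf z') <= 2^-1 * mnorm (z - z').
Proof.
move=> zr zr'.
have -> : Tf z - Tf z' = invmx V *m ((rem u z - rem u z') - (What - V) *m (z - z')).
  rewrite /Tf -mulmxBr; congr (_ *m _); rewrite mulmxBr.
  by rewrite !opprD !opprK addrACA addrC; congr (_ + _); rewrite addrACA subrr add0r addrC.
have rl := rem_lip uuB zr zr'.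
have wl : mnorm ((What - V) *m (z - z')) <= B * e * mnorm (z - z').
  by rewrite (le_trans (mulB _ _))// ler_wpM2r// ler_wpM2l.
apply: (le_trans (mulB _ _)).
apply: (@le_trans _ _ (B * B * ((10 * b * B * B + B * e) * mnorm (z - z')))).
  rewrite ler_pM ?mulr_ge0 ?ler_wpM2l//.
  apply: le_trans (ler_mnormB _ _) _; apply: le_trans (lerD rl wl) _.
  by rewrite (mulrDl (10 * b * B * B)) lerD2r [leLHS]mulrAC.
rewrite mulrA ler_wpM2r//.
have -> : B * B * (10 * b * B * B + B * e) = 40 * (B ^+ 8 * e) + B ^+ 3 * e.
  by rewrite bE; ring.
by have := @expB 8 isT; have := @expB 3 isT; lra.
Qed.

(** The image of 0 lies in the ball of half the radius, and the contraction by 1/2 adds at most the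
    other half. *)
Let Tf_map z : mnorm z <= rho -> mnorm (Tf z) <= rho.
Proof.
move=> zr.
have T0 : mnorm (Tf 0) <= rho / 2.
  rewrite /Tf rem0 mulmx0 subr0 addr0 (le_trans (mulB _ _))//.
  apply: (@le_trans _ _ (B * B * (2 * B / s))).
    by rewrite ler_pM ?mulr_ge0// ler_wpM2l.
  by rewrite le_eqVlt; apply/orP; left; apply/eqP; rewrite rhoE; field; rewrite gt_eqF.
have z00 : mnorm (0 : 'cV[R]_m) <= rho by rewrite mnorm0.
have := Tf_lip zr z00; rewrite subr0.
have := ler_mnormD (Tf z - Tf 0) (Tf 0); rewrite subrK.
by move: T0 zr; lra.
Qed.

(** An exact identity, not an asymptotic one: the scalar expansion of 1 / (1 + x) is averaged with
    the weights [p j], and the linear term becomes a matrix acting on [z]. *)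
Let expand k (p : nat -> 'cV[R]_k) z :
  (forall j, (j < n)%N -> 0 < 1 + dotv (u j) z) ->
  n%:R^-1 *: \sum_(j < n) ((1 + dotv (u j) z)^-1 *: p j) =
  emean n p - (n%:R^-1 *: \sum_(j < n) (p j *m (u j)^T)) *m z + rem p z.
Proof.
move=> pos; rewrite /rem /emean -scalemxAl mulmx_suml -scalerBr -scalerDr.
congr (_ *: _); rewrite -sumrB -big_split/=; apply: eq_bigr => j _.
have -> : p j *m (u j)^T *m z = dotv (u j) z *: p j.
  by rewrite -mulmxA [(u j)^T *m z]mx11_scalar mul_mx_scalar -dotvE.
rewrite -{2}[p j]scale1r -scalerBl -scalerDl; congr (_ *: _).
by have := pos _ (ltn_ord j); move=> ?; rewrite /g; field; rewrite gt_eqF.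
Qed.

(** The ball is closed, contains 0 and is contracted into itself; positivity of the denominators
    holds on all of it by [x1]. The bound and the fixed point equation are kept for
    [EL_expansion]. *)
Lemma EL_exists : exists2 z, EL_solves n u z & mnorm z <= rho /\ z = Tf z.
Proof.
pose U : set ('cV[R]_m) := [set z | mnorm z <= rho].
have fs : set_fun U U Tf by move=> z; exact: Tf_map.
pose F : {fun U >-> U} := mkfun_fun fs.
have [|||z Uz Fz] := @banach_fixed_point R ('cV[R]_m : completeNormedModType R) U F.
- have h0 : (0 <= 2^-1 :> R)%R by [].
  exists (NngNum h0); split; first by rewrite /=; lra.
  by move=> [x y] [/= Ux Uy]; exact: Tf_lip.
- rewrite (_ : U = (@mnorm R m 1) @^-1` [set x | x <= rho])//.
  by apply: closed_comp; [move=> x _; exact: norm_continuous|exact: closed_le].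
- by exists 0; rewrite /U/= mnorm0.
exists z; last by split => //.
have pos j : (j < n)%N -> 0 < 1 + dotv (u j) z by move=> jn; have := x1 jn Uz; lra.
split => //; rewrite expand//.
have : V *m z = V *m Tf z by rewrite {1}Fz.
rewrite mulKVmx// mulmxBl opprB addrA => h.
by apply: (addrI (V *m z)); rewrite addr0 [RHS]h !addrA [V *m z + _]addrC.
Qed.

(** Uniqueness is global, not only within the ball. It reflects the concavity of the log-likelihood:
    the difference of the two equations, paired with z - z', is a sum of nonnegative terms [f j].
    All of them vanish, so z - z' is orthogonal to every [u j] and lies in the kernel of [What],
    which is trivial because [What] is close to [V]. *)
Lemma EL_unique z z' : EL_solves n u z -> EL_solves n u z' -> z = z'.
Proof.
move=> [pos eq] [pos' eq'].
pose f j := (dotv (u j) (z - z')) ^+ 2 / ((1 + dotv (u j) z) * (1 + dotv (u j) z')).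
have f0 (j : 'I_n) : 0 <= f j.
  by rewrite divr_ge0 ?sqr_ge0// mulr_ge0// ltW ?pos ?pos'.
have nn : (n%:R : R) != 0 by rewrite pnatr_eq0 -lt0n.
have sumf : \sum_(j < n) f j = 0.
  have S0 p : n%:R^-1 *: \sum_(j < n) ((1 + dotv (u j) p)^-1 *: u j) = 0 ->
      \sum_(j < n) (1 + dotv (u j) p)^-1 * dotv (u j) (z - z') = 0.
    move=> /(congr1 (fun x => n%:R *: x)); rewrite scaler0 scalerA mulfV// scale1r.
    move=> /(congr1 (dotv (z - z'))); rewrite dotv_sumr [RHS]dotvE mulmx0 mxE => h; rewrite -[RHS]h.
    by apply: eq_bigr => j _; rewrite dotvZr (dotvC (z - z')).
  have -> : \sum_(j < n) f j = \sum_(j < n) ((1 + dotv (u j) z')^-1 * dotv (u j) (z - z')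
      - (1 + dotv (u j) z)^-1 * dotv (u j) (z - z')).
    apply: eq_bigr => j _; rewrite /f dotvBr.
    by field; rewrite !gt_eqF ?pos ?pos'.
  by rewrite sumrB !S0// subrr.
have uz (j : 'I_n) : dotv (u j) (z - z') = 0.
  have /eqP : f j = 0 by exact: (psumr_eq0P (fun i _ => f0 i) sumf).
  rewrite mulf_eq0 expf_eq0/= invr_eq0 mulf_eq0.
  by rewrite (gt_eqF (pos _ (ltn_ord j))) (gt_eqF (pos' _ (ltn_ord j))) !orbF => /eqP.
have Wz : What *m (z - z') = 0.
  rewrite -scalemxAl mulmx_suml big1 ?scaler0// => j _.
  by rewrite -mulmxA [(u j)^T *m _]mx11_scalar mul_mx_scalar -dotvE uz scale0r.
(* Closeness to an invertible matrix replaces invertibility of [What]: on the kernel of [What] the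
   identity equals V^-1 (V - What), whose factor B^3 e is below 1/2. *)
have zE : z - z' = invmx V *m ((V - What) *m (z - z')).
  by rewrite mulmxBl Wz subr0 mulKmx.
have : mnorm (z - z') <= 2^-1 * mnorm (z - z').
  rewrite {1}zE (le_trans (mulB _ _))//.
  apply: (@le_trans _ _ (B * B * (B * e * mnorm (z - z')))).
    rewrite ler_pM ?mulr_ge0 ?ler_wpM2l// (le_trans (mulB _ _))//.
    by rewrite ler_wpM2r// ler_wpM2l// -mnormN opprB.
  rewrite mulrA ler_wpM2r// (_ : B * B * (B * e) = B ^+ 3 * e); last by ring.
  by have := @expB 3 isT; lra.
have := mnorm_ge0 (z - z') => z0 z2.
by apply/eqP; rewrite -subr_eq0; apply/eqP/mnorm0_eq0; lra.
Qed.

Lemma EL_expansion z : EL_solves n u z -> mnorm z <= rho -> z = Tf z ->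
  mnorm (EL_theta n ps u z - emean n ps + C *m invmx V *m vbar)
    <= 400 * B ^+ 13 * (e / s).
Proof.
move=> [pos _] zr zE; rewrite /EL_theta expand// -/CH.
(* Four sources of error: the remainder in the estimator, the error of [CH], the deviation of [z]
   from V^-1 ubar, and the replacement of ubar by [vbar]. *)
have -> : emean n ps - CH *m z + rem ps z - emean n ps + C *m invmx V *m vbar =
    rem ps z - ((CH - C) *m z + C *m (z - invmx V *m emean n u)
      + C *m invmx V *m (emean n u - vbar)).
  rewrite mulmxBl !mulmxBr !mulmxA.
  move: (emean n ps) (CH *m z) (rem ps z) (C *m invmx V *m vbar) (C *m z)
    (C *m invmx V *m emean n u) => a1 a2 a3 a4 a5 a6.
  by apply/matrixP => i j; rewrite !mxE; ring.
have z00 : mnorm (0 : 'cV[R]_m) <= rho by rewrite mnorm0.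
have r1 : mnorm (rem ps z) <= 10 * b * B * rho * B.
  have := rem_lip puB zr z00; rewrite rem0 !subr0 => /le_trans; apply.
  by rewrite ler_wpM2r// ler_wpM2l// !mulr_ge0.
have r2 : mnorm ((CH - C) *m z) <= B * e * rho.
  by rewrite (le_trans (mulB _ _))// ler_pM ?mulr_ge0 ?ler_wpM2l.
have r4 : mnorm (C *m invmx V *m (emean n u - vbar)) <= B * (B * B * B) * (e / s).
  rewrite (le_trans (mulB _ _))// ler_pM ?mulr_ge0 ?ler_wpM2l//.
  by rewrite (le_trans (mulB _ _))// ler_pM ?mulr_ge0 ?ler_wpM2l.
have r3 : mnorm (C *m (z - invmx V *m emean n u)) <=
    B * B * (B * B * (B * e * rho + 10 * b * B * rho * B)).
  rewrite (le_trans (mulB _ _))// ler_pM ?mulr_ge0 ?ler_wpM2l//.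
  (* By the fixed point equation, z - V^-1 ubar is V^-1 applied to [rem u z] minus
     [(What - V) *m z], and both are of order e / s. *)
  rewrite {1}zE /Tf -mulmxBr (le_trans (mulB _ _))// ler_pM ?mulr_ge0 ?ler_wpM2l//.
  rewrite addrAC [_ - _ - _]addrAC subrr sub0r (le_trans (ler_mnormD _ _))// mnormN lerD//.
    by rewrite (le_trans (mulB _ _))// ler_pM ?mulr_ge0 ?ler_wpM2l.
  have := rem_lip uuB zr z00; rewrite rem0 !subr0 => /le_trans; apply.
  by rewrite ler_wpM2r// ler_wpM2l// !mulr_ge0.
apply: le_trans (ler_mnormB _ _) _; apply: le_trans (lerD r1 (lexx _)) _.
apply: le_trans (lerD (lexx _) (ler_mnormD _ _)) _.
apply: le_trans (lerD (lexx _) (lerD (ler_mnormD _ _) (lexx _))) _.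
apply: le_trans (lerD (lexx _) (lerD (lerD r2 r3) r4)) _.
have -> : 10 * b * B * rho * B + (B * e * rho + B * B * (B * B * (B * e * rho + 10 * b * B * rho * B)) +
    B * (B * B * B) * (e / s)) =
  (160 * B ^+ 9 + 4 * B ^+ 4 + 4 * B ^+ 8 + 160 * B ^+ 13 + B ^+ 4) * (e / s).
  by rewrite rhoE bE; field; rewrite gt_eqF.
rewrite ler_wpM2r; [by []|by rewrite divr_ge0 ?ltW|].
(* The five coefficients add up to 329, which 400 covers once every power is raised to the
   thirteenth. *)
have P k : (k <= 13)%N -> B ^+ k <= B ^+ 13 by move=> ?; rewrite ler_weXn2l.
have := P 9%N isT; have := P 4%N isT; have := P 8%N isT; have := exprn_ge0 13 B0.
by move: (B ^+ 9) (B ^+ 4) (B ^+ 8) (B ^+ 13) => b9 b4 b8 b13; lra.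
Qed.

End empirical_likelihood.

(** * Events whose probability tends to one *)

Section with_high_probability.
Variables (d : measure_display) (T : measurableType d) (R : realType)
  (P : probability T R).
Implicit Types (S : nat -> set T) (n : nat).

(* Inner probabilities, so that [S n] need not be measurable. *)
Definition whp S := forall eta : R, 0 < eta -> exists N, forall n, (N <= n)%N ->
  exists A, [/\ measurable A, A `<=` S n & (P (~` A) <= eta%:E)%E].

Lemma whpW S S' : (exists N, forall n, (N <= n)%N -> S n `<=` S' n) -> whp S -> whp S'.
Proof.
move=> [N1 SS] Sp eta eta0; have [N2 H] := Sp _ eta0.
exists (maxn N1 N2) => n; rewrite geq_max => /andP[n1 n2].
have [A [mA AS PA]] := H _ n2.
by exists A; split => //; apply: subset_trans AS _; exact: SS.
Qed.

Lemma whpS S S' : (forall n, S n `<=` S' n) -> whp S -> whp S'.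
Proof. by move=> h; apply: whpW; exists 0%N. Qed.

Lemma probability_setCI_le (A B : set T) (a b : R) : measurable A -> measurable B ->
  (P (~` A) <= a%:E)%E -> (P (~` B) <= b%:E)%E -> (P (~` (A `&` B)) <= (a + b)%:E)%E.
Proof.
move=> mA mB Aa Bb; rewrite setCI EFinD.
apply: le_trans (leeD Aa Bb); apply: measureU2; exact: measurableC.
Qed.

Lemma whpI S S' : whp S -> whp S' -> whp (fun n => S n `&` S' n).
Proof.
move=> Sp Sp' eta eta0; have eta2 : 0 < eta / 2 by rewrite divr_gt0.
have [N1 H1] := Sp _ eta2; have [N2 H2] := Sp' _ eta2.
exists (maxn N1 N2) => n; rewrite geq_max => /andP[n1 n2].
have [A [mA AS PA]] := H1 _ n1; have [B [mB BS PB]] := H2 _ n2.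
exists (A `&` B); split; [exact: measurableI|exact: setISS|].
by rewrite [eta]splitr; exact: probability_setCI_le.
Qed.

Lemma whp_setT : whp (fun=> setT).
Proof.
move=> eta eta0; exists 0%N => n _; exists setT; split => //.
by rewrite setCT measure0 lee_fin ltW.
Qed.

Lemma whp_fin (I : finType) (S : I -> nat -> set T) :
  (forall i, whp (S i)) -> whp (fun n => [set w | forall i, S i n w]).
Proof.
move=> Sp.
suff : whp (fun n => [set w | forall i, i \in enum I -> S i n w]).
  by apply: whpS => n w H i; apply: H; rewrite mem_enum.
elim: (enum I) => [|i s IH]; first by apply: whpS whp_setT => n w _ i.
apply: whpS (whpI (Sp i) IH) => n w [Si Ss] k; rewrite inE => /orP[/eqP->//|].
exact: Ss.
Qed.

Lemma cvg_probability1P (A : nat -> set T) : (forall n, measurable (A n)) ->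
  ((fun n => P (A n)) @ \oo --> 1%:E)%E <->
  (forall eta : R, 0 < eta -> exists N, forall n, (N <= n)%N -> (P (~` A n) <= eta%:E)%E).
Proof.
move=> mA.
have PC n : P (~` A n) = (1 - fine (P (A n)))%:E.
  by rewrite probability_setC// EFinB fineK// fin_num_measure.
have PA n : 0 <= 1 - fine (P (A n)) by rewrite -lee_fin -PC measure_ge0.
split=> [/fine_cvgP[_ /cvgrPdist_le H] eta /H[N _ HN]|H].
  exists N => n /HN/=; rewrite PC lee_fin; exact: le_trans (ler_norm _).
apply/fine_cvgP; split.
  by apply: nearW => n; rewrite fin_num_measure.
apply/cvgrPdist_le => eta /H[N HN]; exists N => // n /= /HN.
by rewrite PC lee_fin ger0_norm.
Qed.

(** In [whp] the measurable subset may change with the failure probability, whereas [small_op] wants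
    one sequence of events. Such a sequence is obtained by taking, for each n, a measurable subset
    whose complement has probability within 1 / (n + 1) of the infimum. *)
Lemma small_opP (X : nat -> T -> R) (a : nat -> R) :
  small_op P X a <-> forall e, 0 < e -> whp (fun n => [set w | `|X n w| <= e * a n]).
Proof.
split=> [H e /H[B [mB [B1 BX]]] eta eta0|H e e0].
  have [N HN] := (cvg_probability1P mB).1 B1 _ eta0.
  by exists N => n nN; exists (B n); split => //; [move=> w; exact: BX|exact: HN].
pose S n := [set w | `|X n w| <= e * a n].
pose v n := ereal_inf [set P (~` A) | A in [set A | measurable A /\ A `<=` S n]].
have vfin n : v n \is a fin_num.
  rewrite ge0_fin_numE; last by apply: le_ereal_inf_tmp => _ [A _ <-]; exact: measure_ge0.
  apply: (@le_lt_trans _ _ (P (~` set0))); last by rewrite setC0 probability_setT ltry.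
  by apply: ereal_inf_lbound; exists set0 => //; split => //; exact: sub0set.
have /choice[E HE] n : exists A, [/\ measurable A, A `<=` S n &
    (P (~` A) < v n + (n.+1%:R^-1)%:E)%E].
  have n0 : 0 < n.+1%:R^-1 :> R by rewrite invr_gt0.
  have [_ [A [mA AS] <-] PA] := lb_ereal_inf_adherent n0 (vfin n).
  by exists A.
exists E; split; first by move=> n; have [] := HE n.
split; last by move=> n w Ew; have [_ ES _] := HE n; exact: ES.
apply/cvg_probability1P => [n|eta eta0]; first by have [] := HE n.
have eta2 : 0 < eta / 2 by rewrite divr_gt0.
have [N1 HN] := H _ e0 _ eta2.
have [N2 _ HN2] : \forall n \near \oo, n.+1%:R^-1 <= eta / 2 :> R.
  by near do rewrite ltW//; exact: (near_infty_natSinv_lt (PosNum eta2)).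
exists (maxn N1 N2) => n; rewrite geq_max => /andP[n1 n2].
have [_ _ /ltW/le_trans] := HE n; apply.
rewrite [eta in leRHS]splitr EFinD leeD ?lee_fin ?HN2//.
have [A [mA AS PA]] := HN _ n1.
by apply: le_trans PA; apply: ereal_inf_lbound; exists A.
Unshelve. all: by end_near. Qed.

(** Applies [small_opP] to the indicator of the complement of [S n] with the zero sequence as rate:
    being at most 0 in absolute value means lying in [S n]. *)
Lemma whp_measurable S : whp S -> exists E : nat -> set T,
  [/\ forall n, measurable (E n), ((fun n => P (E n)) @ \oo --> 1%:E)%E
    & forall n, E n `<=` S n].
Proof.
move=> Sp.
pose X n w : R := if `[< S n w >] then 0 else 1.
have [|B [mB [PB BX]]] := (small_opP X (fun=> 0)).2 _ 1 ltr01.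
  move=> e e0; apply: whpS Sp => n w Sw; rewrite /= /X.
  by case: asboolP => //; rewrite normr0 mulr0.
exists B; split => // n w /BX; rewrite /X mulr0 normr_le0.
by case: asboolP => // _; rewrite oner_eq0.
Qed.

Lemma whp_event (E : nat -> set T) : (forall n, measurable (E n)) ->
  ((fun n => P (E n)) @ \oo --> 1%:E)%E -> whp E.
Proof.
move=> mE /(cvg_probability1P mE) H eta /H[N HN]; exists N => n nN.
by exists (E n); split => //; exact: HN.
Qed.

(* Conditions [Bd K] hold with probability close to one only for [K] large. *)
Lemma whp_bounded (Bd Good : R -> nat -> set T) S :
  (forall eta : R, 0 < eta -> exists K N, forall n, (N <= n)%N ->
     exists A, [/\ measurable A, A `<=` Bd K n & (P (~` A) <= eta%:E)%E]) ->
  (forall K, whp (Good K)) ->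
  (forall K n, Bd K n `&` Good K n `<=` S n) ->
  whp S.
Proof.
move=> H1 H2 H3 eta eta0; have eta2 : 0 < eta / 2 by rewrite divr_gt0.
have [K [N1 HN1]] := H1 _ eta2; have [N2 HN2] := H2 K _ eta2.
exists (maxn N1 N2) => n; rewrite geq_max => /andP[n1 n2].
have [A [mA AS PA]] := HN1 _ n1; have [B [mB BS PB]] := HN2 _ n2.
exists (A `&` B); split; first exact: measurableI.
  by move=> w [/AS Aw /BS Bw]; exact: (H3 K).
by rewrite [eta]splitr; exact: probability_setCI_le.
Qed.

Lemma markov_ge0 (f : T -> \bar R) (e : R) : measurable_fun [set: T] f ->
  (forall w, 0 <= f w)%E -> 0 < e ->
  (P (~` [set w | f w <= e%:E])%E <= (e^-1)%:E * \int[P]_w f w)%E.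
Proof.
move=> mf f0 e0; rewrite lee_pdivlMl//.
have -> : ~` [set w | f w <= e%:E]%E = [set w | e%:E < f w]%E.
  by apply/seteqP; split => w /=; [move=> /negP; rewrite -ltNge|rewrite ltNge => /negP].
have := le_integral_abse P measurableT mf e0.
under eq_integral do rewrite gee0_abs//.
apply: le_trans; apply: lee_wpmul2l; first by rewrite lee_fin ltW.
apply: le_measure; rewrite ?inE.
- by rewrite -[X in measurable X]setTI; exact: emeasurable_fun_o_infty.
- by apply: emeasurable_fun_c_infty => //; exact: measurableT_comp.
- by move=> w /= /ltW; rewrite gee0_abs.
Qed.
End with_high_probability.

(** * Integration of functions of independent variables *)

Section transfer.
Import HBNNSimple.

(** Simple functions and monotone convergence. The weight [h] gives one statement for three uses:
    [h] constant for the law of one variable, [h] a function of other variables for independence,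
    and [h] a density with [X] the identity for the normal law. *)
Lemma ge0_integral_transfer d (T : measurableType d) d' (Y : measurableType d')
    (R : realType) (mu : {measure set T -> \bar R}) (Q : {measure set Y -> \bar R})
    (h : T -> R) (X : T -> Y) (c : R) (g : Y -> R) :
  measurable_fun [set: T] h -> (forall w, 0 <= h w) -> measurable_fun [set: T] X ->
  0 <= c ->
  (forall A, measurable A ->
     (\int[mu]_w (h w * \1_A (X w))%:E = c%:E * Q A)%E) ->
  measurable_fun [set: Y] g -> (forall y, 0 <= g y) ->
  (\int[mu]_w (h w * g (X w))%:E = c%:E * \int[Q]_y (g y)%:E)%E.
Proof.
move=> mh h0 mX c0 H mg g0.
have mEg : measurable_fun [set: Y] (EFin \o g) by exact/measurable_EFinP.
pose f_ := nnsfun_approx measurableT mEg.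
have f_cvg y : (f_ n y)%:E @[n --> \oo] --> (g y)%:E.
  by apply: cvg_nnsfun_approx => // *; rewrite /= lee_fin.
have f_nd y : {homo (fun n => f_ n y) : n m / (n <= m)%N >-> n <= m}.
  by move=> n m nm; exact/lefP/nd_nnsfun_approx.
have mfX n : measurable_fun [set: T] (fun w => f_ n (X w)).
  by apply: measurableT_comp => //; exact: measurable_funP.
have cvg_mono d1 (U : measurableType d1) (nu : {measure set U -> \bar R})
    (k : nat -> U -> R) (l : U -> R) : (forall n, measurable_fun [set: U] (k n)) ->
    (forall n x, 0 <= k n x) -> (forall x n m, (n <= m)%N -> k n x <= k m x) ->
    (forall x, (k n x)%:E @[n --> \oo] --> (l x)%:E) ->
    (\int[nu]_x (k n x)%:E)%E @[n --> \oo] --> (\int[nu]_x (l x)%:E)%E.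
  move=> mk k0 knd kl.
  rewrite (_ : (\int[nu]_x (l x)%:E = \int[nu]_x limn (fun n => (k n x)%:E))%E).
    apply: cvg_monotone_convergence => //.
    - by move=> n; exact/measurable_EFinP.
    - by move=> n x _; rewrite lee_fin.
    - by move=> x _ n m nm; rewrite lee_fin knd.
  by apply: eq_integral => x _; apply/esym/cvg_lim.
have I_cvg := cvg_mono _ _ mu (fun n w => h w * f_ n (X w)) (fun w => h w * g (X w)).
have J_cvg := cvg_mono _ _ Q (fun n => f_ n) g.
have {}J_cvg : (c%:E * \int[Q]_y (f_ n y)%:E)%E @[n --> \oo] -->
    (c%:E * \int[Q]_y (g y)%:E)%E.
  by apply: cvgeZl => //; apply: J_cvg => // y n m; exact: f_nd.
have {}I_cvg : (\int[mu]_w (h w * f_ n (X w))%:E)%E @[n --> \oo] -->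
    (\int[mu]_w (h w * g (X w))%:E)%E.
  apply: I_cvg => [n|n w|w n m nm|w].
  - exact: measurable_funM.
  - by rewrite mulr_ge0.
  - by rewrite ler_wpM2l// f_nd.
  - by under eq_fun do rewrite EFinM; rewrite EFinM; exact: cvgeZl.
apply: (cvg_unique _ I_cvg); first exact: ereal_hausdorff.
rewrite (_ : (fun n => _) = (fun n => c%:E * \int[Q]_y (f_ n y)%:E)%E)//.
apply/funext => n.
have mA r : measurable (f_ n @^-1` [set r]) by exact: measurable_funPTI.
have m1X r : measurable_fun [set: T] (fun w => (\1_(f_ n @^-1` [set r]) (X w) : R)).
  by apply: measurableT_comp => //; exact: measurable_indic.
have kint d1 (U : measurableType d1) (nu : {measure set U -> \bar R}) (k : U -> R) (r : R) :
    measurable_fun [set: U] k -> (forall x, 0 <= k x) -> 0 <= r ->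
    (\int[nu]_x (r * k x)%:E = r%:E * \int[nu]_x (k x)%:E)%E.
  move=> mk k0 r0; under eq_integral do rewrite EFinM.
  rewrite ge0_integralZl//; first exact/measurable_EFinP.
  by move=> x _; rewrite lee_fin.
have rg r : range (f_ n) r -> 0 <= r by move=> [y _ <-].
have sumint d1 (U : measurableType d1) (nu : {measure set U -> \bar R}) (k : U -> R)
    (Xk : U -> Y) : measurable_fun [set: U] k -> (forall x, 0 <= k x) ->
    measurable_fun [set: U] Xk ->
    (\int[nu]_x (k x * f_ n (Xk x))%:E =
     \sum_(r \in range (f_ n)) r%:E * \int[nu]_x (k x * \1_(f_ n @^-1` [set r]) (Xk x))%:E)%E.
  move=> mk k0 mXk.
  have mk1 r : measurable_fun [set: U] (fun x => k x * \1_(f_ n @^-1` [set r]) (Xk x)).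
    by apply: measurable_funM => //; apply: measurableT_comp => //; exact: measurable_indic.
  under eq_integral.
    move=> x _; rewrite fimfunE mulr_fsumr -fsumEFin//. over.
  rewrite ge0_integral_fsum//; last 2 first.
  - move=> r; apply/measurable_EFinP; under eq_fun do rewrite mulrCA.
    exact: measurable_funM.
  - move=> r x _; rewrite lee_fin mulr_ge0// indicE.
    by case: (boolP (_ \in _)) => [/[!inE] <-|]; rewrite ?mulr1 ?mulr0.
  apply: eq_fsbigr => r /[!inE] /rg r0; rewrite -kint//.
    by apply: eq_integral => x _; rewrite mulrCA.
  by move=> x; rewrite mulr_ge0.
rewrite sumint// ; transitivity (\sum_(r \in range (f_ n)) r%:E * (c%:E * Q (f_ n @^-1` [set r])))%E.
  by apply: eq_fsbigr => r _; rewrite H.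
rewrite (_ : \int[Q]_y (f_ n y)%:E = \int[Q]_y (1 * f_ n y)%:E)%E; last first.
  by apply: eq_integral => y _; rewrite mul1r.
rewrite (sumint _ _ Q (cst 1) id)//.
rewrite ge0_mule_fsumr//; last first.
  (* The approximating functions are nonnegative, so a negative value has an empty level set and its
     term is zero. *)
  move=> r; have [r0|r0] := leP 0 r; first by rewrite mule_ge0 ?lee_fin ?integral_ge0// => y _; rewrite lee_fin mul1r.
  by rewrite preimage_nnfun0// (eq_integral (cst 0)) ?integral0 ?mule0// => y _; rewrite indic0 mulr0.
apply: eq_fsbigr => r _; rewrite muleCA; congr (_ * (_ * _))%E.
by rewrite (eq_integral (fun y => (\1_(f_ n @^-1` [set r]) y)%:E)) ?integral_indic ?setIT// => y _; rewrite mul1r.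
Qed.
End transfer.

(** * Integrability and integrals of real-valued functions *)

Section integrable_facts.
Variables (d : measure_display) (T : measurableType d) (R : realType).
Variable mu : {measure set T -> \bar R}.
Implicit Types f g : T -> R.

Lemma integrable_measurable f : mu.-integrable setT (EFin \o f) -> measurable_fun setT f.
Proof. by move=> /integrableP[/measurable_EFinP]. Qed.

Lemma RintegralE f : mu.-integrable setT (EFin \o f) ->
  (\int[mu]_x (f x)%:E)%E = (\int[mu]_x f x)%:E.
Proof. by move=> fi; rewrite /Rintegral fineK//; exact: integrable_fin_num. Qed.

Lemma ge0_integrable f : measurable_fun setT f -> (forall x, 0 <= f x) ->
  (\int[mu]_x (f x)%:E < +oo)%E -> mu.-integrable setT (EFin \o f).
Proof.
move=> mf f0 fi; apply/integrableP; split; first exact/measurable_EFinP.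
by rewrite (eq_integral (fun x => (f x)%:E))// => x _; rewrite /= ger0_norm.
Qed.

Lemma integrable_le f g : measurable_fun setT f ->
  (forall x, `|f x| <= g x) -> mu.-integrable setT (EFin \o g) ->
  mu.-integrable setT (EFin \o f).
Proof.
move=> mf fg gi; apply: (le_integrable measurableT _ _ gi); first exact/measurable_EFinP.
by move=> x _; rewrite /= lee_fin (le_trans (fg x))// ler_norm.
Qed.

Lemma integrable_EFinD f g : mu.-integrable setT (EFin \o f) ->
  mu.-integrable setT (EFin \o g) -> mu.-integrable setT (EFin \o (fun x => f x + g x)).
Proof.
move=> fi gi; rewrite (_ : EFin \o _ = (EFin \o f) \+ (EFin \o g))%E//.
exact: integrableD.
Qed.

Lemma integrable_EFinB f g : mu.-integrable setT (EFin \o f) ->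
  mu.-integrable setT (EFin \o g) -> mu.-integrable setT (EFin \o (fun x => f x - g x)).
Proof.
move=> fi gi; rewrite (_ : EFin \o _ = (EFin \o f) \- (EFin \o g))%E//.
exact: integrableB.
Qed.

Lemma integrable_EFinZl (r : R) f : mu.-integrable setT (EFin \o f) ->
  mu.-integrable setT (EFin \o (fun x => r * f x)).
Proof.
move=> fi; rewrite (_ : EFin \o _ = fun x => r%:E * (EFin \o f) x)%E//.
exact: integrableZl.
Qed.

Lemma integrable_EFin_sum (I : Type) (s : seq I) (P : pred I) (F : I -> T -> R) :
  (forall i, P i -> mu.-integrable setT (EFin \o F i)) ->
  mu.-integrable setT (EFin \o (fun x => \sum_(i <- s | P i) F i x)).
Proof.
move=> Fi; elim: s => [|i s IH].
  rewrite (_ : EFin \o _ = cst 0)%E; first exact: integrable0.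
  by apply/funext => x; rewrite /= big_nil.
rewrite (_ : (fun x => _) =
    (fun x => (if P i then F i x else 0) + \sum_(i <- s | P i) F i x)); last first.
  by apply/funext => x; rewrite big_cons; case: ifP => //; rewrite add0r.
apply: integrable_EFinD => //.
by case: (boolP (P i)) => [Pi|_]; [exact: Fi|exact: integrable0].
Qed.

Lemma Rintegral_sum (I : Type) (s : seq I) (P : pred I) (F : I -> T -> R) :
  (forall i, P i -> mu.-integrable setT (EFin \o F i)) ->
  \int[mu]_x (\sum_(i <- s | P i) F i x) = \sum_(i <- s | P i) \int[mu]_x F i x.
Proof.
move=> Fi; elim: s => [|i s IH].
  rewrite big_nil; under eq_Rintegral do rewrite big_nil.
  by rewrite Rintegral_cst// mul0r.
rewrite big_cons; case: ifP => Pi; last first.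
  by rewrite -IH; apply: eq_Rintegral => x _; rewrite big_cons Pi.
rewrite -IH -RintegralD//; [|exact: Fi|exact: integrable_EFin_sum].
by apply: eq_Rintegral => x _; rewrite big_cons Pi.
Qed.

Lemma integrable_square_mul f g : measurable_fun setT f -> measurable_fun setT g ->
  mu.-integrable setT (EFin \o (fun x => f x ^+ 2)) ->
  mu.-integrable setT (EFin \o (fun x => g x ^+ 2)) ->
  mu.-integrable setT (EFin \o (fun x => f x * g x)).
Proof.
move=> mf mg fi gi.
apply: integrable_le (integrable_EFinD fi gi); first exact: measurable_funM.
move=> x; rewrite ler_norml.
by have := sqr_ge0 (f x + g x); have := sqr_ge0 (f x - g x); have := sqr_ge0 (f x);
  have := sqr_ge0 (g x); rewrite !expr2 => *; apply/andP; split; nra.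
Qed.
End integrable_facts.

Section probability_facts.
Variables (d : measure_display) (T : measurableType d) (R : realType).
Variable P : probability T R.

Lemma bounded_integrable (f : T -> R) (M : R) : measurable_fun setT f ->
  (forall x, `|f x| <= M) -> P.-integrable setT (EFin \o f).
Proof.
move=> mf fM; apply: integrable_le (finite_measure_integrable_cst P M measurableT) => //.
Qed.

Lemma Rintegral_cst1 (c : R) : \int[P]_x c = c.
Proof. rewrite Rintegral_cst//; have -> : fine (P setT) = 1 by rewrite probability_setT. by rewrite mulr1. Qed.

Lemma square_integrable (f : T -> R) : measurable_fun setT f ->
  P.-integrable setT (EFin \o (fun x => f x ^+ 2)) -> P.-integrable setT (EFin \o f).
Proof.
move=> mf fi; have c1 : P.-integrable setT (EFin \o (fun=> 1 ^+ 2 : R)).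
  exact: finite_measure_integrable_cst.
have m1 : measurable_fun [set: T] (fun=> 1 : R) by [].
have := integrable_square_mul mf m1 fi c1.
by under eq_fun do rewrite mulr1.
Qed.

Lemma Rintegral_norm_bound (f : T -> R) (M : R) : measurable_fun setT f ->
  (forall x, `|f x| <= M) -> `|\int[P]_x f x| <= M.
Proof.
move=> mf fM; have fi := bounded_integrable mf fM.
apply: le_trans (le_normr_Rintegral _ fi) _ => //.
rewrite -[leRHS]Rintegral_cst1; apply: le_Rintegral => //.
- exact: integrable_norm.
- exact: finite_measure_integrable_cst.
Qed.

End probability_facts.

(** Signed functions reduce to nonnegative ones by writing g as (|g| + g) - |g|. *)
Lemma integral_transfer d (T : measurableType d) d' (Y : measurableType d')
    (R : realType) (mu : {measure set T -> \bar R}) (Q : {measure set Y -> \bar R})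
    (h : T -> R) (X : T -> Y) (c : R) (g : Y -> R) :
  measurable_fun [set: T] h -> (forall w, 0 <= h w) -> measurable_fun [set: T] X ->
  0 <= c ->
  (forall A, measurable A ->
     (\int[mu]_w (h w * \1_A (X w))%:E = c%:E * Q A)%E) ->
  Q.-integrable setT (EFin \o g) ->
  mu.-integrable setT (EFin \o (fun w => h w * g (X w))) /\
  \int[mu]_w (h w * g (X w)) = c * \int[Q]_y g y.
Proof.
move=> mh h0 mX c0 H gi.
have mg := integrable_measurable gi.
have ti (k : Y -> R) : (forall y, 0 <= k y) -> Q.-integrable setT (EFin \o k) ->
    mu.-integrable setT (EFin \o (fun w => h w * k (X w))) /\
    \int[mu]_w (h w * k (X w)) = c * \int[Q]_y k y.
  move=> k0 ki; have mk := integrable_measurable ki.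
  have E := ge0_integral_transfer mh h0 mX c0 H mk k0.
  have hi : mu.-integrable setT (EFin \o (fun w => h w * k (X w))).
    apply: ge0_integrable => [|w|]; last by rewrite E RintegralE// -EFinM ltry.
      by apply: measurable_funM => //; exact: measurableT_comp.
    by rewrite mulr_ge0.
  by split => //; rewrite /Rintegral E RintegralE.
have gn : Q.-integrable setT (EFin \o (fun y => `|g y|)) by exact: integrable_norm.
have [ni nE] := ti _ (fun y => normr_ge0 (g y)) gn.
have g0 y : 0 <= `|g y| + g y by rewrite -lerBlDr sub0r ler_normr lexx orbT.
have [pi pE] := ti _ g0 (integrable_EFinD gn gi).
have E w : h w * g (X w) = h w * (`|g (X w)| + g (X w)) - h w * `|g (X w)| by ring.
split; first by under eq_fun do rewrite E; exact: integrable_EFinB.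
under eq_Rintegral do rewrite E.
by rewrite RintegralB// pE nE RintegralD//; ring.
Qed.

(** * Factorization of expectations under independence *)

Section iid_theory.
Variables (d : measure_display) (T : measurableType d)
  (dZ : measure_display) (Zs : measurableType dZ) (R : realType).
Variables (P : probability T R) (Q : probability Zs R) (Z : nat -> T -> Zs).
Hypothesis iidZ : iid_law P Q Z.

Let mZ j : measurable_fun setT (Z j). Proof. by have [+ _] := iidZ; apply. Qed.

Let q (A : set Zs) : R := fine (Q A).

Let QE A : measurable A -> (Q : {measure set Zs -> \bar R}) A = (q A)%:E.
Proof. by move=> mA; rewrite fineK// fin_num_measure. Qed.

Let prod_indic (J : seq nat) (A : nat -> set Zs) w :
  \prod_(j <- J) \1_(A j) (Z j w) =
  \1_(\bigcap_(j in [set j | j \in J]) (Z j @^-1` A j)) w :> R.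
Proof.
elim: J => [|j J IH].
  by rewrite big_nil (_ : \bigcap_(j in _) _ = setT) ?indicT//; apply/seteqP; split => // w' _ j.
rewrite big_cons IH (_ : \bigcap_(i in [set i | i \in j :: J]) _ =
    (Z j @^-1` A j) `&` \bigcap_(i in [set i | i \in J]) (Z i @^-1` A i)).
  by rewrite indicI.
apply/seteqP; split => w' /=.
  move=> H; split; first by apply: (H j); rewrite /= mem_head.
  by move=> i iJ; apply: H; rewrite /= inE iJ orbT.
move=> [Hj HJ] i; rewrite /= inE => /orP[/eqP->//|]; exact: HJ.
Qed.

Let measurable_prod_indic (J : seq nat) (A : nat -> set Zs) :
  (forall j, measurable (A j)) ->
  measurable_fun setT (fun w => \prod_(j <- J) \1_(A j) (Z j w) : R).
Proof.
move=> mA; elim: J => [|j J IH]; first by under eq_fun do rewrite big_nil; exact: measurable_cst.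
under eq_fun do rewrite big_cons.
by apply: measurable_funM => //; apply: measurableT_comp => //; exact: measurable_indic.
Qed.

Let prod_indic_ge0 (J : seq nat) (A : nat -> set Zs) w :
  0 <= \prod_(j <- J) \1_(A j) (Z j w) :> R.
Proof. by apply: prodr_ge0 => j _; rewrite indicE ler0n. Qed.

Let prod_indic_le1 (J : seq nat) (A : nat -> set Zs) w :
  `|\prod_(j <- J) \1_(A j) (Z j w) : R| <= 1.
Proof.
rewrite ger0_norm//; elim: J => [|j J IH]; first by rewrite big_nil.
by rewrite big_cons -[leRHS]mulr1 ler_pM// ?indicE ?ler0n// lern1 leq_b1.
Qed.

Let integral_prod_indic (J : seq nat) (A : nat -> set Zs) :
  uniq J -> (forall j, measurable (A j)) ->
  (\int[P]_w (\prod_(j <- J) \1_(A j) (Z j w))%:E = (\prod_(j <- J) q (A j))%:E)%E.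
Proof.
move=> uJ mA; under eq_integral do rewrite prod_indic.
have [_ [ZQ prodZ]] := iidZ.
have mcap : measurable (\bigcap_(j in [set j | j \in J]) (Z j @^-1` A j)).
  apply: fin_bigcap_measurable; first exact: finite_seq.
  by move=> j _; rewrite -[X in measurable X]setTI; exact: mZ.
rewrite integral_indic// setIT; apply: etrans (prodZ J A uJ mA) _.
elim: J {uJ mcap} => [|j J IH]; first by rewrite !big_nil.
by rewrite !big_cons IH ZQ// EFinM -QE.
Qed.

Lemma iid_transfer j (g : Zs -> R) : Q.-integrable setT (EFin \o g) ->
  P.-integrable setT (EFin \o (fun w => g (Z j w))) /\
  \int[P]_w g (Z j w) = \int[Q]_z g z.
Proof.
move=> gi.
have [||||||i E] := @integral_transfer _ T _ Zs R P Q (cst 1) (Z j) 1 g => //.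
  move=> A mA; rewrite mul1e QE//.
  have := @integral_prod_indic [:: j] (fun=> A) isT (fun=> mA).
  rewrite big_cons big_nil mulr1 => <-; apply: eq_integral => w _.
  by rewrite mul1r big_cons big_nil mulr1.
split; last by rewrite -[RHS]mul1r -E; apply: eq_Rintegral => w _; rewrite mul1r.
by under eq_fun do rewrite -[g _]mul1r.
Qed.

(** Two transfers in a row: the weight k (Z i) carries the integral over Z j, and its hypothesis on
    sets is a transfer over Z i with an indicator of Z j as weight. Only [f] has to be split into
    nonnegative parts, since [integral_transfer] already accepts a signed [g]. *)
Lemma iid_transfer2 i j (f g : Zs -> R) : i != j ->
  Q.-integrable setT (EFin \o f) -> Q.-integrable setT (EFin \o g) ->
  P.-integrable setT (EFin \o (fun w => f (Z i w) * g (Z j w))) /\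
  \int[P]_w (f (Z i w) * g (Z j w)) = (\int[Q]_z f z) * (\int[Q]_z g z).
Proof.
move=> ij fi gi.
have ge0 (k : Zs -> R) : (forall z, 0 <= k z) -> Q.-integrable setT (EFin \o k) ->
    P.-integrable setT (EFin \o (fun w => k (Z i w) * g (Z j w))) /\
    \int[P]_w (k (Z i w) * g (Z j w)) = (\int[Q]_z k z) * (\int[Q]_z g z).
  move=> k0 ki; have mk := integrable_measurable ki.
  have mkZ : measurable_fun setT (fun w => k (Z i w)) by exact: measurableT_comp.
  apply: (@integral_transfer _ T _ Zs R P Q (fun w => k (Z i w)) (Z j)) => //.
    by apply: Rintegral_ge0.
  move=> A mA; under eq_integral do rewrite mulrC.
  rewrite (@ge0_integral_transfer _ T _ Zs R P Q (fun w => \1_A (Z j w)) (Z i) (q A) k)//.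
  - by rewrite RintegralE// QE// -!EFinM mulrC.
  - by apply: measurableT_comp => //; exact: measurable_indic.
  - by rewrite fine_ge0.
  move=> A' mA'; rewrite QE// -EFinM.
  (* The independence hypothesis takes sets indexed by all natural numbers; only the indices i and j
     matter here. *)
  have mB l : measurable (if l == i then A' else A) by case: ifP.
  have uij : uniq [:: j; i] by rewrite /= inE eq_sym ij.
  have := integral_prod_indic uij mB.
  rewrite !big_cons !big_nil eqxx eq_sym (negbTE ij) !mulr1 => <-.
  apply: eq_integral => w _.
  by rewrite !big_cons !big_nil eqxx [j == i]eq_sym (negbTE ij) !mulr1.
have fn : Q.-integrable setT (EFin \o (fun y => `|f y|)) by exact: integrable_norm.
have [ni nE] := ge0 _ (fun y => normr_ge0 (f y)) fn.
have f0 y : 0 <= `|f y| + f y by rewrite -lerBlDr sub0r ler_normr lexx orbT.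
have [pi pE] := ge0 _ f0 (integrable_EFinD fn fi).
have E w : f (Z i w) * g (Z j w) =
  (`|f (Z i w)| + f (Z i w)) * g (Z j w) - `|f (Z i w)| * g (Z j w) by ring.
split; first by under eq_fun do rewrite E; exact: integrable_EFinB.
under eq_Rintegral do rewrite E.
by rewrite RintegralB// pE nE RintegralD//; ring.
Qed.

(* [F] is bounded and independent of [Z n], [Z n.+1], ... *)
Definition indep_from n (F : T -> R) :=
  [/\ measurable_fun setT F, exists M, forall w, `|F w| <= M &
   forall k (A : nat -> set Zs), (forall j, measurable (A j)) ->
     \int[P]_w (F w * \prod_(j <- iota n k) \1_(A j) (Z j w)) =
     (\int[P]_w F w) * \prod_(j <- iota n k) q (A j)].

Lemma indep_from_cst n c : indep_from n (cst c).
Proof.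
split; [by []|by exists (`|c| : R) |].
move=> k A mA.
rewrite RintegralZl//; last first.
  by apply: (bounded_integrable _ (M := 1)) => //; exact: measurable_prod_indic.
rewrite Rintegral_cst1; congr (_ * _).
by rewrite /Rintegral integral_prod_indic// iota_uniq.
Qed.

Lemma indep_from_bounded n F : indep_from n F -> P.-integrable setT (EFin \o F).
Proof. by move=> [mF [M FM] _]; exact: (bounded_integrable _ (M := M)). Qed.

Let indep_integrable n F J (A : nat -> set Zs) : indep_from n F -> (forall j, measurable (A j)) ->
  P.-integrable setT (EFin \o (fun w => F w * \prod_(j <- J) \1_(A j) (Z j w))).
Proof.
move=> [mF [M FM] _] mA; apply: (bounded_integrable _ (M := M)).
  by apply: measurable_funM => //; exact: measurable_prod_indic.
by move=> w; rewrite normrM -[leRHS]mulr1 ler_pM.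
Qed.

Lemma indep_from_lin n a b F G : indep_from n F -> indep_from n G ->
  indep_from n (fun w => a * F w + b * G w).
Proof.
move=> iF iG; have Fi := indep_from_bounded iF; have Gi := indep_from_bounded iG.
have [mF [M FM] FI] := iF; have [mG [N GN] GI] := iG.
split; first by apply: measurable_funD; exact: measurable_funM.
  exists (`|a| * M + `|b| * N) => w.
  by rewrite (le_trans (ler_normD _ _))// !normrM lerD// ler_wpM2l.
move=> k A mA.
have E w : (a * F w + b * G w) * \prod_(j <- iota n k) \1_(A j) (Z j w) =
    a * (F w * \prod_(j <- iota n k) \1_(A j) (Z j w)) +
    b * (G w * \prod_(j <- iota n k) \1_(A j) (Z j w)) by ring.
have iF' := indep_integrable (iota n k) iF mA.
have iG' := indep_integrable (iota n k) iG mA.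
under eq_Rintegral do rewrite E.
rewrite RintegralD//; [|exact: integrable_EFinZl|exact: integrable_EFinZl].
rewrite !RintegralZl// FI// GI//.
rewrite RintegralD//; [|exact: integrable_EFinZl|exact: integrable_EFinZl].
by rewrite !RintegralZl//; ring.
Qed.

(** The invariant for adding one variable at a time. It tests [F] only against products of
    indicators, so the joint law of the first variables is never formed; transfer over Z n with
    weight [F] times indicators of later variables gives both claims. *)
Lemma indep_from_step n F (g : Zs -> R) (N : R) : indep_from n F ->
  measurable_fun setT g -> (forall z, `|g z| <= N) ->
  indep_from n.+1 (fun w => F w * g (Z n w)) /\
  \int[P]_w (F w * g (Z n w)) = (\int[P]_w F w) * \int[Q]_z g z.
Proof.
move=> iF mg gN; have [mF [M1 FM1] _] := iF.
pose M := `|M1|; have M0' : 0 <= M by rewrite /M normr_ge0.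
have FM w : `|F w| <= M by rewrite (le_trans (FM1 w))// ler_norm.
have gi : Q.-integrable setT (EFin \o g) by exact: (bounded_integrable _ (M := N)).
have mgZ : measurable_fun setT (fun w => g (Z n w)) by exact: measurableT_comp.
have ge0 (G : T -> R) k A : (forall j, measurable (A j)) -> indep_from n G ->
    (forall w, 0 <= G w) ->
    P.-integrable setT (EFin \o (fun w => G w * \prod_(j <- iota n.+1 k) \1_(A j) (Z j w) * g (Z n w))) /\
    \int[P]_w (G w * \prod_(j <- iota n.+1 k) \1_(A j) (Z j w) * g (Z n w)) =
    (\int[P]_w G w) * \prod_(j <- iota n.+1 k) q (A j) * \int[Q]_z g z.
  move=> mA iG G0; have [mG [M' GM'] GI] := iG.
  apply: (@integral_transfer _ T _ Zs R P Q
    (fun w => G w * \prod_(j <- iota n.+1 k) \1_(A j) (Z j w)) (Z n)) => //.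
  - by apply: measurable_funM => //; exact: measurable_prod_indic.
  - by move=> w; rewrite mulr_ge0.
  - by rewrite mulr_ge0 ?Rintegral_ge0// prodr_ge0// => j _; rewrite fine_ge0.
  move=> A' mA'.
  (* The list [iota n k.+1] starts with n, which is where the test set of Z n is inserted. *)
  pose B j := if j == n then A' else A j.
  have mB j : measurable (B j) by rewrite /B; case: ifP.
  have BE j : j \in iota n.+1 k -> B j = A j.
    by rewrite mem_iota /B => /andP[nj _]; rewrite gtn_eqF.
  have E w : G w * \prod_(j <- iota n k.+1) \1_(B j) (Z j w) =
      G w * \prod_(j <- iota n.+1 k) \1_(A j) (Z j w) * \1_A' (Z n w) :> R.
    rewrite /= big_cons {1}/B eqxx [_ * \prod_(j <- _) _]mulrC mulrA.
    by congr (_ * _ * _); apply: eq_big_seq => j jk; rewrite BE.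
  have := GI k.+1 B mB; rewrite /= [in RHS]big_cons {2}/B eqxx.
  have -> : \prod_(j <- iota n.+1 k) q (B j) = \prod_(j <- iota n.+1 k) q (A j).
    by apply: eq_big_seq => j jk; rewrite BE.
  move=> h; rewrite QE// -EFinM -mulrA [_ * q A']mulrC -h -RintegralE.
    by apply: eq_integral => w _; rewrite E.
  exact: (indep_integrable (iota n k.+1) iG mB).
(* Adding the bound [M] makes the weight nonnegative; the constant [M] is itself an admissible
   weight and is subtracted afterwards. *)
have M0 w : 0 <= F w + M by rewrite -lerBlDr sub0r lerNl (le_trans _ (FM w))// ler_normr lexx orbT.
have iFM : indep_from n (fun w => F w + M).
  have := indep_from_lin 1 1 iF (indep_from_cst n M).
  by under eq_fun do rewrite !mul1r.
have iM := indep_from_cst n M.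
have main k A : (forall j, measurable (A j)) ->
    \int[P]_w (F w * g (Z n w) * \prod_(j <- iota n.+1 k) \1_(A j) (Z j w)) =
    (\int[P]_w F w) * (\int[Q]_z g z) * \prod_(j <- iota n.+1 k) q (A j).
  move=> mA.
  have [i1 E1] := ge0 _ k A mA iFM M0.
  have [i2 E2] := ge0 _ k A mA iM (fun=> M0').
  have E w : F w * g (Z n w) * \prod_(j <- iota n.+1 k) \1_(A j) (Z j w) =
    (F w + M) * \prod_(j <- iota n.+1 k) \1_(A j) (Z j w) * g (Z n w) -
    M * \prod_(j <- iota n.+1 k) \1_(A j) (Z j w) * g (Z n w) by ring.
  under eq_Rintegral do rewrite E.
  rewrite RintegralB// E1 E2 RintegralD ?Rintegral_cst1//; first by ring.
  - exact: indep_from_bounded iF.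
  - exact: indep_from_bounded iM.
(* With no later variable, the identity is the factorization of the expectation. *)
have E0 := main 0%N (fun=> setT) (fun=> measurableT).
have {}E0 : \int[P]_w (F w * g (Z n w)) = (\int[P]_w F w) * \int[Q]_z g z.
  by move: E0; rewrite /= big_nil mulr1 => <-; apply: eq_Rintegral => w _; rewrite big_nil mulr1.
split => //; split; first exact: measurable_funM.
  exists (M * N) => w; rewrite normrM ler_pM//.
by move=> k A mA; rewrite main// E0.
Qed.

End iid_theory.

(** * Law of large numbers and central limit theorem *)

Section trig_bounds.
Variable R : realType.
Implicit Types x y : R.

Lemma MVT0 (f df : R -> R) x : (forall y, is_derive y 1 f (df y)) ->
  exists2 c, `|c| <= `|x| & f x - f 0 = df c * x.
Proof.
move=> fdf.
have fc (a b : R) : {within `[a, b], continuous f}.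
  apply: continuous_subspaceT => y; apply/differentiable_continuous/derivable1_diffP.
  by have [] := fdf y.
have [x0|x0] := leP 0 x.
  have [//|c + ->] := @MVT_segment _ f df 0 x x0 (fun y _ => fdf y).
  rewrite in_itv/= => /andP[c0 cx]; exists c; last by rewrite subr0.
  by rewrite !ger0_norm.
have [//|c + E] := @MVT_segment _ f df x 0 (ltW x0) (fun y _ => fdf y).
rewrite in_itv/= => /andP[cx c0]; exists c; first by rewrite !ler0_norm ?lerN2// ltW.
by rewrite -opprB E sub0r mulrN opprK.
Qed.

Lemma normr_sin_le x : `|sin x| <= `|x|.
Proof.
have [c _] := @MVT0 sin cos x (@is_derive_sin R).
rewrite sin0 subr0 => ->; rewrite normrM.
by rewrite -[leRHS]mul1r ler_wpM2r// cos_max.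
Qed.

Lemma cos_sub1_bound x : `|cos x - 1| <= x ^+ 2 / 2.
Proof.
have -> : cos x - 1 = - (2 * sin (x / 2) ^+ 2).
  have -> : cos x = cos ((x / 2) *+ 2) by rewrite -mulr_natr divfK.
  by rewrite cos_mulr2n cos2sin2 -mulr_natr; ring.
rewrite normrN normrM [`|2|]ger0_norm// normrX.
have -> : x ^+ 2 / 2 = 2 * `|x / 2| ^+ 2 by rewrite -normrX ger0_norm ?sqr_ge0//; field.
by rewrite ler_pM2l// lerXn2r ?nnegrE// normr_sin_le.
Qed.

(** Cosine and sine each get two remainder bounds. In the central limit theorem the quadratic ones
    give the integrable majorant [xi z ^+ 2], the higher-order ones give pointwise convergence. The
    constants are not sharp. *)
Lemma cos_taylor2 x : `|cos x - 1 + x ^+ 2 / 2| <= x ^+ 2.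
Proof.
apply: le_trans (ler_normD _ _) _; have := cos_sub1_bound x.
rewrite [`|_ / 2|]ger0_norm ?divr_ge0 ?sqr_ge0//.
by lra.
Qed.

Lemma sin_taylor3 x : `|sin x - x| <= `|x| ^+ 3.
Proof.
have [c cx] := @MVT0 (fun y => sin y - y) (fun y => cos y - 1) x _.
rewrite sin0 !subr0 => ->; rewrite normrM exprSr ler_wpM2r//.
apply: le_trans (cos_sub1_bound c) _.
have : c ^+ 2 <= `|x| ^+ 2 by rewrite -real_normK ?num_real// lerXn2r ?nnegrE.
by have := sqr_ge0 c; lra.
Qed.

Lemma sin_taylor2 x : `|sin x - x| <= x ^+ 2.
Proof.
have [c cx] := @MVT0 (fun y => sin y - y) (fun y => cos y - 1) x _.
rewrite sin0 !subr0 => ->; rewrite normrM -[x ^+ 2]real_normK ?num_real// expr2.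
rewrite ler_wpM2r//; apply: le_trans cx.
(* It remains to see that |cos c - 1| is at most |c|: by c^2 / 2 for |c| up to 2, and by the trivial
   bound 2 beyond. *)
have [c2|c2] := leP `|c| 2.
  apply: le_trans (cos_sub1_bound c) _; rewrite -real_normK ?num_real//.
  by have := normr_ge0 c; nra.
apply: le_trans (ltW c2); apply: le_trans (ler_normB _ _) _.
by rewrite normr1 -[leRHS]/(1 + 1) lerD2r cos_max.
Qed.

Lemma cos_taylor4 x : `|cos x - 1 + x ^+ 2 / 2| <= x ^+ 4.
Proof.
have [|c cx] := @MVT0 (fun y => cos y - 1 + 2^-1 *: (y ^+ 2)) (fun y => - sin y + y) x.
  move=> y; apply: is_derive_eq.
  by rewrite /GRing.scale/=; field.
rewrite /GRing.scale/= [2^-1 * _]mulrC.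
rewrite cos0 subrr expr0n mulr0 addr0 subr0 => ->; rewrite normrM.
rewrite addrC -normrN opprB.
have -> : x ^+ 4 = `|x| ^+ 3 * `|x| by rewrite -exprSr -normrX ger0_norm// exprn_even_ge0.
rewrite ler_wpM2r//; apply: le_trans (sin_taylor3 c) _.
by rewrite lerXn2r ?nnegrE.
Qed.

(** Both sides come from exp x being at least 1 + x: at -y it gives the lower bound, at y it gives
    exp (-y) at most 1 / (1 + y), which exceeds 1 - y by y^2 / (1 + y). *)
Lemma expRN_taylor2 y : 0 <= y -> `|expR (- y) - (1 - y)| <= y ^+ 2.
Proof.
move=> y0; have e1 := expR_ge1Dx (- y); have e2 := expR_ge1Dx y.
rewrite ger0_norm ?subr_ge0// lerBlDr.
have y1 : 0 < 1 + y by lra.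
rewrite expRN (@le_trans _ _ (1 + y)^-1)//.
  by rewrite lef_pV2// posrE ?expR_gt0.
rewrite -[leLHS]mul1r ler_pdivrMr//; have := mulr_ge0 y0 (sqr_ge0 y); nra.
Qed.

End trig_bounds.

Lemma Rintegral_dominated d (T : measurableType d) (R : realType)
    (mu : {measure set T -> \bar R}) (f_ : nat -> T -> R) (f g : T -> R) :
  (forall n, measurable_fun setT (f_ n)) ->
  (forall x, f_ n x @[n --> \oo] --> f x) ->
  mu.-integrable setT (EFin \o g) -> (forall n x, `|f_ n x| <= g x) ->
  \int[mu]_x f_ n x @[n --> \oo] --> \int[mu]_x f x.
Proof.
move=> mf ff gi fg.
have Ef x : ((f_ n x)%:E @[n --> \oo] --> (f x)%:E)%E by apply/cvg_EFin; [exact: nearW|exact: ff].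
have mlim : measurable_fun setT (EFin \o f).
  apply: (emeasurable_fun_cvg (fun n => EFin \o f_ n)) => [n|x _]; last exact: Ef.
  exact/measurable_EFinP.
have [|||||fi _ H] := @dominated_convergence _ T R mu setT measurableT
   (fun n => EFin \o f_ n) (EFin \o f) (EFin \o g).
- by move=> n; exact/measurable_EFinP.
- exact: mlim.
- by apply: aeW => x _; exact: Ef.
- exact: gi.
- by apply: aeW => x n _; rewrite /= lee_fin.
by apply: fine_cvg; rewrite fineK//; exact: integrable_fin_num.
Qed.

Section iid_limits.
Variables (d : measure_display) (T : measurableType d)
  (dZ : measure_display) (Zs : measurableType dZ) (R : realType).
Variables (P : probability T R) (Q : probability Zs R) (Z : nat -> T -> Zs).
Hypothesis iidZ : iid_law P Q Z.

Lemma probability_square_tail (f : T -> R) (K v : R) : measurable_fun setT f ->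
  P.-integrable setT (EFin \o (fun w => f w ^+ 2)) -> \int[P]_w (f w ^+ 2) <= v ->
  0 < K ->
  measurable [set w | `|f w| <= K] /\ (P (~` [set w | (`|f w| <= K)%R]) <= ((v / K ^+ 2)%R)%:E)%E.
Proof.
move=> mf fi fv K0.
have mf2 : measurable_fun setT (fun w => (f w ^+ 2)%:E).
  by apply/measurable_EFinP; exact: measurable_funX.
have E : [set w | `|f w| <= K] = [set w | (((f w ^+ 2)%R)%:E <= ((K ^+ 2)%R)%:E)%E].
  apply/funext => w; apply/propext; rewrite /= lee_fin -[f w ^+ 2]real_normK ?num_real//.
  by rewrite ler_pXn2r ?nnegrE// ltW.
split.
  rewrite -[X in measurable X]setTI; apply: measurable_fun_le => //.
  by apply: measurableT_comp.
rewrite E; apply: le_trans (markov_ge0 P mf2 _ _) _ => //.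
- by move=> w; rewrite lee_fin sqr_ge0.
- by rewrite exprn_gt0.
by rewrite RintegralE// -EFinM lee_fin mulrC ler_wpM2r// invr_ge0 exprn_ge0// ltW.
Qed.

Lemma iid_measurable_sum (xi : Zs -> R) n : measurable_fun setT xi ->
  measurable_fun setT (fun w => \sum_(j < n) xi (Z j w)).
Proof.
move=> mxi; apply: measurable_sum => j.
by apply: measurableT_comp => //; have [+ _] := iidZ; apply.
Qed.

(** The mixed terms vanish because the variables are centred and pairwise independent. *)
Lemma iid_sum_square (xi : Zs -> R) n : measurable_fun setT xi ->
  Q.-integrable setT (EFin \o (fun z => xi z ^+ 2)) -> \int[Q]_z xi z = 0 ->
  P.-integrable setT (EFin \o (fun w => (\sum_(j < n) xi (Z j w)) ^+ 2)) /\
  \int[P]_w (\sum_(j < n) xi (Z j w)) ^+ 2 = n%:R * \int[Q]_z (xi z ^+ 2).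
Proof.
move=> mxi xi2 xi0; have xi1 := square_integrable mxi xi2.
have E w : (\sum_(j < n) xi (Z j w)) ^+ 2 =
    \sum_(i < n) \sum_(j < n) xi (Z i w) * xi (Z j w).
  by rewrite expr2 big_distrlr.
have pair i j : P.-integrable setT (EFin \o (fun w => xi (Z i w) * xi (Z j w))) /\
    \int[P]_w (xi (Z i w) * xi (Z j w)) = if i == j then \int[Q]_z (xi z ^+ 2) else 0.
  case: (eqVneq i j) => [->|ij].
    have [i2 E2] := iid_transfer iidZ j xi2.
    split; first by under eq_fun do rewrite -expr2.
    by rewrite -E2; apply: eq_Rintegral => w _; rewrite expr2.
  by have [i2 ->] := iid_transfer2 iidZ ij xi1 xi1; rewrite xi0 mul0r.
split.
  under eq_fun do rewrite E.
  by apply: integrable_EFin_sum => i _; apply: integrable_EFin_sum => j _; have [] := pair i j.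
under eq_Rintegral do rewrite E.
rewrite Rintegral_sum; last first.
  by move=> i _; apply: integrable_EFin_sum => j _; have [] := pair i j.
rewrite (eq_bigr (fun=> \int[Q]_z (xi z ^+ 2))); last first.
  move=> i _; rewrite Rintegral_sum; last by move=> j _; have [] := pair i j.
  rewrite (bigD1 i)//= big1 ?addr0; first by have [_ ->] := pair i i; rewrite eqxx.
  move=> j ji; have [_ ->] := pair i j.
  by rewrite eq_sym -val_eqE/= in ji; rewrite (negbTE ji).
by rewrite sumr_const card_ord mulr_natl.
Qed.

Lemma iid_sum_tail (xi : Zs -> R) n (K : R) : measurable_fun setT xi ->
  Q.-integrable setT (EFin \o (fun z => xi z ^+ 2)) -> \int[Q]_z xi z = 0 -> 0 < K ->
  measurable [set w | `|\sum_(j < n) xi (Z j w)| <= K] /\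
  (P (~` [set w | (`|\sum_(j < n) xi (Z j w)| <= K)%R]) <=
    ((n%:R * \int[Q]_z (xi z ^+ 2) / K ^+ 2)%R)%:E)%E.
Proof.
move=> mxi xi2 xi0 K0; have [i2 E2] := iid_sum_square n mxi xi2 xi0.
by apply: probability_square_tail => //; [exact: iid_measurable_sum|rewrite E2].
Qed.

Let measurable_indic_ler (g : Zs -> R) M : measurable_fun setT g ->
  measurable_fun setT (fun z => (`|g z| <= M)%R%:R : R).
Proof.
move=> mg; rewrite (_ : (fun z => _) = \1_[set z | `|g z| <= M]).
  apply: measurable_indic; rewrite -[X in measurable X]setTI.
  by apply: measurable_fun_le => //; exact: measurableT_comp.
by apply/funext => z; rewrite indicE; congr (_%:R); rewrite mem_setE.
Qed.

Lemma truncation_approx (g : Zs -> R) (e : R) : Q.-integrable setT (EFin \o g) -> 0 < e ->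
  exists M, \int[Q]_z `|g z - g z * (`|g z| <= M)%R%:R| <= e.
Proof.
move=> gi e0; have mg := integrable_measurable gi.
pose f (n : nat) z := `|g z - g z * (`|g z| <= n%:R)%R%:R|.
have mf n : measurable_fun setT (f n).
  apply: measurableT_comp => //; apply: measurable_funB => //; apply: measurable_funM => //.
  exact: measurable_indic_ler.
have gn : Q.-integrable setT (EFin \o (fun y => `|g y|)) by exact: integrable_norm.
have fg n z : `|f n z| <= `|g z|.
  by rewrite /f normr_id; case: (`|g z| <= n%:R); rewrite ?mulr1 ?mulr0 ?subrr ?subr0 ?normr0.
have f0 z : f n z @[n --> \oo] --> 0.
  apply: cvg_near_cst; have := nbhs_infty_ger `|g z|; apply: filterS => n gz.
  by rewrite /f gz mulr1 subrr normr0.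
have := Rintegral_dominated mf f0 gn fg.
rewrite (_ : \int[Q]_x 0 = 0); last by rewrite Rintegral_cst1.
move=> /cvgrPdist_le/(_ _ e0)[N _ /(_ N (leqnn _))/=].
rewrite sub0r normrN => le; exists N%:R; apply: le_trans le.
exact: ler_norm.
Qed.

Lemma iid_LLN (g : Zs -> R) (e : R) : Q.-integrable setT (EFin \o g) -> 0 < e ->
  whp P (fun n => [set w | `|n%:R^-1 * \sum_(j < n) g (Z j w) - \int[Q]_z g z| <= e]).
Proof.
move=> gi e0 eta eta0; have mg := integrable_measurable gi.
have gn : Q.-integrable setT (EFin \o (fun y => `|g y|)) by exact: integrable_norm.
pose e3 := e / 3; have e30 : 0 < e3 by rewrite divr_gt0.
(* The first entry of the minimum keeps the bias of the truncated mean below e / 3; the second makes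
   Markov's inequality for the discarded part cost at most eta / 2. *)
pose dl := e3 * Num.min 1 (eta / 2).
have m0 : 0 < Num.min 1 (eta / 2) by rewrite lt_min ltr01 divr_gt0.
have dl0 : 0 < dl by rewrite mulr_gt0.
have [M hM] := truncation_approx gi dl0.
pose g1 z := g z * (`|g z| <= M)%R%:R.
have mg1 : measurable_fun setT g1.
  apply: measurable_funM => //; exact: measurable_indic_ler.
have g1M z : `|g1 z| <= `|M|.
  rewrite /g1; case: (boolP (`|g z| <= M)) => gM; rewrite ?mulr1 ?mulr0 ?normr0//.
  by rewrite (le_trans gM)// ler_norm.
have g1i : Q.-integrable setT (EFin \o g1) by exact: bounded_integrable g1M.
pose g2 z := `|g z - g1 z|.
have g2i : Q.-integrable setT (EFin \o g2).
  by apply: integrable_norm => //; exact: integrable_EFinB.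
pose mu1 := \int[Q]_z g1 z.
pose xi z := g1 z - mu1.
have mxi : measurable_fun setT xi by exact: measurable_funB.
have xiM z : `|xi z ^+ 2| <= (`|M| + `|mu1|) ^+ 2.
  rewrite normrX lerXn2r ?nnegrE ?addr_ge0//.
  by rewrite (le_trans (ler_normB _ _))// lerD2r.
have xi2 : Q.-integrable setT (EFin \o (fun z => xi z ^+ 2)).
  by apply: bounded_integrable xiM; exact: measurable_funX.
have xi0 : \int[Q]_z xi z = 0.
  rewrite RintegralB ?Rintegral_cst1 ?subrr//.
  exact: finite_measure_integrable_cst.
pose v := \int[Q]_z (xi z ^+ 2).
(* Chebyshev's inequality for the truncated variables costs v / (e3^2 n), which is at most eta / 2
   from here on. *)
have [N _ HN] := nbhs_infty_ger (v / e3 ^+ 2 / (eta / 2)).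
exists N.+1 => n nN; have n0 : 0 < n%:R :> R by rewrite ltr0n (leq_trans _ nN).
have en0 : 0 < e3 * n%:R by rewrite mulr_gt0.
have [mA PA] := iid_sum_tail n mxi xi2 xi0 en0.
pose S2 w := n%:R^-1 * \sum_(j < n) g2 (Z j w).
have mS2 : measurable_fun setT (EFin \o S2).
  apply/measurable_EFinP; apply: measurable_funM => //.
  by apply: iid_measurable_sum; exact: integrable_measurable g2i.
have S20 w : (0 <= (EFin \o S2) w)%E.
  by rewrite /= lee_fin mulr_ge0// sumr_ge0// => j _; exact: normr_ge0.
have PB := markov_ge0 P mS2 S20 e30.
have mB : measurable [set w | ((EFin \o S2) w <= e3%:E)%E].
  rewrite -[X in measurable X]setTI; apply: emeasurable_fun_infty_c => //.
exists ([set w | `|\sum_(j < n) xi (Z j w)| <= e3 * n%:R] `&`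
        [set w | ((EFin \o S2) w <= e3%:E)%E]); split.
- exact: measurableI.
- move=> w [/= h1]; rewrite lee_fin => h2.
  (* Centred truncated part, discarded part and bias, with e / 3 for each. *)
  have -> : n%:R^-1 * \sum_(j < n) g (Z j w) - \int[Q]_z g z =
      n%:R^-1 * \sum_(j < n) xi (Z j w) +
      n%:R^-1 * \sum_(j < n) (g (Z j w) - g1 (Z j w)) +
      (mu1 - \int[Q]_z g z).
    rewrite /xi !sumrB sumr_const card_ord -[mu1 *+ n]mulr_natl.
    by field; rewrite gt_eqF.
  have h3 : `|mu1 - \int[Q]_z g z| <= e3.
    rewrite -opprB normrN -RintegralB//.
    apply: le_trans (le_normr_Rintegral _ _) _ => //; first exact: integrable_EFinB.
    apply: le_trans hM _; rewrite /dl -[leRHS]mulr1 ler_pM2l//.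
    by rewrite ge_min lexx.
  have h4 : `|n%:R^-1 * \sum_(j < n) xi (Z j w)| <= e3.
    by rewrite normrM ger0_norm ?invr_ge0// ler_pdivrMl// mulrC.
  have h5 : `|n%:R^-1 * \sum_(j < n) (g (Z j w) - g1 (Z j w))| <= e3.
    rewrite normrM ger0_norm ?invr_ge0//; apply: le_trans h2.
    by rewrite ler_wpM2l ?invr_ge0// ler_norm_sum.
  have -> : e = e3 + e3 + e3 by rewrite /e3; field.
  apply: le_trans (ler_normD _ _) _; apply: lerD => //.
  by apply: le_trans (ler_normD _ _) _; exact: lerD.
rewrite [eta]splitr; apply: probability_setCI_le => //.
  apply: le_trans PA _; rewrite lee_fin.
  have := HN n (ltnW nN); rewrite /= ler_pdivrMr ?divr_gt0// => h.
  have -> : n%:R * v / (e3 * n%:R) ^+ 2 = v / e3 ^+ 2 / n%:R.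
    by field; rewrite !gt_eqF.
  by rewrite ler_pdivrMr// [leRHS]mulrC.
apply: le_trans PB _.
have iS2 : P.-integrable setT (EFin \o (fun w => \sum_(j < n) g2 (Z j w))).
  by apply: integrable_EFin_sum => j _; have [] := iid_transfer iidZ j g2i.
rewrite RintegralE//; last exact: integrable_EFinZl.
rewrite -EFinM lee_fin RintegralZl// Rintegral_sum; last first.
  by move=> j _; have [] := iid_transfer iidZ j g2i.
rewrite (eq_bigr (fun=> \int[Q]_z g2 z)); last by move=> j _; have [] := iid_transfer iidZ j g2i.
rewrite sumr_const card_ord -(mulr_natl (\int[Q]_z g2 z)) mulKf ?gt_eqF//.
rewrite ler_pdivrMl//; apply: le_trans hM _; rewrite /dl ler_pM2l//.
by rewrite ge_min lexx orbT.
Qed.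

End iid_limits.

(** * Characteristic functions of normalized sums *)

Section iid_clt.
Variables (d : measure_display) (T : measurableType d)
  (dZ : measure_display) (Zs : measurableType dZ) (R : realType).
Variables (P : probability T R) (Q : probability Zs R) (Z : nat -> T -> Zs).
Hypothesis iidZ : iid_law P Q Z.

Lemma measurable_cos : measurable_fun [set: R] (@cos R).
Proof. by apply: continuous_measurable_fun; exact: continuous_cos. Qed.

Lemma measurable_sin : measurable_fun [set: R] (@sin R).
Proof. by apply: continuous_measurable_fun; exact: continuous_sin. Qed.

(* [E exp(i S_n) = (E exp(i xi))^n], compared with a real power [w^n]. *)
Lemma iid_cos_sin_sum (xi : Zs -> R) (w : R) n : measurable_fun setT xi -> 0 <= w <= 1 ->
  let a := \int[Q]_z cos (xi z) in let b := \int[Q]_z sin (xi z) in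
  let S o := \sum_(j < n) xi (Z j o) in
  `|\int[P]_o cos (S o) - w ^+ n| <= n%:R * (`|a - w| + `|b|) /\
  `|\int[P]_o sin (S o)| <= n%:R * (`|a - w| + `|b|).
Proof.
move=> mxi /andP[w0 w1] a b /=.
have mc : measurable_fun setT (cos \o xi) by apply: measurableT_comp => //; exact: measurable_cos.
have ms : measurable_fun setT (sin \o xi) by apply: measurableT_comp => //; exact: measurable_sin.
have c1 z : `|(cos \o xi) z| <= 1 by exact: cos_max.
have s1 z : `|(sin \o xi) z| <= 1 by exact: sin_max.
suff : [/\ indep_from P Q Z n (fun o => cos (\sum_(j < n) xi (Z j o))),
  indep_from P Q Z n (fun o => sin (\sum_(j < n) xi (Z j o))),
  `|\int[P]_o cos (\sum_(j < n) xi (Z j o)) - w ^+ n| <= n%:R * (`|a - w| + `|b|) &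
  `|\int[P]_o sin (\sum_(j < n) xi (Z j o))| <= n%:R * (`|a - w| + `|b|)] by case.
elim: n => [|n [ic is_ Ec Es]].
  have -> : (fun o => cos (\sum_(j < 0) xi (Z j o))) = cst 1.
    by apply/funext => o; rewrite big_ord0 cos0.
  have -> : (fun o => sin (\sum_(j < 0) xi (Z j o))) = cst 0.
    by apply/funext => o; rewrite big_ord0 sin0.
  split; [exact: indep_from_cst|exact: indep_from_cst| |];
    by rewrite Rintegral_cst1 ?expr0 ?subrr normr0 mul0r.
have [icc Ecc] := indep_from_step iidZ ic mc c1.
have [ics Ecs] := indep_from_step iidZ ic ms s1.
have [isc Esc] := indep_from_step iidZ is_ mc c1.
have [iss Ess] := indep_from_step iidZ is_ ms s1.
have EC o : cos (\sum_(j < n.+1) xi (Z j o)) =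
    1 * (cos (\sum_(j < n) xi (Z j o)) * (cos \o xi) (Z n o)) +
    (-1) * (sin (\sum_(j < n) xi (Z j o)) * (sin \o xi) (Z n o)).
  by rewrite big_ord_recr/= cosD; ring.
have ES o : sin (\sum_(j < n.+1) xi (Z j o)) =
    1 * (sin (\sum_(j < n) xi (Z j o)) * (cos \o xi) (Z n o)) +
    1 * (cos (\sum_(j < n) xi (Z j o)) * (sin \o xi) (Z n o)).
  by rewrite big_ord_recr/= sinD; ring.
have iC := indep_from_lin iidZ 1 (-1) icc iss.
have iS := indep_from_lin iidZ 1 1 isc ics.
have lin F G (x y : R) : indep_from P Q Z n.+1 F -> indep_from P Q Z n.+1 G ->
    \int[P]_o (x * F o + y * G o) = x * (\int[P]_o F o) + y * (\int[P]_o G o).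
  move=> /indep_from_bounded iF /indep_from_bounded iG.
  by rewrite RintegralD ?RintegralZl//; exact: integrable_EFinZl.
have AC : `|\int[P]_o cos (\sum_(j < n) xi (Z j o))| <= 1.
  by apply: Rintegral_norm_bound => [|o]; [case: ic|exact: cos_max].
have BC : `|\int[P]_o sin (\sum_(j < n) xi (Z j o))| <= 1.
  by apply: Rintegral_norm_bound => [|o]; [case: is_|exact: sin_max].
split; [by under eq_fun do rewrite EC|by under eq_fun do rewrite ES| |].
  under eq_Rintegral do rewrite EC.
  rewrite lin// Ecc Ess -/a -/b.
  move: AC BC Ec Es; set A := \int[P]_o cos _; set B := \int[P]_o sin _ => AC BC Ec Es.
  (* As 0 <= w <= 1 the previous error is not amplified, and as |A| and |B| are at most 1 the new
     variable adds at most |a - w| + |b|. *)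
  have -> : 1 * (A * a) + -1 * (B * b) - w ^+ n.+1 =
      w * (A - w ^+ n) + ((a - w) * A - B * b) by rewrite exprS; ring.
  apply: le_trans (ler_normD _ _) _.
  rewrite -natr1 [leRHS]mulrDl mul1r lerD//.
    rewrite normrM ger0_norm// -[leRHS]mul1r ler_pM//.
  apply: le_trans (ler_normB _ _) _; rewrite !normrM lerD//.
    by rewrite -[leRHS]mulr1 ler_pM.
  by rewrite -[leRHS]mul1r ler_pM.
under eq_Rintegral do rewrite ES.
rewrite lin// Esc Ecs -/a -/b.
move: AC BC Ec Es; set A := \int[P]_o cos _; set B := \int[P]_o sin _ => AC BC Ec Es.
have -> : 1 * (B * a) + 1 * (A * b) = w * B + ((a - w) * B + A * b) by ring.
apply: le_trans (ler_normD _ _) _.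
rewrite -natr1 [leRHS]mulrDl mul1r lerD//.
  rewrite normrM ger0_norm// -[leRHS]mul1r ler_pM//.
apply: le_trans (ler_normD _ _) _; rewrite !normrM lerD//.
  by rewrite -[leRHS]mulr1 ler_pM.
by rewrite -[leRHS]mul1r ler_pM.
Qed.

(** The comparison value w = exp (- v / (2 n)) has n-th power exactly exp (- v / 2). What remains is
    that n (|a - w| + |b|) tends to zero, for which dominated convergence with majorant [xi z ^+ 2]
    suffices, without a third moment. *)
Lemma iid_CLT_trig (xi : Zs -> R) : measurable_fun setT xi ->
  Q.-integrable setT (EFin \o (fun z => xi z ^+ 2)) -> \int[Q]_z xi z = 0 ->
  let S n o := (Num.sqrt n%:R)^-1 * \sum_(j < n) xi (Z j o) in
  \int[P]_o cos (S n o) @[n --> \oo] --> expR (- (\int[Q]_z (xi z ^+ 2)) / 2) /\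
  \int[P]_o sin (S n o) @[n --> \oo] --> 0.
Proof.
move=> mxi xi2 xi0 /=; set v := \int[Q]_z (xi z ^+ 2).
have xi1 := square_integrable mxi xi2.
have v0 : 0 <= v by apply: Rintegral_ge0 => // z _; rewrite sqr_ge0.
have nn n : 1 + n%:R != 0 :> R by rewrite nat1r pnatr_eq0.
(* Sample size n + 1 is used until [cvgS], so that the normalization never divides by zero. *)
pose t n : R := (Num.sqrt n.+1%:R)^-1.
have t0 n : 0 < t n by rewrite invr_gt0 sqrtr_gt0 ltr0n.
have t2 n : t n ^+ 2 = n.+1%:R^-1 by rewrite exprVn sqr_sqrtr.
have tcvg : t n @[n --> \oo] --> 0.
  rewrite -(sqrtr0 R) (_ : t = Num.sqrt \o harmonic).
    by apply: continuous_cvg (cvg_harmonic); exact: sqrt_continuous.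
  by apply/funext => n; rewrite /t/= sqrtrV.
pose eta n z := t n * xi z.
have meta n : measurable_fun setT (eta n) by exact: measurable_funM.
(* Taylor remainders multiplied by the sample size: the factor cancels against the squared
   normalization, which makes the majorant independent of n. *)
pose fc n z := n.+1%:R * (cos (eta n z) - 1 + eta n z ^+ 2 / 2).
pose fs n z := n.+1%:R * (sin (eta n z) - eta n z).
have mfc n : measurable_fun setT (fc n).
  apply: measurable_funM => //; apply: measurable_funD; last first.
    by apply: measurable_funM => //; exact: measurable_funX.
  by apply: measurable_funB => //; apply: measurableT_comp => //; exact: measurable_cos.
have mfs n : measurable_fun setT (fs n).
  apply: measurable_funM => //; apply: measurable_funB => //.
  by apply: measurableT_comp => //; exact: measurable_sin.
have etaE n z k : n.+1%:R * `|eta n z| ^+ k.+2 = t n ^+ k * `|xi z| ^+ k.+2.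
  rewrite /eta normrM exprMn mulrA [`|t n|]gtr0_norm//; congr (_ * _).
  by rewrite -[k.+2]addn2 exprD t2 mulrCA mulfV ?pnatr_eq0// mulr1.
have eta2 n z : n.+1%:R * eta n z ^+ 2 = xi z ^+ 2.
  by have := etaE n z 0%N; rewrite expr0 mul1r !real_normK ?num_real.
have fcb n z : `|fc n z| <= xi z ^+ 2.
  by rewrite normrM ger0_norm// -(eta2 n) ler_wpM2l// cos_taylor2.
have fsb n z : `|fs n z| <= xi z ^+ 2.
  by rewrite normrM ger0_norm// -(eta2 n) ler_wpM2l// sin_taylor2.
have cvg_bound (f : nat -> Zs -> R) z k : (forall n, `|f n z| <= n.+1%:R * `|eta n z| ^+ k.+3) ->
    f n z @[n --> \oo] --> 0.
  move=> fb; apply/norm_cvg0P.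
  apply: (@squeeze_cvgr _ _ _ _ (cst 0) (fun n => t n ^+ k.+1 * `|xi z| ^+ k.+3)).
  - by apply: nearW => n; rewrite normr_ge0/= -etaE.
  - exact: cvg_cst.
  - rewrite -[X in _ --> X](mul0r (`|xi z| ^+ k.+3)); apply: cvgMr_tmp.
    have -> : (0 : R) = 0 ^+ k.+1 by rewrite expr0n.
    by apply: (continuous_cvg _ (h := fun x : R => x ^+ k.+1)) => //; exact: exprn_continuous.
have fc0 : \int[Q]_z fc n z @[n --> \oo] --> 0.
  have -> : (0 : R) = \int[Q]_z (0 : R) by rewrite Rintegral_cst1.
  apply: Rintegral_dominated xi2 fcb => // z.
  apply: (cvg_bound _ _ 1%N) => n.
  rewrite /fc normrM ger0_norm// ler_wpM2l//.
  by rewrite -normrX (ger0_norm (exprn_even_ge0 _ _))// cos_taylor4.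
have fs0 : \int[Q]_z fs n z @[n --> \oo] --> 0.
  have -> : (0 : R) = \int[Q]_z (0 : R) by rewrite Rintegral_cst1.
  apply: Rintegral_dominated xi2 fsb => // z.
  apply: (cvg_bound _ _ 0%N) => n.
  by rewrite /fs normrM ger0_norm// ler_wpM2l// sin_taylor3.
pose a n := \int[Q]_z cos (eta n z).
pose b n := \int[Q]_z sin (eta n z).
pose w n := expR (- (v / 2 * n.+1%:R^-1)).
have w01 n : 0 <= w n <= 1.
  rewrite expR_ge0/= -[leRHS]expR0 ler_expR oppr_le0.
  by rewrite mulr_ge0 ?invr_ge0// divr_ge0.
have wX n : w n ^+ n.+1 = expR (- v / 2).
  by rewrite -expRM_natl; congr expR; field; rewrite nn.
have ic n : Q.-integrable setT (EFin \o (fun z => cos (eta n z))).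
  apply: (bounded_integrable _ (M := 1)) => [|z]; last exact: cos_max.
  by apply: measurableT_comp => //; exact: measurable_cos.
have is_ n : Q.-integrable setT (EFin \o (fun z => sin (eta n z))).
  apply: (bounded_integrable _ (M := 1)) => [|z]; last exact: sin_max.
  by apply: measurableT_comp => //; exact: measurable_sin.
have i1 : Q.-integrable setT (EFin \o cst 1) by exact: finite_measure_integrable_cst.
have aE n : n.+1%:R * (a n - 1 + v / 2 * n.+1%:R^-1) = \int[Q]_z fc n z.
  have E z : fc n z = n.+1%:R * (cos (eta n z) - 1) + 2^-1 * xi z ^+ 2.
    by rewrite -(eta2 n) /fc; field.
  under [RHS]eq_Rintegral do rewrite E.
  rewrite RintegralD//; last 2 first.
  - by apply: integrable_EFinZl; exact: integrable_EFinB.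
  - exact: integrable_EFinZl.
  rewrite !RintegralZl//; last exact: integrable_EFinB.
  rewrite RintegralB// Rintegral_cst1 -/(a n) -/v.
  by field; rewrite nn.
(* The linear term of the sine may be subtracted for free because [xi] is centred. *)
have bE n : n.+1%:R * b n = \int[Q]_z fs n z.
  have ie : Q.-integrable setT (EFin \o eta n) by exact: integrable_EFinZl.
  rewrite RintegralZl//; last exact: integrable_EFinB.
  by rewrite RintegralB// /eta RintegralZl// xi0 mulr0 subr0.
pose B n := `|\int[Q]_z fc n z| + (v / 2) ^+ 2 * n.+1%:R^-1 + `|\int[Q]_z fs n z|.
have B0 : B n @[n --> \oo] --> 0.
  rewrite (_ : 0 = 0 + (v / 2) ^+ 2 * 0 + 0 :> R); last by rewrite mulr0 !addr0.
  apply: cvgD; last exact/norm_cvg0P.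
  apply: cvgD; first exact/norm_cvg0P.
  by apply: cvgMl_tmp; exact: cvg_harmonic.
have bound n : n.+1%:R * (`|a n - w n| + `|b n|) <= B n.
  rewrite mulrDr /B lerD//; last first.
    by rewrite -bE normrM [`|n.+1%:R|]ger0_norm.
  have -> : a n - w n = (a n - 1 + v / 2 * n.+1%:R^-1) - (w n - (1 - v / 2 * n.+1%:R^-1)) by ring.
  rewrite (le_trans (ler_wpM2l _ (ler_normB _ _)))// mulrDr lerD//.
    by rewrite -aE normrM [`|n.+1%:R|]ger0_norm.
  have y0 : 0 <= v / 2 * n.+1%:R^-1 by rewrite mulr_ge0 ?invr_ge0// divr_ge0.
  rewrite (le_trans (ler_wpM2l _ (expRN_taylor2 y0)))//.
  by rewrite le_eqVlt; apply/orP; left; apply/eqP; field; rewrite nn.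
have main n : `|\int[P]_o cos ((Num.sqrt n.+1%:R)^-1 * \sum_(j < n.+1) xi (Z j o)) - expR (- v / 2)| <= B n /\
   `|\int[P]_o sin ((Num.sqrt n.+1%:R)^-1 * \sum_(j < n.+1) xi (Z j o))| <= B n.
  have [h1 h2] := iid_cos_sin_sum n.+1 (meta n) (w01 n).
  split; apply: le_trans (bound n); [apply: le_trans h1|apply: le_trans h2].
    rewrite wX le_eqVlt; apply/orP; left; apply/eqP; congr (`|_ - _|).
    by apply: eq_Rintegral => o _; rewrite mulr_sumr.
  rewrite le_eqVlt; apply/orP; left; apply/eqP; congr (`|_|).
  by apply: eq_Rintegral => o _; rewrite mulr_sumr.
have cvgS (f : nat -> R) l : (forall n, `|f n.+1 - l| <= B n) -> f n @[n --> \oo] --> l.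
  move=> fB; rewrite -cvg_shiftS; apply/cvgrPdist_le => e e0.
  move/cvgrPdist_le : B0 => /(_ _ e0); apply: filterS => n /=.
  rewrite sub0r normrN => Be; rewrite distrC (le_trans (fB n))// (le_trans _ Be)//.
  exact: ler_norm.
split; apply: cvgS => n; first by have [] := main n.
by rewrite subr0; have [] := main n.
Qed.

End iid_clt.

(** * Trigonometric approximation and weak convergence *)

Section bernstein.
Variable R : realType.
Implicit Types (s : R) (N k : nat).

(** The binomial probability of k successes in N trials with success probability [s]. Pascal's
    recursion lets moments be computed by induction on N and shows at once that composing with a
    trigonometric polynomial gives another one. *)
Fixpoint bern s N k : R :=
  if N is N'.+1 then (1 - s) * bern s N' k + s * (if k is k'.+1 then bern s N' k' else 0)
  else (k == 0%N)%:R.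

Lemma bern_gt s N k : (N < k)%N -> bern s N k = 0.
Proof.
elim: N k => [[]//|N IH [//|k] /= Nk].
by rewrite !IH ?mulr0 ?addr0// ltnW.
Qed.

Lemma bern_ge0 s N k : 0 <= s <= 1 -> 0 <= bern s N k.
Proof.
move=> /andP[s0 s1]; elim: N k => [k|N IH k] /=; first exact: ler0n.
by rewrite addr_ge0// mulr_ge0 ?subr_ge0//; case: k.
Qed.

(** Conditioning on one trial; the moment computations below all rest on it. *)
Lemma bern_sumS s N (phi : nat -> R) :
  \sum_(k < N.+2) bern s N.+1 k * phi k =
  (1 - s) * (\sum_(k < N.+1) bern s N k * phi k) +
  s * (\sum_(k < N.+1) bern s N k * phi k.+1).
Proof.
rewrite /=; under eq_bigr do rewrite mulrDl -!mulrA.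
rewrite big_split/= -!mulr_sumr; congr (_ * _ + _ * _).
  by rewrite big_ord_recr/= bern_gt// mul0r addr0.
by rewrite big_ord_recl/= mul0r add0r.
Qed.

Lemma bern_sum1 s N : \sum_(k < N.+1) bern s N k = 1.
Proof.
rewrite (eq_bigr (fun k : 'I_N.+1 => bern s N k * 1)); last by move=> k _; rewrite mulr1.
elim: N => [|N IH]; first by rewrite big_ord1 mulr1.
by rewrite (bern_sumS s N (fun=> 1)) IH; ring.
Qed.

Lemma bern_sum_centered s N : \sum_(k < N.+1) bern s N k * (k%:R - N%:R * s) = 0.
Proof.
elim: N => [|N IH]; first by rewrite big_ord1/= mul0r subr0 mulr0.
rewrite (bern_sumS s N (fun k => k%:R - N.+1%:R * s)).
have E c : \sum_(k < N.+1) bern s N k * (k%:R - N%:R * s + c) = c.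
  under eq_bigr do rewrite mulrDr.
  by rewrite big_split/= IH add0r -mulr_suml bern_sum1 mul1r.
have E1 : \sum_(k < N.+1) bern s N k * (k%:R - N.+1%:R * s) = - s.
  by rewrite -[RHS]E; apply: eq_bigr => k _; rewrite -natr1; ring.
have E2 : \sum_(k < N.+1) bern s N k * (k.+1%:R - N.+1%:R * s) = 1 - s.
  by rewrite -[RHS]E; apply: eq_bigr => k _; rewrite -!natr1; ring.
by rewrite E1 E2; ring.
Qed.

(** A further trial shifts the centred count by -s with probability 1 - s and by 1 - s with
    probability s; the mixed term vanishes by centring. *)
Lemma bern_variance s N :
  \sum_(k < N.+1) bern s N k * (k%:R - N%:R * s) ^+ 2 = N%:R * (s * (1 - s)).
Proof.
elim: N => [|N IH]; first by rewrite big_ord1/= !mul0r subr0 expr0n mulr0.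
rewrite (bern_sumS s N (fun k => (k%:R - N.+1%:R * s) ^+ 2)).
have E c : \sum_(k < N.+1) bern s N k * (k%:R - N%:R * s + c) ^+ 2 =
    N%:R * (s * (1 - s)) + c ^+ 2.
  rewrite -IH; transitivity (\sum_(k < N.+1) bern s N k * (k%:R - N%:R * s) ^+ 2 +
      (2 * c) * (\sum_(k < N.+1) bern s N k * (k%:R - N%:R * s)) +
      c ^+ 2 * \sum_(k < N.+1) bern s N k).
    by rewrite !mulr_sumr -!big_split/=; apply: eq_bigr => k _; ring.
  by rewrite bern_sum_centered bern_sum1; ring.
have E1 : \sum_(k < N.+1) bern s N k * (k%:R - N.+1%:R * s) ^+ 2 =
    N%:R * (s * (1 - s)) + (- s) ^+ 2.
  by rewrite -E; apply: eq_bigr => k _; rewrite -natr1; ring.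
have E2 : \sum_(k < N.+1) bern s N k * (k.+1%:R - N.+1%:R * s) ^+ 2 =
    N%:R * (s * (1 - s)) + (1 - s) ^+ 2.
  by rewrite -E; apply: eq_bigr => k _; rewrite -!natr1; ring.
by rewrite E1 E2 -natr1; ring.
Qed.

Variable r : nat.

Lemma bern_prod_sum1 (s : 'I_r -> R) N :
  \sum_(K : {ffun 'I_r -> 'I_N.+1}) \prod_i bern (s i) N (K i) = 1.
Proof.
rewrite -(bigA_distr_bigA (fun i (k : 'I_N.+1) => bern (s i) N k)).
by rewrite big1// => i _; exact: bern_sum1.
Qed.

Lemma bern_prod_variance (s : 'I_r -> R) N j :
  \sum_(K : {ffun 'I_r -> 'I_N.+1}) \prod_i bern (s i) N (K i) * ((K j)%:R - N%:R * s j) ^+ 2 =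
  N%:R * (s j * (1 - s j)).
Proof.
pose F i (k : 'I_N.+1) := bern (s i) N k * (if i == j then (k%:R - N%:R * s j) ^+ 2 else 1).
rewrite (eq_bigr (fun K : {ffun 'I_r -> 'I_N.+1} => \prod_i F i (K i))); last first.
  move=> K _; rewrite /F big_split/=; congr (_ * _).
  by rewrite (bigD1 j)//= eqxx big1 ?mulr1// => i /negbTE ->.
rewrite -bigA_distr_bigA (bigD1 j)//= {1}/F eqxx bern_variance big1 ?mulr1// => i /negbTE ij.
by rewrite /F ij; under eq_bigr do rewrite mulr1; exact: bern_sum1.
Qed.

(** Chebyshev's argument in integrated form: a deviation bounded by [e] plus a multiple of the
    squared distance is averaged, and each coordinate has variance at most N. *)
Lemma bernstein_approx (s : 'I_r -> R) N (phi : {ffun 'I_r -> 'I_N.+1} -> R) (c e D : R) :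
  (forall i, 0 <= s i <= 1) -> (0 < N)%N -> 0 <= D ->
  (forall K, `|phi K - c| <= e + D * \sum_i ((K i)%:R - N%:R * s i) ^+ 2) ->
  `|\sum_(K : {ffun 'I_r -> 'I_N.+1}) phi K * \prod_i bern (s i) N (K i) - c| <=
    e + D * (r%:R * N%:R).
Proof.
move=> s01 N0 D0 H.
have w0 (K : {ffun 'I_r -> 'I_N.+1}) : 0 <= \prod_i bern (s i) N (K i).
  by apply: prodr_ge0 => i _; exact: bern_ge0.
have -> : \sum_(K : {ffun 'I_r -> 'I_N.+1}) phi K * \prod_i bern (s i) N (K i) - c =
  \sum_(K : {ffun 'I_r -> 'I_N.+1}) (phi K - c) * \prod_i bern (s i) N (K i).
  by under [RHS]eq_bigr do rewrite mulrBl; rewrite sumrB -mulr_sumr bern_prod_sum1 mulr1.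
apply: le_trans (ler_norm_sum _ _ _) _.
apply: (@le_trans _ _ (\sum_(K : {ffun 'I_r -> 'I_N.+1})
    (e * \prod_i bern (s i) N (K i) + D * \sum_j
      \prod_i bern (s i) N (K i) * ((K j)%:R - N%:R * s j) ^+ 2))).
  apply: ler_sum => K _; rewrite normrM [`|\prod_(_ | _) _|]ger0_norm//.
  rewrite -mulr_sumr mulrCA [e * _]mulrC -mulrDr mulrC ler_wpM2l//.
rewrite big_split/= -!mulr_sumr bern_prod_sum1 mulr1 lerD2l ler_wpM2l// exchange_big/=.
rewrite (eq_bigr (fun j => N%:R * (s j * (1 - s j)))); last by move=> j _; exact: bern_prod_variance.
rewrite -mulr_sumr mulrC ler_wpM2r//.
apply: (@le_trans _ _ (\sum_(i < r) 1)); last by rewrite sumr_const card_ord.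
apply: ler_sum => i _; have /andP[h1 h2] := s01 i.
by rewrite mulr_ile1 ?subr_ge0// lerBlDl lerDr.
Qed.

End bernstein.

Section trigonometric_polynomials.
Variables (R : realType) (r : nat).
Implicit Types (t x : 'cV[R]_r) (p q : 'cV[R]_r -> R).

(** The phase [b] brings in constants and sines without complex exponentials, and expectations of
    such functions are determined by those of cosines and sines of linear forms. *)
Inductive trig_poly : ('cV[R]_r -> R) -> Prop :=
| trig_cos t b : trig_poly (fun x => cos (dotv t x + b))
| trig_lin a b p q : trig_poly p -> trig_poly q -> trig_poly (fun x => a * p x + b * q x).

Lemma dotv0l x : dotv 0 x = 0.
Proof. by rewrite /dotv big1// => i _; rewrite mxE mul0r. Qed.

Lemma dotvDl t u x : dotv (t + u) x = dotv t x + dotv u x.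
Proof. by rewrite ![dotv _ x]dotvC dotvDr. Qed.

Lemma dotvNl t x : dotv (- t) x = - dotv t x.
Proof. by rewrite dotvC -scaleN1r dotvZr mulN1r dotvC. Qed.

Lemma trig_cst c : trig_poly (fun=> c).
Proof.
have := trig_lin c 0 (trig_cos 0 0) (trig_cos 0 0).
by under eq_fun do rewrite dotv0l addr0 cos0 mulr1 mul0r addr0.
Qed.

Lemma trig_sin t b : trig_poly (fun x => sin (dotv t x + b)).
Proof.
have := trig_cos t (b - pi / 2).
by under eq_fun do rewrite addrA cosBpihalf.
Qed.

Lemma trig_scale c p : trig_poly p -> trig_poly (fun x => c * p x).
Proof.
move=> tp; have := trig_lin c 0 tp tp.
by under eq_fun do rewrite mul0r addr0.
Qed.

Lemma trig_add p q : trig_poly p -> trig_poly q -> trig_poly (fun x => p x + q x).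
Proof.
move=> tp tq; have := trig_lin 1 1 tp tq.
by under eq_fun do rewrite !mul1r.
Qed.

(** Induction on both factors reduces to two cosines, whose product is half the sum of the cosines
    of the sum and of the difference. *)
Lemma trig_mul p q : trig_poly p -> trig_poly q -> trig_poly (fun x => p x * q x).
Proof.
move=> tp; elim: tp q => [t b|a b p1 p2 _ IH1 _ IH2] q.
  elim=> [u c|a c q1 q2 _ IH1 _ IH2].
    have := trig_lin 2^-1 2^-1 (trig_cos (t + u) (b + c)) (trig_cos (t - u) (b - c)).
    congr trig_poly; apply/funext => x.
    rewrite !dotvDl dotvNl.
    have -> : dotv t x + dotv u x + (b + c) = (dotv t x + b) + (dotv u x + c) by ring.
    have -> : dotv t x - dotv u x + (b - c) = (dotv t x + b) - (dotv u x + c) by ring.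
    by rewrite cosD cosB; field.
  have := trig_lin a c IH1 IH2; congr trig_poly; apply/funext => x; ring.
move=> tq; have := trig_lin a b (IH1 _ tq) (IH2 _ tq).
by congr trig_poly; apply/funext => x; ring.
Qed.

Lemma trig_sum (I : Type) (s : seq I) (F : I -> 'cV[R]_r -> R) :
  (forall i, trig_poly (F i)) -> trig_poly (fun x => \sum_(i <- s) F i x).
Proof.
move=> tF; elim: s => [|i s IH].
  by under eq_fun do rewrite big_nil; exact: trig_cst.
by under eq_fun do rewrite big_cons; exact: trig_add.
Qed.

Lemma trig_prod (I : Type) (s : seq I) (F : I -> 'cV[R]_r -> R) :
  (forall i, trig_poly (F i)) -> trig_poly (fun x => \prod_(i <- s) F i x).
Proof.
move=> tF; elim: s => [|i s IH].
  by under eq_fun do rewrite big_nil; exact: trig_cst.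
by under eq_fun do rewrite big_cons; exact: trig_mul.
Qed.

Lemma trig_bern p N k : trig_poly p -> trig_poly (fun x => bern (p x) N k).
Proof.
move=> tp; elim: N k => [|N IH] k /=; first exact: trig_cst.
apply: trig_add.
  apply: trig_mul => //; apply: trig_add; first exact: trig_cst.
  by have := trig_scale (-1) tp; under eq_fun do rewrite mulN1r.
by apply: trig_mul => //; case: k => [|k]; [exact: trig_cst|exact: IH].
Qed.

End trigonometric_polynomials.

Lemma normr_sinB_le {R : realType} (x y : R) : `|sin x - sin y| <= `|x - y|.
Proof.
have [|c _] := @MVT0 R (fun h => sin (y + h)) (fun h => cos (y + h)) (x - y).
  by move=> h; apply: is_derive_eq; rewrite /GRing.scale/=; ring.
rewrite addr0 (addrC y) subrK => ->; rewrite normrM.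
by rewrite -[leRHS]mul1r ler_wpM2r// cos_max.
Qed.

Section trig_approximation.
Variables (R : realType) (r : nat).

Lemma cV_continuous_dist (f : 'cV[R]_r -> R) : continuous f ->
  forall (x : 'cV[R]_r) (e : R), 0 < e ->
  exists2 dl : R, 0 < dl & forall y : 'cV[R]_r, (forall i, `|x i 0 - y i 0| < dl) -> `|f x - f y| < e.
Proof.
move=> cf x e e0.
have /cvgrPdist_lt/(_ _ e0) := cf x.
rewrite near_simpl => /nbhs_ballP[dl /= dl0 H].
exists dl => // y xy; apply: H; split => // i j; rewrite ord1; exact: xy.
Qed.

(** Compactness of the box makes a locally uniform choice of [e] uniform. The box is transposed
    because compactness of products is stated for row vectors. *)
Lemma cV_box_near (K : R) (F : R -> 'cV[R]_r -> Prop) :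
  (forall x : 'cV[R]_r, (forall i, `|x i 0| <= K) ->
     exists2 dl : R, 0 < dl & forall (e : R) (y : 'cV[R]_r), 0 < e < dl ->
     (forall i, `|x i 0 - y i 0| < dl) -> F e y) ->
  exists2 e, 0 < e & forall x : 'cV[R]_r, (forall i, `|x i 0| <= K) -> F e x.
Proof.
move=> H.
pose A := [set v : 'rV[R]_r | forall i, `[- K, K]%classic (v ord0 i)].
have cA : compact A by apply: (@rV_compact _ r (fun=> `[- K, K]%classic)) => i; exact: segment_compact.
have AE v : A v <-> forall i, `|(v^T : 'cV[R]_r) i 0| <= K.
  by split => Av i; have := Av i; rewrite mxE ler_norml /= in_itv.
have /compact_near_coveringP cov := cA.
have : \forall e \near (0 : R)^'+, A `<=` (fun v => F e v^T).
  apply: cov => v /AE /H[dl dl0 Hdl].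
  exists (ball v dl, [set e | 0 < e < dl]); first split.
  - exact: nbhsx_ballx.
  - near=> e; apply/andP; split; first by near: e; exact: nbhs_right_gt.
    by near: e; exact: nbhs_right_lt.
  - move=> [w e] [/= [_ vw] e0]; apply: Hdl => // i.
    by have := vw 0 i; rewrite !mxE.
move=> E.
have [e [e0 HA]] : exists e : R, 0 < e /\ A `<=` (fun v => F e v^T).
  near (0 : R)^'+ => e; exists e; split; first by near: e; exact: nbhs_right_gt.
  by near: e.
exists e => // x xK; rewrite -[x]trmxK; apply: HA; apply/AE.
by rewrite trmxK.
Unshelve. all: by end_near. Qed.

(* On the box, [y] is recovered from [s y = (1 + sin (a * y)) / 2] in [0, 1], so that
   [f] is a continuous function of the [s (x i 0)]; its Bernstein polynomial in these
   variables is a trigonometric polynomial in [x]. *)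
Lemma trig_approx (f : 'cV[R]_r -> R) (M K e : R) : continuous f ->
  (forall x, `|f x| <= M) -> 0 < K -> 0 < e ->
  exists p, [/\ trig_poly p, forall x, `|p x| <= M &
    forall x : 'cV[R]_r, (forall i, `|x i 0| <= K) -> `|p x - f x| <= e].
Proof.
move=> cf fM K0 e0.
have M0 : 0 <= M by exact: le_trans (fM 0).
(* Keeps a * y within pi / 4 on the box, strictly inside the interval where sine is injective and
   arcsine is continuous at its values. *)
pose a := pi / (4 * K).
have a0 : 0 < a by rewrite divr_gt0 ?pi_gt0// mulr_gt0.
have aK y : `|y| <= K -> - (pi / 2) < a * y < pi / 2.
  move=> yK; rewrite -ltr_norml normrM (gtr0_norm a0).
  apply: (@le_lt_trans _ _ (a * K)); first by rewrite ler_pM2l.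
  rewrite /a; have := pi_gt0 R => p0.
  have -> : pi / (4 * K) * K = pi / 4 by field; rewrite gt_eqF.
  lra.
pose s y : R := (1 + sin (a * y)) / 2.
pose g (y : R) : R := asin (2 * y - 1) / a.
have s2 y : 2 * s y - 1 = sin (a * y) by rewrite /s; field.
have s01 y : 0 <= s y <= 1.
  have := sin_max (a * y); rewrite ler_norml => /andP[h1 h2].
  by rewrite /s; apply/andP; split; lra.
have gs y : `|y| <= K -> g (s y) = y.
  move=> /aK /andP[h1 h2]; rewrite /g s2 sinK; last by rewrite in_itv/= !ltW.
  by rewrite mulrC mulKf// gt_eqF.
(* Continuity of [g] is claimed only at points [s y] coming from the box, but [z] is unrestricted: a
   grid point k / N may lie outside the image of the box. *)
have gcont y e' : `|y| <= K -> 0 < e' -> exists2 dl, 0 < dl &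
    forall z, `|s y - z| < dl -> `|y - g z| < e'.
  move=> yK e'0.
  have sinlt : -1 < sin (a * y) < 1.
    have c0 := cos_gt0_pihalf (aK _ yK).
    rewrite -ltr_norml -[ltRHS](sqrtr1 R) -sqrtr_sqr ltr_sqrt// sin2cos2.
    by rewrite ltrBlDr ltrDl exprn_gt0.
  have /cvgrPdist_lt/(_ (a * e')) := continuous_asin sinlt.
  rewrite mulr_gt0// => /(_ isT); rewrite near_simpl => /nbhs_ballP[dl /= dl0 Hdl].
  exists (dl / 2); first by rewrite divr_gt0.
  move=> z yz.
  have /Hdl/= : ball (sin (a * y)) dl (2 * z - 1).
    rewrite /ball/= -s2 (_ : _ - _ = 2 * (s y - z)); last by ring.
    by rewrite normrM ger0_norm// mulrC -ltr_pdivlMr.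
  rewrite -s2 => h.
  rewrite -{1}(gs _ yK) /g -mulrBl normrM normfV (gtr0_norm a0) ltr_pdivrMr//.
  by rewrite [ltRHS]mulrC.
have scont y z : `|s y - s z| <= a * `|y - z|.
  have -> : s y - s z = 2^-1 * (sin (a * y) - sin (a * z)) by rewrite /s; field.
  rewrite normrM ger0_norm//; have := normr_sinB_le (a * y) (a * z).
  by rewrite -mulrBr normrM (gtr0_norm a0); have := normr_ge0 (sin (a * y) - sin (a * z)); lra.
have [dl dl0 Hdl] : exists2 dl, 0 < dl & forall x : 'cV[R]_r, (forall i, `|x i 0| <= K) ->
    forall sg : 'I_r -> R, (forall i, `|s (x i 0) - sg i| < dl) ->
    `|f (\col_i g (sg i)) - f x| <= e / 2.
  apply: cV_box_near => x xK.
  have e4 : 0 < e / 4 by rewrite divr_gt0.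
  have [d1 d10 H1] := cV_continuous_dist cf x e4.
  have /choice[D HD] i : exists dl, 0 < dl /\
      forall z, `|s (x i 0) - z| < dl -> `|x i 0 - g z| < d1.
    by have [dl dl0 H] := gcont _ _ (xK i) d10; exists dl.
  pose d2 := \big[Num.min/1]_i D i.
  have d20 : 0 < d2 by apply/bigmin_gtP; split => // i _; have [] := HD i.
  (* Half of [d2] pays for moving from x to y, through the Lipschitz constant [a] of [s], and the
     other half for moving from [s (y i 0)] to [sg i]. *)
  pose d3 := Num.min d1 (Num.min (d2 / 2) (d2 / 2 / a)).
  have d22 : 0 < d2 / 2 by rewrite divr_gt0.
  exists d3; first by rewrite !lt_min d10 d22 divr_gt0.
  move=> e' y /andP[e'0]; rewrite !lt_min => /and3P[ed1 ed2 ed3] xy sg ysg.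
  have h1 : `|f x - f y| < e / 4.
    by apply: H1 => i; have := xy i; rewrite lt_min => /andP[].
  have h2 : `|f x - f (\col_i g (sg i))| < e / 4.
    apply: H1 => i; rewrite mxE; have [_] := HD i; apply.
    apply: (@lt_le_trans _ _ d2); last by apply: bigmin_le_cond.
    rewrite (splitr d2) -[s _ - _](subrKA (s (y i 0))).
    apply: le_lt_trans (ler_normD _ _) _; apply: ltrD; last exact: lt_trans (ysg i) ed2.
    apply: le_lt_trans (scont _ _) _; rewrite mulrC -ltr_pdivlMr//.
    by have := xy i; rewrite !lt_min => /and3P[].
  rewrite -[_ - f y](subrKA (f x)) distrC in h2 *.
  apply: le_trans (ler_normD _ _) _.
  have -> : e / 2 = e / 4 + e / 4 by field.
  by apply: lerD; apply: ltW => //; rewrite distrC.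
(* Chosen so that the averaged squared distances contribute 2 M r / (dl^2 N), at most e / 2. *)
have [N0 _ HN] := nbhs_infty_ger (4 * M * r%:R / (dl ^+ 2 * e)).
pose N := N0.+1; have Nr : 0 < N%:R :> R by rewrite ltr0n.
pose phi (L : {ffun 'I_r -> 'I_N.+1}) := f (\col_i g ((L i)%:R / N%:R)).
exists (fun x : 'cV[R]_r => \sum_(L : {ffun 'I_r -> 'I_N.+1}) phi L * \prod_i bern (s (x i 0)) N (L i)).
split.
- apply: trig_sum => L; apply: trig_scale; apply: trig_prod => i; apply: trig_bern.
  have := trig_add (trig_cst r 2^-1) (trig_scale 2^-1 (trig_sin (a *: delta_mx i 0) 0)).
  congr trig_poly; apply/funext => x; rewrite addr0 /s dotvC dotvZr.
  have -> : dotv x (delta_mx i 0) = x i 0.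
    rewrite /dotv (bigD1 i)//= mxE !eqxx mulr1 big1 ?addr0// => j /negbTE ji.
    by rewrite mxE ji mulr0.
  by field.
- move=> x; apply: le_trans (ler_norm_sum _ _ _) _.
  have ME : \sum_(L : {ffun 'I_r -> 'I_N.+1}) M * \prod_i bern (s (x i 0)) N (L i) = M.
    by rewrite -mulr_sumr bern_prod_sum1 mulr1.
  rewrite -[leRHS]ME.
  apply: ler_sum => L _; rewrite normrM ler_pM//; first exact: fM.
  by rewrite ger0_norm// prodr_ge0// => i _; exact: bern_ge0.
move=> x xK.
have D0 : 0 <= 2 * M / (dl ^+ 2 * N%:R ^+ 2).
  by rewrite divr_ge0 ?mulr_ge0 ?exprn_ge0 ?(ltW dl0).
apply: le_trans (@bernstein_approx R r (fun i => s (x i 0)) N phi (f x) (e / 2)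
  (2 * M / (dl ^+ 2 * N%:R ^+ 2)) _ _ D0 _) _ => //.
- move=> L; have sq0 (i : 'I_r) : 0 <= ((L i)%:R - N%:R * s (x i 0)) ^+ 2 by exact: sqr_ge0.
  (* At grid points near x uniform continuity gives e / 2; at the others some coordinate is off by
     at least N * dl, so the quadratic term alone exceeds the trivial bound 2 M. *)
  have [/forallP Hd|/forallPn[i]] := boolP [forall i, `|s (x i 0) - (L i)%:R / N%:R| < dl].
    apply: le_trans (Hdl _ xK _ Hd) _; rewrite lerDl mulr_ge0// sumr_ge0//.
  rewrite -leNgt => Hi; apply: le_trans (ler_normB _ _) _.
  apply: (@le_trans _ _ (2 * M)); first by have := fM x; have := fM (\col_i g ((L i)%:R / N%:R)); rewrite /phi; lra.
  rewrite -[leLHS]add0r lerD//; first by rewrite divr_ge0// ltW.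
  rewrite mulrAC ler_pdivlMr ?mulr_gt0 ?exprn_gt0// ler_wpM2l ?mulr_ge0//.
  rewrite (bigD1 i)//= -[leLHS]addr0 lerD ?sumr_ge0//.
  rewrite -exprMn -[leRHS]real_normK ?num_real// lerXn2r ?nnegrE ?mulr_ge0 ?(ltW dl0)//.
  have -> : (L i)%:R - N%:R * s (x i 0) = - (N%:R * (s (x i 0) - (L i)%:R / N%:R)).
    by field; rewrite gt_eqF.
  by rewrite normrN normrM [`|N%:R|]ger0_norm// mulrC ler_pM2l.
have := HN N (leqnSn N0); rewrite /= ler_pdivrMr ?mulr_gt0 ?exprn_gt0// => h.
rewrite [leRHS]splitr lerD2l.
have -> : 2 * M / (dl ^+ 2 * N%:R ^+ 2) * (r%:R * N%:R) = 2 * M * r%:R / (dl ^+ 2 * N%:R).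
  by field; rewrite !gt_eqF.
rewrite ler_pdivrMr ?mulr_gt0 ?exprn_gt0//.
by lra.
Qed.
End trig_approximation.

(** * Weak convergence from trigonometric test functions *)

Section weak_convergence.
Variables (R : realType) (r : nat).

Lemma measurable_dotv d (T : measurableType d) (X : T -> 'cV[R]_r) (t : 'cV[R]_r) :
  meas_vec X -> measurable_fun setT (fun w => dotv t (X w)).
Proof. by move=> mX; apply: measurable_sum => i; exact: measurable_funM. Qed.

Lemma measurable_trig_poly d (T : measurableType d) (X : T -> 'cV[R]_r) p :
  meas_vec X -> trig_poly p -> measurable_fun setT (fun w => p (X w)).
Proof.
move=> mX; elim=> [t b|a b p1 p2 _ m1 _ m2].
  apply: measurableT_comp; first exact: measurable_cos.
  by apply: measurable_funD => //; exact: measurable_dotv.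
by apply: measurable_funD; exact: measurable_funM.
Qed.

Lemma trig_poly_bounded p : trig_poly p -> exists M : R, forall x : 'cV[R]_r, `|p x| <= M.
Proof.
elim=> [t b|a b p1 p2 _ [M1 H1] _ [M2 H2]]; first by exists 1 => x; exact: cos_max.
exists (`|a| * M1 + `|b| * M2) => x.
by rewrite (le_trans (ler_normD _ _))// !normrM lerD// ler_wpM2l.
Qed.

(** [meas_vec] speaks of coordinates only, so measurability passes through the approximation: [f] is
    a pointwise limit of trigonometric polynomials that approximate it on growing boxes. *)
Lemma measurable_continuous_comp d (T : measurableType d) (X : T -> 'cV[R]_r)
    (f : 'cV[R]_r -> R) (M : R) : meas_vec X -> continuous f ->
  (forall x, `|f x| <= M) -> measurable_fun setT (fun w => f (X w)).
Proof.
move=> mX cf fM.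
have /choice[p pP] n : exists p, trig_poly p /\ forall x : 'cV[R]_r,
    (forall i, `|x i 0| <= n.+1%:R) -> `|p x - f x| <= n.+1%:R^-1.
  have [||p [tp _ Hp]] := @trig_approx R r f M n.+1%:R n.+1%:R^-1 cf fM => //.
  by exists p.
apply: (measurable_fun_cvg (h := fun n w => p n (X w))) => [n|w _].
  by have [tp _] := pP n; exact: measurable_trig_poly.
apply/cvgrPdist_le => e e0.
have [N1 _ H1] := nbhs_infty_ger (mnorm (X w)).
have [N2 _ H2] := near_infty_natSinv_lt (PosNum e0).
exists (maxn N1 N2) => // n /=; rewrite geq_max => /andP[n1 n2].
have [_ Hp] := pP n; rewrite distrC; apply: le_trans (Hp _ _) _; last exact/ltW/H2.
move=> i; apply: le_trans (mnorm_entry _ _ _) _.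
by apply: le_trans (H1 _ n1) _; rewrite ler_nat.
Qed.

Lemma Rintegral_approx d (T : measurableType d) (P : probability T R)
    (f g : T -> R) (M e eta : R) (A : set T) :
  measurable_fun setT f -> measurable_fun setT g ->
  (forall w, `|f w| <= M) -> (forall w, `|g w| <= M) -> measurable A ->
  0 <= e -> (forall w, A w -> `|f w - g w| <= e) -> (P (~` A) <= eta%:E)%E ->
  `|\int[P]_w f w - \int[P]_w g w| <= e + 2 * M * eta.
Proof.
move=> mf mg fM gM mA e0 Afg PA.
have fi := bounded_integrable P mf fM; have gi := bounded_integrable P mg gM.
(* A negative bound would leave no point at all, against total mass one. *)
have M0 : 0 <= M.
  rewrite leNgt; apply/negP => M0; have := probability_setT P.
  rewrite (_ : setT = set0); first by rewrite measure0 => -[] /eqP; rewrite eq_sym oner_eq0.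
  by apply/seteqP; split => // w _; have := le_trans (normr_ge0 _) (fM w); rewrite leNgt M0.
rewrite -RintegralB//; apply: le_trans (le_normr_Rintegral _ _) _ => //.
  exact: integrable_EFinB.
have i1 : P.-integrable setT (EFin \o (\1_(~` A) : T -> R)).
  apply: (bounded_integrable _ (M := 1)) => [|w].
    by apply: measurable_indic; exact: measurableC.
  by rewrite indicE ger0_norm// lern1 leq_b1.
apply: (@le_trans _ _ (\int[P]_w (e + 2 * M * \1_(~` A) w))).
  apply: le_Rintegral => //.
  - by apply: integrable_norm => //; exact: integrable_EFinB.
  - by apply: integrable_EFinD; [exact: finite_measure_integrable_cst|exact: integrable_EFinZl].
  move=> w _; rewrite indicE; have [Aw|nAw] := pselect (A w).
    by apply: le_trans (Afg _ Aw) _; rewrite lerDl mulr_ge0// mulr_ge0.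
  rewrite mem_set//= mulr1; apply: le_trans (ler_normB _ _) _.
  by have := fM w; have := gM w; lra.
rewrite RintegralD//; [|exact: finite_measure_integrable_cst|exact: integrable_EFinZl].
rewrite Rintegral_cst1 RintegralZl// lerD2l ler_wpM2l ?mulr_ge0//.
rewrite /Rintegral integral_indic ?setIT//; last exact: measurableC.
by rewrite -lee_fin fineK// fin_num_measure//; exact: measurableC.
Qed.

Lemma measurable_box d (T : measurableType d) (Y : T -> 'cV[R]_r) (K : R) :
  meas_vec Y -> measurable [set w | forall i, `|Y w i 0| <= K].
Proof.
move=> mY; rewrite (_ : mkset _ = \bigcap_(i in [set: 'I_r]) [set w | `|Y w i 0| <= K]).
  apply: fin_bigcap_measurable => [|i _]; first exact: finite_finset.
  rewrite -[X in measurable X]setTI; apply: measurable_fun_le => //.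
  by apply: measurableT_comp => //; exact: mY.
by apply/seteqP; split => w /= H i; [move=> _|]; exact: H.
Qed.

Lemma tight_vec d (T : measurableType d) (P : probability T R) (Y : T -> 'cV[R]_r)
    (eta : R) : meas_vec Y -> 0 < eta ->
  exists2 K, 0 < K & (P (~` [set w | forall i, (`|Y w i 0| <= K)%R]) <= eta%:E)%E.
Proof.
move=> mY eta0.
pose A n := [set w | forall i, `|Y w i 0| <= n.+1%:R].
have mA n : measurable (A n) by exact: measurable_box.
have c0 : \int[P]_w (\1_(~` A n) w : R) @[n --> \oo] --> \int[P]_w (0 : R).
  apply: (Rintegral_dominated (g := cst 1)) => [n|w||n w].
  - by apply: measurable_indic; exact: measurableC.
  - apply: cvg_near_cst; have := nbhs_infty_ger (mnorm (Y w)).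
    apply: filterS => n Hn; have Aw : A n w.
      move=> i; apply: le_trans (mnorm_entry _ _ _) _.
      by apply: le_trans Hn _; rewrite ler_nat.
    by rewrite indicE memNset//; apply.
  - exact: finite_measure_integrable_cst.
  - by rewrite indicE ger0_norm// lern1 leq_b1.
move: c0; rewrite Rintegral_cst1 => /cvgrPdist_le/(_ _ eta0)[N _ /(_ N (leqnn _))/=].
rewrite sub0r normrN => h; exists N.+1%:R => //.
have mC : measurable (~` A N) by exact: measurableC.
have : fine (P (~` A N)) <= eta.
  apply: le_trans h; rewrite /Rintegral integral_indic ?setIT//; exact: ler_norm.
by rewrite -lee_fin fineK// fin_num_measure.
Qed.

Lemma weak_cvg_of_trig d (T : measurableType d) (P : probability T R)
    d' (T' : measurableType d') (P' : probability T' R)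
    (X : nat -> T -> 'cV[R]_r) (Y : T' -> 'cV[R]_r) (f : 'cV[R]_r -> R) (M : R) :
  (forall n, meas_vec (X n)) -> meas_vec Y ->
  (forall t, \int[P]_w cos (dotv t (X n w)) @[n --> \oo] --> \int[P']_w cos (dotv t (Y w))) ->
  (forall t, \int[P]_w sin (dotv t (X n w)) @[n --> \oo] --> \int[P']_w sin (dotv t (Y w))) ->
  (forall eta, 0 < eta -> exists K N, forall n, (N <= n)%N -> exists A, [/\ measurable A,
     A `<=` [set w | forall i, `|X n w i 0| <= K] & (P (~` A) <= eta%:E)%E]) ->
  continuous f -> (forall x, `|f x| <= M) ->
  ('E_P[fun w => f (X n w)] @[n --> \oo] --> 'E_P'[fun w => f (Y w)])%E.
Proof.
move=> mX mY Hc Hs tight cf fM.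
have mfX n := measurable_continuous_comp (mX n) cf fM.
have mfY := measurable_continuous_comp mY cf fM.
have iX n := bounded_integrable P (mfX n) (fun w => fM (X n w)).
have iY := bounded_integrable P' mfY (fun w => fM (Y w)).
have M0 : 0 <= M by exact: le_trans (fM 0).
have trig p : trig_poly p -> \int[P]_w p (X n w) @[n --> \oo] --> \int[P']_w p (Y w).
  elim=> [t b|a b p1 p2 t1 H1 t2 H2].
    have E dU (TU : measurableType dU) (PU : probability TU R) (W : TU -> 'cV[R]_r) : meas_vec W ->
        \int[PU]_w cos (dotv t (W w) + b) =
        cos b * (\int[PU]_w cos (dotv t (W w))) + (- sin b) * (\int[PU]_w sin (dotv t (W w))).
      move=> mW; have md := measurable_dotv t mW.
      have mc : measurable_fun setT (fun w => cos (dotv t (W w))).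
        by apply: measurableT_comp => //; exact: measurable_cos.
      have ms : measurable_fun setT (fun w => sin (dotv t (W w))).
        by apply: measurableT_comp => //; exact: measurable_sin.
      have ic := bounded_integrable PU mc (fun w => cos_max _).
      have is_ := bounded_integrable PU ms (fun w => sin_max _).
      rewrite -!RintegralZl// -RintegralD//; last 2 first.
      - exact: integrable_EFinZl.
      - exact: integrable_EFinZl.
      by apply: eq_Rintegral => w _; rewrite cosD; ring.
    rewrite E//; under eq_fun do rewrite E//.
    by apply: cvgD; apply: cvgMl_tmp; [exact: Hc|exact: Hs].
  have E dU (TU : measurableType dU) (PU : probability TU R) (W : TU -> 'cV[R]_r) : meas_vec W ->
      \int[PU]_w (a * p1 (W w) + b * p2 (W w)) =
      a * (\int[PU]_w p1 (W w)) + b * (\int[PU]_w p2 (W w)).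
    move=> mW; have [N1 B1] := trig_poly_bounded t1; have [N2 B2] := trig_poly_bounded t2.
    have i1 := bounded_integrable PU (measurable_trig_poly mW t1) (fun w => B1 _).
    have i2 := bounded_integrable PU (measurable_trig_poly mW t2) (fun w => B2 _).
    by rewrite -!RintegralZl// -RintegralD//; exact: integrable_EFinZl.
  rewrite E//; under eq_fun do rewrite E//.
  by apply: cvgD; apply: cvgMl_tmp.
rewrite unlock (_ : (fun n => _) = (fun n => (\int[P]_w f (X n w))%:E)); last first.
  by apply/funext => n; rewrite RintegralE.
rewrite RintegralE//; apply/cvg_EFin; first exact: nearW.
apply/cvgrPdist_le => e e0.
(* Off the box [p] and [f] share the bound [M], so the exceptional set costs 2 M eta, at most e / 8.
   With e / 8 on the box, each replacement of [f] by [p] costs e / 4. *)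
pose eta := e / (16 * (M + 1)).
have M1 : 0 < M + 1 by rewrite ltr_wpDl.
have eta0 : 0 < eta by rewrite divr_gt0// mulr_gt0.
have [K1 [N HN]] := tight _ eta0; have [K2 K20 HK2] := tight_vec P' mY eta0.
pose K := Num.max K1 K2.
have K0 : 0 < K by rewrite lt_max K20 orbT.
have e8 : 0 < e / 8 by rewrite divr_gt0.
have [p [tp pM pf]] := trig_approx cf fM K0 e8.
have Meta : 2 * M * eta <= e / 8.
  rewrite /eta; have -> : 2 * M * (e / (16 * (M + 1))) = e / 8 * (M / (M + 1)).
    by field; rewrite gt_eqF.
  rewrite -[leRHS]mulr1 ler_pM2l// ler_pdivrMr// mul1r lerDl//.
have close dU (TU : measurableType dU) (PU : probability TU R) (W : TU -> 'cV[R]_r) A :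
    meas_vec W -> measurable A -> (forall w, A w -> forall i, `|W w i 0| <= K) ->
    (PU (~` A) <= eta%:E)%E -> `|\int[PU]_w p (W w) - \int[PU]_w f (W w)| <= e / 4.
  move=> mW mA AK PA.
  have := @Rintegral_approx _ _ PU (fun w => p (W w)) (fun w => f (W w)) M (e / 8) eta A
    (measurable_trig_poly mW tp) (measurable_continuous_comp mW cf fM)
    (fun w => pM _) (fun w => fM _) mA (ltW e8) (fun w Aw => pf _ (AK _ Aw)) PA.
  by move/le_trans; apply; lra.
have e4 : 0 < e / 4 by rewrite divr_gt0.
have /cvgrPdist_le/(_ _ e4)[N' _ HN'] := trig _ tp.
exists (maxn N N') => // n /=; rewrite geq_max => /andP[n1 n2].
have [A [mA AK PA]] := HN _ n1.
have cX : `|\int[P]_w p (X n w) - \int[P]_w f (X n w)| <= e / 4.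
  apply: close PA => // w /AK h i; apply: le_trans (h i) _.
  by rewrite /K le_max lexx.
have cY : `|\int[P']_w p (Y w) - \int[P']_w f (Y w)| <= e / 4.
  apply: close HK2 => //; first exact: measurable_box.
  by move=> w /= h i; apply: le_trans (h i) _; rewrite /K le_max lexx orbT.
have := HN' _ n2; rewrite /= => cp.
rewrite (_ : _ - _ = - (\int[P']_w p (Y w) - \int[P']_w f (Y w)) +
  (\int[P']_w p (Y w) - \int[P]_w p (X n w)) +
  (\int[P]_w p (X n w) - \int[P]_w f (X n w))); last by ring.
apply: le_trans (ler_normD _ _) _.
apply: le_trans (lerD (ler_normD _ _) (lexx _)) _.
by rewrite normrN; lra.
Qed.

End weak_convergence.

(** * Gaussian vectors *)

Section normal_characteristic.
Variable R : realType.
Notation leb := (@lebesgue_measure R).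
Notation N01 := (@normal_prob R 0 1).
Let phi (x : R) : R := normal_pdf 0 1 x.
Let c : R := @normal_peak R 1.

Let phiE x : phi x = c * expR (- (x ^+ 2 / 2)).
Proof.
rewrite /phi normal_pdfE ?oner_eq0// /normal_fun subr0 expr1n.
by rewrite mulNr.
Qed.

Let phi_derive (x : R) : is_derive x 1 phi (- (x * phi x)).
Proof.
have -> : phi = fun x => c * expR (- (2^-1 *: x ^+ 2)).
  by apply/funext => y; rewrite phiE /GRing.scale/= [2^-1 * _]mulrC.
apply: is_derive_eq.
by rewrite /GRing.scale/=; field.
Qed.

Lemma integral_normal_transfer (g : R -> R) : N01.-integrable setT (EFin \o g) ->
  leb.-integrable setT (EFin \o (fun x => phi x * g x)) /\
  \int[leb]_x (phi x * g x) = \int[N01]_x g x.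
Proof.
move=> gi; have mphi : measurable_fun setT phi by exact: measurable_normal_pdf.
have [||||||i E] := @integral_transfer _ _ _ _ R leb N01 phi id 1 g => //.
- by move=> x; exact: normal_pdf_ge0.
- move=> A mA; rewrite mul1e /= /normal_prob [RHS]integral_mkcond.
  apply: eq_integral => x _; rewrite /patch indicE; case: ifP => _; by rewrite ?mulr1 ?mulr0.
by rewrite E mul1r.
Qed.

(** The majorant is a multiple of the normal density of variance 2: |x| is at most 1 + x^2 / 4,
    hence at most exp (x^2 / 4), which absorbs half of the exponent. *)
Let integrable_xphi : leb.-integrable setT (EFin \o (fun x => phi x * x)).
Proof.
pose s : R := Num.sqrt 2; have s0 : s != 0 by rewrite gt_eqF// sqrtr_gt0.
have mphi : measurable_fun setT phi by exact: measurable_normal_pdf.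
have i2 := integrable_EFinZl (2 * c / normal_peak s) (integrable_normal_pdf 0 s).
apply: integrable_le i2; first exact: measurable_funM.
move=> x; have ps : 0 < normal_peak s by exact: normal_peak_gt0.
rewrite normrM phiE normal_pdfE// /normal_fun subr0 sqr_sqrtr//.
have c0 : 0 <= c by exact: normal_peak_ge0.
rewrite ger0_norm ?mulr_ge0 ?expR_ge0//.
have -> : 2 * c / normal_peak s * (normal_peak s * expR (- x ^+ 2 / (2 *+ 2))) =
   c * (2 * expR (- (x ^+ 2 / 4))).
  rewrite (_ : - x ^+ 2 / (2 *+ 2) = - (x ^+ 2 / 4)); last by rewrite mulNr (_ : 2 *+ 2 = 4 :> R)// -mulr_natr -natrM.
  by field; rewrite gt_eqF.
rewrite -mulrA ler_wpM2l//.
have -> : - (x ^+ 2 / 2) = - (x ^+ 2 / 4) + - (x ^+ 2 / 4) by field.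
rewrite expRD -mulrA [leRHS]mulrC ler_wpM2l ?expR_ge0//.
rewrite expRN mulrC ler_pdivrMr ?expR_gt0//.
have := expR_ge1Dx (x ^+ 2 / 4); have := sqr_ge0 (`|x| - 2).
rewrite sqrrB real_normK ?num_real//; have := normr_ge0 x; lra.
Qed.

Lemma integrable_normal_id : N01.-integrable setT (EFin \o id).
Proof.
apply/integrableP; split; first exact/measurable_EFinP.
have mphi : measurable_fun setT phi by exact: measurable_normal_pdf.
have h : (forall A, measurable A -> \int[leb]_w (phi w * \1_A w)%:E = 1%:E * N01 A)%E.
  move=> A mA; rewrite mul1e /= /normal_prob [RHS]integral_mkcond.
  apply: eq_integral => x _; rewrite /patch indicE; case: ifP => _; by rewrite ?mulr1 ?mulr0.
have mn : measurable_fun setT (fun x : R => `|x|) by exact: measurableT_comp.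
have E := @ge0_integral_transfer _ _ _ _ R leb N01 phi id 1 (fun x => `|x|) mphi
   (fun x => normal_pdf_ge0 _ _ _) (@measurable_id _ _ _) ler01 h mn (fun x => normr_ge0 x).
move: E; rewrite mul1e => /= <-.
have /integrableP[_] := integrable_xphi.
by under eq_integral do rewrite /= normrM ger0_norm ?normal_pdf_ge0//.
Qed.

(* Stein's identity follows by integrating [k' t b], the derivative of [k t b], over R. *)
Let k (t b x : R) : R := - (phi x * sin (t * x + b)).
Let k' (t b x : R) : R := phi x * (x * sin (t * x + b)) - t * (phi x * cos (t * x + b)).

Let k_derive (t b x : R) : is_derive x 1 (k t b) (k' t b x).
Proof.
have ds : is_derive x 1 (fun x => sin (t * x + b)) (t * cos (t * x + b)).
  by apply: is_derive_eq; rewrite /GRing.scale/=; ring.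
have dm := is_deriveM (phi_derive x) ds.
rewrite /k (_ : (fun x => - (phi x * sin (t * x + b))) = - (phi * (fun x => sin (t * x + b))))//.
by apply: is_derive_eq; rewrite /k' /GRing.scale/=; ring.
Qed.

Let continuous_phi : continuous phi.
Proof. by apply: continuous_normal_pdf; rewrite oner_eq0. Qed.

Let continuous_k' t b : continuous (k' t b).
Proof.
have cl : continuous (fun x : R => t * x + b).
  by move=> y; apply: cvgD; [apply: cvgMl_tmp|exact: cvg_cst].
have cs (h : R -> R) : continuous h -> continuous (fun x => h (t * x + b)).
  by move=> ch y; apply: (continuous_comp (cl y)); exact: ch.
move=> x; apply: cvgB.
  apply: cvgM; first exact: continuous_phi.
  by apply: cvgM; [exact: cvg_id|apply: cs; exact: continuous_sin].
apply: cvgMl_tmp; apply: cvgM; first exact: continuous_phi.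
by apply: cs; exact: continuous_cos.
Qed.

Let ic01 t b : N01.-integrable setT (EFin \o (fun x => cos (t * x + b))).
Proof.
apply: (bounded_integrable _ (M := 1)) => [|x]; last exact: cos_max.
apply: measurableT_comp; first exact: measurable_cos.
by apply: measurable_funD => //; exact: measurable_funM.
Qed.

Let ixs01 t b : N01.-integrable setT (EFin \o (fun x => x * sin (t * x + b))).
Proof.
apply: integrable_le (integrable_norm integrable_normal_id) => [|x].
  apply: measurable_funM => //; apply: measurableT_comp; first exact: measurable_sin.
  by apply: measurable_funD => //; exact: measurable_funM.
by rewrite /= normrM -[leRHS]mulr1 ler_wpM2l// sin_max.
Qed.

Let ik' t b : leb.-integrable setT (EFin \o k' t b).
Proof.
have [h1 _] := integral_normal_transfer (ixs01 t b).
have [h2 _] := integral_normal_transfer (ic01 t b).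
by apply: integrable_EFinB => //; exact: integrable_EFinZl.
Qed.

(** Over [-(n + 1), n + 1] the integral is a difference of boundary values of [k t b], which decay
    like the density; dominated convergence extends this to the line. *)
Let int_k'0 t b : \int[leb]_x k' t b x = 0.
Proof.
pose I n : set R := `[- n.+1%:R, n.+1%:R]%classic.
pose f n x := k' t b x * \1_(I n) x.
have mk' := integrable_measurable (ik' t b).
have fc : \int[leb]_x f n x @[n --> \oo] --> \int[leb]_x k' t b x.
  apply: (@Rintegral_dominated _ _ _ leb f (k' t b) (fun x => `|k' t b x|)) => [n|x||n x].
  - by apply: measurable_funM => //; apply: measurable_indic; exact: measurable_itv.
  - apply: cvg_near_cst; have := nbhs_infty_ger `|x|; apply: filterS => n xn.
    rewrite /f indicE mem_set ?mulr1// /I/= in_itv/= -ler_norml.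
    by apply: le_trans xn _; rewrite ler_nat.
  - exact: integrable_norm (ik' t b).
  - by rewrite /f normrM -[leRHS]mulr1 ler_wpM2l// indicE ger0_norm// lern1 leq_b1.
have fE n : \int[leb]_x f n x = k t b n.+1%:R - k t b (- n.+1%:R).
  have lt : - n.+1%:R < n.+1%:R :> R by have := ltr0Sn R n; lra.
  rewrite /Rintegral (_ : (\int[leb]_x (f n x)%:E = \int[leb]_(x in I n) (k' t b x)%:E)%E).
    rewrite (@continuous_FTC2 R (k' t b) (k t b) _ _ lt)//.
    - by apply: continuous_subspaceT; exact: continuous_k'.
    - have kc : continuous (k t b).
        move=> x; apply/differentiable_continuous/derivable1_diffP.
        by have [] := k_derive t b x.
      split.
      + by move=> x _; have [] := k_derive t b x.
      + by apply: cvg_at_right_filter; exact: kc.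
      + by apply: cvg_at_left_filter; exact: kc.
    - by move=> x _; rewrite derive1E; have [_ ->] := k_derive t b x.
  rewrite [RHS]integral_mkcond; apply: eq_integral => x _.
  by rewrite /patch /f indicE; case: ifP => _; rewrite ?mulr1 ?mulr0.
have f0 : \int[leb]_x f n x @[n --> \oo] --> (0 : R).
  apply/norm_cvg0P; apply: (@squeeze_cvgr _ _ _ _ (cst 0) (fun n => 2 * c * (2 * n.+1%:R^-1))).
  - apply: nearW => n; rewrite normr_ge0 fE/=.
    have kb y : y ^+ 2 = n.+1%:R ^+ 2 -> `|k t b y| <= c * (2 * n.+1%:R^-1).
      move=> yE; rewrite normrN normrM -[leRHS]mulr1 ler_pM ?sin_max//.
      have c0 : 0 <= c by exact: normal_peak_ge0.
      rewrite phiE yE ger0_norm ?mulr_ge0 ?expR_ge0// ler_wpM2l//.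
      rewrite expRN -[2 * _]invrK lef_pV2 ?posrE ?expR_gt0 ?invr_gt0 ?mulr_gt0 ?invr_gt0//.
      apply: le_trans (expR_ge1Dx _); rewrite invfM invrK.
      have n1 : 1 <= n.+1%:R :> R by rewrite ler1n.
      nra.
    apply: le_trans (ler_normB _ _) _.
    by rewrite -mulrA mulr_natl mulr2n; apply: lerD; apply: kb => //; exact: sqrrN.
  - exact: cvg_cst.
  - rewrite -[X in _ --> X](mulr0 (2 * c)); apply: cvgMl_tmp.
    rewrite -[X in _ --> X](mulr0 2); apply: cvgMl_tmp; exact: cvg_harmonic.
exact: (cvg_unique _ fc f0).
Qed.

Lemma normal_stein t b :
  \int[N01]_x (x * sin (t * x + b)) = t * \int[N01]_x cos (t * x + b).
Proof.
have [h1 E1] := integral_normal_transfer (ixs01 t b).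
have [h2 E2] := integral_normal_transfer (ic01 t b).
have := int_k'0 t b; rewrite /k' RintegralB//; last exact: integrable_EFinZl.
by rewrite RintegralZl// E1 E2 => /subr0_eq.
Qed.

Let H (b t : R) : R := \int[N01]_x cos (t * x + b).

(** Differentiation under the integral, with majorant |y|, produces the left side of Stein's
    identity, which turns the derivative into a linear differential equation. *)
Let H_derive (b t : R) : is_derive t 1 (H b) (- t * H b t).
Proof.
have tI : `]t - 1, t + 1[%classic t by rewrite /= in_itv/=; apply/andP; split; lra.
have d (x y : R) : is_derive x 1 (fun u : R => cos (u * y + b)) (- (y * sin (x * y + b))).
  by apply: is_derive_eq; rewrite /GRing.scale/=; ring.
have dE : partial1of2 (fun u y : R => cos (u * y + b)) = fun u y => - (y * sin (u * y + b)).
  by apply/funext => x; apply/funext => y; rewrite /partial1of2 derive1E; have [_ ->] := d x y.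
have ders : forall (x y : R), `]t - 1, t + 1[%classic x -> setT y ->
    derivable ((fun u y : R => cos (u * y + b)) ^~ y) x 1.
  by move=> x y _ _; have [] := d x y.
have bnd : forall (x y : R), `]t - 1, t + 1[%classic x -> setT y ->
    `|partial1of2 (fun u y : R => cos (u * y + b)) x y| <= `|y|.
  by move=> x y _ _; rewrite dE normrN normrM -[leRHS]mulr1 ler_wpM2l// sin_max.
have iN := integrable_norm integrable_normal_id.
have int x : `]t - 1, t + 1[%classic x -> N01.-integrable setT (EFin \o (fun y : R => cos (x * y + b))).
  by move=> _; exact: ic01.
apply: DeriveDef.
  exact: (derivable_under_integral measurableT tI int ders (fun y => normr_ge0 y) iN bnd).
rewrite -derive1E (differentiation_under_integral measurableT tI int ders (fun y => normr_ge0 y) iN bnd).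
rewrite dE; under eq_Rintegral do rewrite -mulN1r.
by rewrite RintegralZl// normal_stein mulN1r mulNr.
Qed.

(** By that equation [H b t] times exp (t^2 / 2) has zero derivative, so it keeps its value cos b at
    0. *)
Lemma normal_cos (b t : R) : \int[N01]_x cos (t * x + b) = cos b * expR (- t ^+ 2 / 2).
Proof.
rewrite -/(H b t).
have d (x : R) : is_derive x 1 (fun u => H b u * expR (2^-1 *: u ^+ 2)) 0.
  have hd := H_derive b x.
  have de : is_derive x 1 (fun u : R => expR (2^-1 *: u ^+ 2)) (x * expR (2^-1 *: x ^+ 2)).
    by apply: is_derive_eq; rewrite /GRing.scale/=; field.
  have dm := is_deriveM hd de.
  apply: is_derive_eq; by rewrite /GRing.scale/=; ring.
have := is_derive_0_is_cst t 0 d.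
rewrite /GRing.scale/= expr0n mulr0 expR0 mulr1 => E.
have H0 : H b 0 = cos b.
  by rewrite /H; under eq_Rintegral do rewrite mul0r add0r; rewrite Rintegral_cst1.
rewrite -H0 -E -mulrA -expRD (_ : 2^-1 * _ + _ = 0) ?expR0 ?mulr1//.
by field.
Qed.

End normal_characteristic.

Section cholesky.
Variable R : realType.

Lemma dotv_mulmx n m (A : 'M[R]_(n, m)) (x : 'cV[R]_n) (y : 'cV[R]_m) :
  dotv x (A *m y) = dotv (A^T *m x) y.
Proof. by rewrite !dotvE trmx_mul trmxK mulmxA. Qed.

Lemma dotv_col_mx n1 n2 (a c : 'cV[R]_n1) (b d : 'cV[R]_n2) :
  dotv (col_mx a b) (col_mx c d) = dotv a c + dotv b d.
Proof. by rewrite !dotvE tr_col_mx mul_row_col mxE. Qed.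

Lemma psd_unitmx_pd n (S : 'M[R]_n) : S^T = S -> S \in unitmx ->
  (forall t, 0 <= dotv t (S *m t)) -> forall t, t != 0 -> 0 < dotv t (S *m t).
Proof.
move=> Ss Su S0 t; apply: contraNT; rewrite -leNgt => St.
have {}St : dotv t (S *m t) = 0 by apply/eqP; rewrite eq_le St S0.
suff /eqP : S *m t = 0.
  by move=> /eqP St0; rewrite -(mulKmx Su t) St0 mulmx0.
(* otherwise the form would be negative at [t - x *: u] for some small [x > 0] *)
pose u := S *m t; pose q := dotv u (S *m u).
have E x : dotv (t - x *: u) (S *m (t - x *: u)) = x ^+ 2 * q - 2 * x * dotv u u.
  rewrite mulmxBr -scalemxAr dotvBr dotvZr ![dotv (t - _) _]dotvC !dotvBr !dotvZr.
  rewrite [dotv (S *m t) t]dotvC St [dotv (S *m u) t]dotvC dotv_mulmx Ss -/u.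
  by rewrite [dotv (S *m u) u]dotvC -/q; ring.
have q0 : 0 <= q by exact: S0.
have u0 : 0 <= dotv u u by apply: sumr_ge0 => i _; rewrite -expr2 sqr_ge0.
have : dotv u u <= 0.
  rewrite leNgt; apply/negP => upos.
  (* At this x the form equals -|u|^4 (q + 2) / (q + 1)^2; the added 1 covers the case q = 0. *)
  have := S0 (t - (dotv u u / (q + 1)) *: u); rewrite E => h.
  have q1 : 0 < q + 1 by lra.
  have hE : (dotv u u / (q + 1)) ^+ 2 * q - 2 * (dotv u u / (q + 1)) * dotv u u =
     - ((dotv u u) ^+ 2 * ((q + 2) / (q + 1) ^+ 2)) by field; rewrite gt_eqF.
  move: h; rewrite hE oppr_ge0 leNgt mulr_gt0 ?exprn_gt0// divr_gt0 ?exprn_gt0//; lra.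
move=> un; have {}un : dotv u u = 0 by apply/eqP; rewrite eq_le un u0.
apply/matrixP => i j; rewrite ord1 [RHS]mxE.
have uu (k : 'I_n) : 0 <= u k 0 * u k 0 by rewrite -expr2 sqr_ge0.
have : u i 0 * u i 0 = 0 by exact: (psumr_eq0P (fun k _ => uu k) un).
by rewrite -expr2 => /eqP; rewrite sqrf_eq0 => /eqP.
Qed.

(** Induction on the Schur complement D - b b^T / a of the first entry. Its form at y is the value
    of the whole form at (- b.y / a, y), the minimum over the first coordinate, hence positive. *)
Lemma cholesky n (S : 'M[R]_n) : S^T = S ->
  (forall t, t != 0 -> 0 < dotv t (S *m t)) -> exists A : 'M[R]_n, S = A *m A^T.
Proof.
elim: n S => [|n IH] S Ss Spos; first by exists 0; apply/matrixP => -[].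
rewrite -[n.+1]/(1 + n)%N in S Ss Spos *.
pose a := ulsubmx S 0 0; pose b := dlsubmx S; pose D := drsubmx S.
have SE : S = block_mx a%:M b^T b D.
  rewrite -[S in LHS]submxK /a -mx11_scalar -/b -/D; congr block_mx.
  by rewrite /b trmx_dlsub Ss.
have Ds : D^T = D by rewrite /D trmx_drsub Ss.
have QE (x : 'M[R]_1) (y : 'cV[R]_n) : dotv (col_mx x y) (S *m col_mx x y) =
    a * x 0 0 ^+ 2 + 2 * x 0 0 * dotv b y + dotv y (D *m y).
  rewrite SE mul_block_col dotv_col_mx !dotvDr.
  rewrite [x]mx11_scalar !mxE/= mulr1n; set z := x 0 0.
  rewrite [b *m z%:M]mul_mx_scalar dotvZr (dotvC y b) (dotv_mulmx b^T) trmxK.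
  rewrite [b *m z%:M]mul_mx_scalar (dotvC (z *: b)) dotvZr (dotvC y b).
  have -> : dotv z%:M (a%:M *m z%:M) = a * z ^+ 2 :> R.
    by rewrite -scalar_mxM /dotv big_ord1 !mxE !mulr1n; ring.
  by ring.
have a0 : 0 < a.
  have := Spos (col_mx 1%:M 0); rewrite QE !mxE/= !mulmx0 !dotvE mulmx0 trmx0 mul0mx !mxE.
  rewrite !mulr0 !addr0 mulr1n expr1n mulr1; apply.
  apply/eqP => /matrixP/(_ 0 0); rewrite !mxE; case: splitP => //= j _.
  by rewrite !mxE ord1 => /eqP; rewrite oner_eq0.
pose s := Num.sqrt a; have s0 : 0 < s by rewrite sqrtr_gt0.
have s2 : s ^+ 2 = a by rewrite sqr_sqrtr// ltW.
have [||A' A'E] := IH (D - a^-1 *: (b *m b^T)).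
- by rewrite linearB/= Ds linearZ/= trmx_mul trmxK.
- move=> y y0; have := Spos (col_mx (- (dotv b y / a))%:M y).
  rewrite QE !mxE mulr1n mulmxBl dotvBr -scalemxAl dotvZr -mulmxA.
  rewrite [b^T *m y]mx11_scalar -dotvE mul_mx_scalar dotvZr [dotv y b]dotvC.
  have -> : a * (- (dotv b y / a)) ^+ 2 + 2 * - (dotv b y / a) * dotv b y + dotv y (D *m y)
    = dotv y (D *m y) - a^-1 * (dotv b y * dotv b y).
    by field; rewrite gt_eqF.
  apply; apply: contraNneq y0 => h.
  by rewrite -[y](col_mxKd (- (dotv b y / a))%:M) h linear0.
exists (block_mx s%:M 0 (s^-1 *: b) A').
rewrite tr_block_mx mulmx_block !trmx0 !mulmx0 !mul0mx !addr0 tr_scalar_mx -scalar_mxM -expr2 s2.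
rewrite -A'E linearZ/= -!scalemxAl -!scalemxAr mul_scalar_mx mul_mx_scalar !scalerA.
rewrite ?mulVf ?mulfV ?gt_eqF// !scale1r -invfM -expr2 s2.
by rewrite [_ + (D - _)]addrC subrK.
Qed.

End cholesky.

Section gaussian_existence.
Variable R : realType.

(** The phase makes the induction work: integrating out the new coordinate leaves the remaining
    linear form as part of the phase in [normal_cos]. *)
Lemma standard_gaussian r : exists (d : measure_display) (T : measurableType d)
    (P : probability T R) (Y : T -> 'cV[R]_r), meas_vec Y /\
  forall t b, \int[P]_w cos (dotv t (Y w) + b) = cos b * expR (- dotv t t / 2).
Proof.
elim: r => [|r [d [T [P [Y [mY HY]]]]]].
  exists _, _, (@normal_prob R 0 1), (fun=> 0); split; first by move=> [].
  move=> t b; have t0 (y : 'cV[R]_0) : dotv t y = 0 by rewrite /dotv big_ord0.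
  by rewrite !t0 oppr0 mul0r expR0 mulr1 Rintegral_cst1 add0r.
rewrite -[r.+1]/(1 + r)%N; pose N01 := @normal_prob R 0 1.
pose Y' (z : T * R) : 'cV[R]_(1 + r) := col_mx z.2%:M (Y z.1).
have mY' : meas_vec Y'.
  move=> i; rewrite /Y'; have [j ij|j ij] := splitP (i : 'I_(1 + r)).
    rewrite (_ : (fun z => _) = snd); first exact: measurable_snd.
    apply/funext => z; have -> : i = lshift r j by exact: val_inj.
    by rewrite col_mxEu mxE !ord1.
  rewrite (_ : (fun z => _) = (fun w => Y w j 0) \o fst).
    by apply: measurableT_comp; [exact: mY|exact: measurable_fst].
  apply/funext => z; have -> : i = rshift 1 j by exact: val_inj.
  by rewrite col_mxEd.
exists _, _, (P \x N01)%E, Y'; split => // t b.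
pose t1 := usubmx (t : 'cV[R]_(1 + r)) 0 0; pose t2 := dsubmx (t : 'cV[R]_(1 + r)).
have tE : t = col_mx t1%:M t2 by rewrite -mx11_scalar vsubmxK.
have E z : dotv t (Y' z) = t1 * z.2 + dotv t2 (Y z.1).
  by rewrite {1}tE dotv_col_mx /dotv big_ord1 !mxE !mulr1n.
have tt : dotv t t = t1 * t1 + dotv t2 t2.
  by rewrite {1 2}tE dotv_col_mx /dotv big_ord1 !mxE !mulr1n.
have mc : measurable_fun setT (fun z => cos (dotv t (Y' z) + b)).
  apply: measurableT_comp; first exact: measurable_cos.
  by apply: measurable_funD => //; exact: measurable_dotv.
have ic := bounded_integrable (P \x N01)%E mc (fun z => cos_max _).
rewrite /Rintegral -(integral12_prod_meas1 ic) /fubini_F.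
have -> : (\int[P]_x \int[N01]_y (cos (dotv t (Y' (x, y)) + b))%:E =
   \int[P]_x (expR (- t1 ^+ 2 / 2) * cos (dotv t2 (Y x) + b))%:E)%E.
  apply: eq_integral => x _.
  under eq_integral do rewrite E/= -addrA.
  rewrite RintegralE ?normal_cos 1?mulrC//.
  apply: (bounded_integrable _ (M := 1)) => [|z]; last exact: cos_max.
  apply: measurableT_comp; first exact: measurable_cos.
  by apply: measurable_funD => //; exact: measurable_funM.
rewrite -[LHS]/(\int[P]_x _) RintegralZl//; last first.
  apply: (bounded_integrable _ (M := 1)) => [|z]; last exact: cos_max.
  apply: measurableT_comp; first exact: measurable_cos.
  by apply: measurable_funD => //; exact: measurable_dotv.
by rewrite HY mulrCA -expRD tt; congr (_ * expR _); field.
Qed.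

Lemma gaussian_exists r (S : 'M[R]_r) : S^T = S ->
  (forall t, t != 0 -> 0 < dotv t (S *m t)) ->
  exists (d : measure_display) (T : measurableType d)
    (P : probability T R) (Y : T -> 'cV[R]_r), meas_vec Y /\
  forall t b, \int[P]_w cos (dotv t (Y w) + b) = cos b * expR (- dotv t (S *m t) / 2).
Proof.
move=> Ss Spos; have [A AE] := cholesky Ss Spos.
have [d [T [P [Y [mY HY]]]]] := standard_gaussian r.
exists d, T, P, (fun w => A *m Y w); split.
  move=> i; under eq_fun do rewrite mxE.
  by apply: measurable_sum => j; exact: measurable_funM.
move=> t b; under eq_Rintegral do rewrite dotv_mulmx.
by rewrite HY AE -mulmxA (dotv_mulmx A).
Qed.

End gaussian_existence.

(** * Expansion of the estimator *)

Section empirical_likelihood_perturbation.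
Variables (R : realType) (r m : nat) (V : 'M[R]_m) (C : 'M[R]_(r, m)).
Variables (K Mv Mp : R).
Hypotheses (Vu : V \in unitmx) (K0 : 0 <= K) (Mv0 : 0 <= Mv) (Mp0 : 0 <= Mp).

(** [B] adds up everything it has to dominate. [L * e] is the error level passed to the likelihood
    section: the error of the second-moment matrix is at most (4 + 2 Mv) e, that of the cross
    moments at most (2 + Mp) e. *)
Variables (B L : R).
Hypotheses (BE : B = 2 + m%:R + mnorm (invmx V) + mnorm C + K + 2 * Mv + Mp)
  (LE : L = 4 + 2 * Mv + Mp).

Lemma EL_perturbation (e : R) n (u v : nat -> 'cV[R]_m) (ps : nat -> 'cV[R]_r) :
  0 < e -> e * (L * (100 * B ^+ 10)) <= 1 -> (0 < n)%N ->
  (forall j, (j < n)%N -> enorm (u j) <= e * Num.sqrt n%:R) ->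
  enorm (emean n u - emean n v) <= e / Num.sqrt n%:R ->
  n%:R^-1 * \sum_(j < n) enorm (u j - v j) ^+ 2 <= e ^+ 2 ->
  (forall i k, `|n%:R^-1 * \sum_(j < n) (v j i 0 * v j k 0) - V i k| <= e) ->
  (forall i k, `|n%:R^-1 * \sum_(j < n) (ps j i 0 * v j k 0) - C i k| <= e) ->
  n%:R^-1 * \sum_(j < n) enorm (ps j) ^+ 2 <= Mp ->
  n%:R^-1 * \sum_(j < n) enorm (v j) ^+ 2 <= Mv ->
  (forall i, `|\sum_(j < n) v j i 0| <= K * Num.sqrt n%:R) ->
  (exists! z, EL_solves n u z) /\
  (forall z, EL_solves n u z ->
     enorm (EL_theta n ps u z - emean n ps + emean n (fun j => C *m invmx V *m v j)) <=
     r%:R * (400 * B ^+ 13 * L) * (e / Num.sqrt n%:R)).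
Proof.
move=> e0 eB n0 H1 H2 H3 H4 H5 H6 H6' H7.
set s := Num.sqrt n%:R in H1 H2 H7 *.
have s0 : 0 < s by rewrite sqrtr_gt0 ltr0n.
have nr0 : 0 < n%:R :> R by rewrite ltr0n.
have ninv0 : 0 <= n%:R^-1 :> R by rewrite invr_ge0.
have V0 := mnorm_ge0 (invmx V); have C0 := mnorm_ge0 C; have m0 : 0 <= m%:R :> R by [].
have [k0 mv0 mp0] : [/\ 0 <= K, 0 <= Mv & 0 <= Mp] by [].
have B2 : 2 <= B by rewrite BE; lra.
have B1 : 1 <= B by apply: le_trans B2; rewrite ler1n.
have L1 : 1 <= L by rewrite LE; lra.
have e1 : e <= 1.
  apply: le_trans eB; rewrite -[leLHS]mulr1 ler_pM2l// -[leLHS]mulr1 ler_pM//.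
  rewrite -[leLHS]mulr1 ler_pM//; first by lra.
  by rewrite exprn_ege1.
pose eL := L * e; have eL0 : 0 < eL by rewrite mulr_gt0// (lt_le_trans _ L1).
have eLB : eL * (100 * B ^+ 10) <= 1 by rewrite /eL [L * e]mulrC -mulrA.
have eeL : e <= eL by rewrite /eL -[leLHS]mul1r ler_wpM2r// ltW.
pose d j := enorm (u j - v j).
have d0 j : 0 <= d j by exact: sqrtr_ge0.
have en0 k (x : 'cV[R]_k) : 0 <= enorm x by exact: sqrtr_ge0.
have ent k (x : 'cV[R]_k) i : `|x i 0| <= enorm x.
  exact: le_trans (mnorm_entry _ _ _) (mnorm_le_enorm _).
have mean_le (f g : nat -> R) : (forall j, f j <= g j) ->
    n%:R^-1 * \sum_(j < n) f j <= n%:R^-1 * \sum_(j < n) g j.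
  by move=> fg; rewrite ler_wpM2l// ler_sum.
have mean_norm (f : nat -> R) : `|n%:R^-1 * \sum_(j < n) f j| <= n%:R^-1 * \sum_(j < n) `|f j|.
  by rewrite normrM ger0_norm// ler_wpM2l// ler_norm_sum.
have meanD (a c : R) (f g : nat -> R) : n%:R^-1 * \sum_(j < n) (a * f j + c * g j) =
    a * (n%:R^-1 * \sum_(j < n) f j) + c * (n%:R^-1 * \sum_(j < n) g j).
  by rewrite big_split/= -!mulr_sumr; ring.
(* weighted AM-GM: [d * x <= d^2 / e + e * x^2] *)
have young a x : 0 <= a -> 0 <= x -> a * x <= e^-1 * a ^+ 2 + e * x ^+ 2.
  move=> a0 x0; rewrite -(ler_pM2l e0).
  rewrite (_ : e * (e^-1 * _ + _) = a ^+ 2 + (e * x) ^+ 2); last by field; rewrite gt_eqF.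
  by have := sqr_ge0 (a - e * x); have := mulr_ge0 (ltW e0) (mulr_ge0 a0 x0); nra.
have uE j i : u j i 0 = v j i 0 + (u j - v j) i 0 by rewrite !mxE; ring.
have uB j : mnorm (u j) ^+ 2 <= 2 * enorm (v j) ^+ 2 + 2 * d j ^+ 2.
  have h : mnorm (u j) <= enorm (v j) + d j.
    rewrite -[u j](subrK (v j)) addrC (le_trans (ler_mnormD _ _))//.
    by rewrite lerD// mnorm_le_enorm.
  have := mnorm_ge0 (u j); have := en0 _ (v j); have := d0 j.
  by have := sqr_ge0 (enorm (v j) - d j); nra.
have e2 : e ^+ 2 <= e by rewrite expr2 -[leRHS]mul1r ler_wpM2r// ltW.
have uuB : n%:R^-1 * \sum_(j < n) mnorm (u j) ^+ 2 <= 2 * Mv + 2.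
  apply: le_trans (mean_le _ _ uB) _.
  rewrite (meanD _ _ (fun j => enorm (v j) ^+ 2) (fun j => d j ^+ 2)); have : n%:R^-1 * \sum_(j < n) d j ^+ 2 <= e ^+ 2 by [].
  lra.
have uje j : (j < n)%N -> mnorm (u j) <= eL * s.
  move=> jn; apply: le_trans (mnorm_le_enorm _) _; apply: le_trans (H1 _ jn) _.
  by rewrite ler_wpM2r// ltW.
have uv : mnorm (emean n u - emean n v) <= eL / s.
  apply: le_trans (mnorm_le_enorm _) _; apply: le_trans H2 _.
  by rewrite ler_wpM2r// invr_ge0 ltW.
have ns : n%:R^-1 * s = s^-1.
  by rewrite -[n%:R]sqr_sqrtr ?ler0n// -/s; field; rewrite gt_eqF.
have vK : mnorm (emean n v) <= K / s.
  apply: mnorm_le => [|i j]; first by rewrite divr_ge0// ltW.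
  rewrite ord1 /emean mxE summxE normrM ger0_norm//.
  by rewrite -ns mulrCA ler_wpM2l.
have ubarB : mnorm (emean n u) <= 2 * B / s.
  rewrite -[emean n u](subrK (emean n v)); apply: le_trans (ler_mnormD _ _) _.
  have h1 : e / s <= 1 / s by rewrite ler_wpM2r// invr_ge0 ltW.
  have h2 : mnorm (emean n u - emean n v) <= e / s.
    by apply: le_trans (mnorm_le_enorm _) _.
  apply: (@le_trans _ _ (1 / s + K / s)); first by rewrite lerD// (le_trans h2).
  rewrite -mulrDl ler_wpM2r ?invr_ge0 ?(ltW s0)//.
  by rewrite BE; lra.
have WV : mnorm (n%:R^-1 *: \sum_(j < n) u j *m (u j)^T - V) <= eL.
  apply: mnorm_le => [|i k]; first exact: ltW.
  have -> : (n%:R^-1 *: \sum_(j < n) u j *m (u j)^T - V) i k =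
     n%:R^-1 * \sum_(j < n) (u j i 0 * u j k 0 - v j i 0 * v j k 0) +
     (n%:R^-1 * \sum_(j < n) (v j i 0 * v j k 0) - V i k).
    rewrite !mxE summxE sumrB mulrBr subrKA; congr (_ * _ - _).
    by apply: eq_bigr => j _; rewrite !mxE big_ord1 !mxE.
  apply: le_trans (ler_normD _ _) _; apply: le_trans (lerD (mean_norm (fun j => u j i 0 * u j k 0 - v j i 0 * v j k 0)) (H4 i k)) _.
  (* With d = u - v, an entry of u u^T - v v^T is a product of two entries of d plus two cross
     terms. [young] bounds each cross term by |d|^2 / e + e |v|^2, of mean order [e] because |d|^2
     has mean at most e^2. *)
  apply: (@le_trans _ _ ((1 + 2 * e^-1) * e ^+ 2 + (2 * e) * Mv + e)); last first.
    have -> : (1 + 2 * e^-1) * e ^+ 2 = e ^+ 2 + 2 * e by field; rewrite gt_eqF.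
    by rewrite /eL LE; have := mulr_ge0 mp0 (ltW e0); lra.
  rewrite lerD2r; apply: (@le_trans _ _ (n%:R^-1 * \sum_(j < n)
     ((1 + 2 * e^-1) * d j ^+ 2 + (2 * e) * enorm (v j) ^+ 2))); last first.
    rewrite (meanD _ _ (fun j => d j ^+ 2) (fun j => enorm (v j) ^+ 2)) lerD//.
      by rewrite ler_wpM2l// addr_ge0// mulr_ge0// invr_ge0 ltW.
    by rewrite ler_wpM2l// mulr_ge0// ltW.
  apply: (mean_le (fun j => `|u j i 0 * u j k 0 - v j i 0 * v j k 0|)
    (fun j => (1 + 2 * e^-1) * d j ^+ 2 + (2 * e) * enorm (v j) ^+ 2)) => j.
  rewrite !uE.
  have -> : (v j i 0 + (u j - v j) i 0) * (v j k 0 + (u j - v j) k 0) - v j i 0 * v j k 0 =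
     (u j - v j) i 0 * (u j - v j) k 0 + (u j - v j) i 0 * v j k 0 + (u j - v j) k 0 * v j i 0 by ring.
  have p (a b x y : R) : `|a| <= x -> `|b| <= y -> `|a * b| <= x * y by move=> *; rewrite normrM ler_pM.
  have h1 := p _ _ _ _ (ent _ (u j - v j) i) (ent _ (u j - v j) k).
  have h2 := p _ _ _ _ (ent _ (u j - v j) i) (ent _ (v j) k).
  have h3 := p _ _ _ _ (ent _ (u j - v j) k) (ent _ (v j) i).
  have yg := young (d j) (enorm (v j)) (d0 j) (en0 _ (v j)).
  apply: (@le_trans _ _ (d j * d j + d j * enorm (v j) + d j * enorm (v j))) => [|].
    by rewrite (le_trans (ler_normD _ _))// lerD// (le_trans (ler_normD _ _))// lerD.
  have -> : (1 + 2 * e^-1) * d j ^+ 2 = d j * d j + 2 * (e^-1 * d j ^+ 2) by ring.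
  have -> : 2 * e * enorm (v j) ^+ 2 = 2 * (e * enorm (v j) ^+ 2) by ring.
  by move: yg; move: (d j * d j) (e^-1 * _) (e * _) (d j * _) => x1 x2 x3 x4 yg; lra.
have psum (f : nat -> R) : (forall j, f j <= e^-1 * d j ^+ 2 + e * enorm (ps j) ^+ 2) ->
    n%:R^-1 * \sum_(j < n) f j <= e + e * Mp.
  move=> fh; apply: le_trans (mean_le _ _ fh) _.
  rewrite (meanD _ _ (fun j => d j ^+ 2) (fun j => enorm (ps j) ^+ 2)) lerD//.
    rewrite [leRHS](_ : e = e^-1 * e ^+ 2); last by field; rewrite gt_eqF.
    by rewrite ler_wpM2l// invr_ge0 ltW.
  by rewrite ler_wpM2l// ltW.
have CC : mnorm (n%:R^-1 *: \sum_(j < n) ps j *m (u j)^T - C) <= eL.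
  apply: mnorm_le => [|i k]; first exact: ltW.
  have -> : (n%:R^-1 *: \sum_(j < n) ps j *m (u j)^T - C) i k =
     n%:R^-1 * \sum_(j < n) (ps j i 0 * (u j - v j) k 0) +
     (n%:R^-1 * \sum_(j < n) (ps j i 0 * v j k 0) - C i k).
    rewrite !mxE summxE addrA -mulrDr -big_split/=; congr (_ * _ - _).
    by apply: eq_bigr => j _; rewrite !mxE big_ord1 !mxE; ring.
  apply: le_trans (ler_normD _ _) _; apply: le_trans (lerD (mean_norm (fun j => ps j i 0 * (u j - v j) k 0)) (H5 i k)) _.
  apply: (@le_trans _ _ (e + e * Mp + e)); last first.
    by rewrite /eL LE; have := mulr_ge0 mv0 (ltW e0); lra.
  rewrite lerD2r; apply: (psum (fun j => `|ps j i 0 * (u j - v j) k 0|)) => j.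
  apply: le_trans (young _ _ (d0 j) (en0 _ (ps j))).
  by rewrite normrM mulrC ler_pM// ent.
have puB : n%:R^-1 * \sum_(j < n) mnorm (ps j) * mnorm (u j) <= B.
  apply: (@le_trans _ _ (n%:R^-1 * \sum_(j < n) (1 * enorm (ps j) ^+ 2 + 1 * mnorm (u j) ^+ 2))).
    apply: (mean_le (fun j => mnorm (ps j) * mnorm (u j))
      (fun j => 1 * enorm (ps j) ^+ 2 + 1 * mnorm (u j) ^+ 2)) => j; have := mnorm_le_enorm (ps j); have := mnorm_ge0 (ps j).
    have := mnorm_ge0 (u j); have := sqr_ge0 (mnorm (u j) - enorm (ps j)).
    by have := en0 _ (ps j); nra.
  by rewrite (meanD _ _ (fun j => enorm (ps j) ^+ 2) (fun j => mnorm (u j) ^+ 2)) !mul1r BE; lra.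
have mB : m%:R <= B by rewrite BE; lra.
have LB : mnorm (invmx V) <= B by rewrite BE; lra.
have CB : mnorm C <= B by rewrite BE; lra.
have uuB' : n%:R^-1 * \sum_(j < n) mnorm (u j) ^+ 2 <= B by apply: le_trans uuB _; rewrite BE; lra.
have [z0 z0s [z0r z0E]] := EL_exists Vu B1 mB LB eL0 eLB n0 ubarB uje WV uuB' erefl erefl.
have uniq := EL_unique Vu B1 mB LB eL0 eLB n0 WV.
split; first by exists z0; split => // z' z's; exact: uniq.
move=> z zs; rewrite (uniq _ _ zs z0s).
have vE : emean n (fun j => C *m invmx V *m v j) = C *m invmx V *m emean n v.
  by rewrite /emean -scalemxAr mulmx_sumr.
rewrite vE; apply: le_trans (enorm_le_mnorm _) _; rewrite -mulrA ler_wpM2l//.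
have := EL_expansion B1 mB LB CB eL0 eLB n0 uje WV uuB' puB CC uv erefl erefl z0s z0r z0E.
by rewrite /eL !mulrA.
Qed.

Lemma EL_perturbation_const : 0 < L * (100 * B ^+ 10) /\ 0 <= r%:R * (400 * B ^+ 13 * L).
Proof.
have V0 := mnorm_ge0 (invmx V); have C0 := mnorm_ge0 C; have m0 : 0 <= m%:R :> R by [].
have [k0 mv0 mp0] : [/\ 0 <= K, 0 <= Mv & 0 <= Mp] by [].
have B2 : 0 < B by rewrite BE; lra.
have L1 : 0 < L by rewrite LE; lra.
split.
  by apply: mulr_gt0 => //; apply: mulr_gt0; [rewrite ltr0n|exact: exprn_gt0].
apply: mulr_ge0; first exact: ler0n.
by apply: mulr_ge0; [apply: mulr_ge0; [exact: ler0n|apply: exprn_ge0; exact: ltW]|exact: ltW].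
Qed.

End empirical_likelihood_perturbation.

Section square_integrable_vectors.
Variables (d : measure_display) (T : measurableType d) (R : realType).
Variable Q : probability T R.

Lemma measurable_enorm_sqr k (f : T -> 'cV[R]_k) : meas_vec f ->
  measurable_fun setT (fun z => enorm (f z) ^+ 2).
Proof.
move=> mf; under eq_fun do rewrite enorm_sqr.
by apply: measurable_sum => i; exact: measurable_funM.
Qed.

Lemma sq_int_integrable k (f : T -> 'cV[R]_k) : meas_vec f -> sq_int Q f ->
  Q.-integrable setT (EFin \o (fun z => enorm (f z) ^+ 2)).
Proof.
move=> mf f2; apply: ge0_integrable => //; first exact: measurable_enorm_sqr.
by move=> z; rewrite sqr_ge0.
Qed.

Lemma sq_int_entry k (f : T -> 'cV[R]_k) i : meas_vec f -> sq_int Q f ->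
  Q.-integrable setT (EFin \o (fun z => f z i 0 ^+ 2)).
Proof.
move=> mf f2; apply: integrable_le (sq_int_integrable mf f2).
  by apply: measurable_funX; exact: mf.
move=> z; rewrite normrX lerXn2r ?nnegrE ?sqrtr_ge0//.
exact: le_trans (mnorm_entry _ _ _) (mnorm_le_enorm _).
Qed.

Lemma sq_int_mul k l (f : T -> 'cV[R]_k) (g : T -> 'cV[R]_l) i j :
  meas_vec f -> sq_int Q f -> meas_vec g -> sq_int Q g ->
  Q.-integrable setT (EFin \o (fun z => f z i 0 * g z j 0)).
Proof.
move=> mf f2 mg g2; apply: integrable_square_mul; [exact: mf|exact: mg| |];
  exact: sq_int_entry.
Qed.

Lemma sq_int_entry1 k (f : T -> 'cV[R]_k) i : meas_vec f -> sq_int Q f ->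
  Q.-integrable setT (EFin \o (fun z => f z i 0)).
Proof. by move=> mf f2; apply: square_integrable; [exact: mf|exact: sq_int_entry]. Qed.

End square_integrable_vectors.

Section iid_vectors.
Variables (d : measure_display) (T : measurableType d)
  (dZ : measure_display) (Zs : measurableType dZ) (R : realType).
Variables (P : probability T R) (Q : probability Zs R) (Z : nat -> T -> Zs).
Hypothesis iidZ : iid_law P Q Z.

Lemma iid_vec_tail k (h : Zs -> 'cV[R]_k) (eta : R) : meas_vec h ->
  (forall i, Q.-integrable setT (EFin \o (fun z => h z i 0 ^+ 2))) ->
  (forall i, \int[Q]_z h z i 0 = 0) -> 0 < eta ->
  exists2 K, 0 < K & forall n, (0 < n)%N -> exists A, [/\ measurable A,
    A `<=` [set w | forall i, `|\sum_(j < n) h (Z j w) i 0| <= K * Num.sqrt n%:R] &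
    (P (~` A) <= eta%:E)%E].
Proof.
move=> mh h2 h0 eta0.
pose v := \sum_i \int[Q]_z (h z i 0 ^+ 2).
have v0 : 0 <= v by apply: sumr_ge0 => i _; apply: Rintegral_ge0 => // z _; rewrite sqr_ge0.
(* Markov's inequality asks for v at most K^2 eta; the added 1 makes K at least 1, so that v at most
   K eta is enough. *)
pose K := v / eta + 1.
have K1 : 1 <= K by rewrite lerDr divr_ge0// ltW.
have K0 : 0 < K by exact: lt_le_trans K1.
exists K => // n n0; have nr0 : 0 < n%:R :> R by rewrite ltr0n.
pose S i w := \sum_(j < n) h (Z j w) i 0.
pose f w := \sum_i S i w ^+ 2.
have mS i : measurable_fun setT (S i) by exact: (iid_measurable_sum iidZ n (mh i)).
have si i := iid_sum_square iidZ n (mh i) (h2 i) (h0 i).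
have fi : P.-integrable setT (EFin \o f) by apply: integrable_EFin_sum => i _; have [] := si i.
have fE : \int[P]_w f w = n%:R * v.
  rewrite Rintegral_sum; last by move=> i _; have [] := si i.
  by rewrite mulr_sumr; apply: eq_bigr => i _; have [_ ->] := si i.
have mf : measurable_fun setT (EFin \o f) by have /integrableP[] := fi.
have f0 w : (0 <= (EFin \o f) w)%E by rewrite /= lee_fin sumr_ge0// => i _; rewrite sqr_ge0.
have e0 : 0 < K ^+ 2 * n%:R by rewrite mulr_gt0// exprn_gt0.
exists [set w | ((EFin \o f) w <= (K ^+ 2 * n%:R)%:E)%E]; split.
- by rewrite -[X in measurable X]setTI; exact: emeasurable_fun_infty_c.
- move=> w /=; rewrite lee_fin => fK i.
  have -> : K * Num.sqrt n%:R = Num.sqrt (K ^+ 2 * n%:R).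
    by rewrite sqrtrM ?sqr_ge0// sqrtr_sqr gtr0_norm.
  rewrite -sqrtr_sqr ler_wsqrtr//; apply: le_trans fK.
  by rewrite /f (bigD1 i)//= lerDl sumr_ge0// => l _; rewrite sqr_ge0.
apply: le_trans (markov_ge0 P mf f0 e0) _.
rewrite RintegralE// fE -EFinM lee_fin ler_pdivrMl//.
have -> : K ^+ 2 * n%:R * eta = n%:R * (K ^+ 2 * eta) by ring.
rewrite ler_pM2l//.
have : v <= K * eta by rewrite /K mulrDl divfK ?gt_eqF// mul1r lerDl ltW.
move=> /le_trans; apply; rewrite ler_pM2r// expr2 -[leLHS]mulr1 ler_pM2l//.
Qed.

Lemma whp_markov (f : nat -> T -> R) (e : R) :
  (forall n, measurable_fun setT (f n)) -> (forall n w, 0 <= f n w) ->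
  (\int[P]_w (f n w)%:E @[n --> \oo] --> 0)%E -> 0 < e ->
  whp P (fun n => [set w | f n w <= e]).
Proof.
move=> mf f0 fcvg e0 eta eta0.
have eeta : 0 < e * eta by rewrite mulr_gt0.
move/fine_cvgP : fcvg => [[N1 _ H1] /cvgrPdist_le/(_ _ eeta)[N2 _ H2]].
exists (maxn N1 N2) => n; rewrite geq_max => /andP[n1 n2].
have mfn : measurable_fun setT (EFin \o f n) by exact/measurable_EFinP.
have fn0 w : (0 <= (EFin \o f n) w)%E by rewrite /= lee_fin.
exists [set w | ((EFin \o f n) w <= e%:E)%E]; split.
- by rewrite -[X in measurable X]setTI; exact: emeasurable_fun_infty_c.
- by move=> w /=; rewrite lee_fin.
apply: le_trans (markov_ge0 P mfn fn0 e0) _.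
have /= := H1 _ n1; have /= := H2 _ n2; rewrite sub0r normrN => h hf.
rewrite -(fineK hf) -EFinM lee_fin ler_pdivrMl//.
by apply: le_trans h; exact: ler_norm.
Qed.

End iid_vectors.

Lemma normr_cosB_le {R : realType} (x y : R) : `|cos x - cos y| <= `|x - y|.
Proof.
rewrite -!sinDpihalf; apply: le_trans (normr_sinB_le _ _) _.
by rewrite opprD addrACA subrr addr0.
Qed.

(** * Central limit theorem for vectors, up to a negligible perturbation *)

Section vector_clt.
Variables (d : measure_display) (T : measurableType d)
  (dZ : measure_display) (Zs : measurableType dZ) (R : realType).
Variables (P : probability T R) (Q : probability Zs R) (Z : nat -> T -> Zs).
Hypothesis iidZ : iid_law P Q Z.
Variables (r : nat) (h : Zs -> 'cV[R]_r) (S : 'M[R]_r) (X : nat -> T -> 'cV[R]_r).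
Hypotheses (mh : meas_vec h)
  (h2 : forall i, Q.-integrable setT (EFin \o (fun z => h z i 0 ^+ 2)))
  (h0 : forall i, \int[Q]_z h z i 0 = 0)
  (hS : forall i k, \int[Q]_z (h z i 0 * h z k 0) = S i k)
  (Su : S \in unitmx) (mX : forall n, meas_vec (X n)).
Let Sn n w := (Num.sqrt n%:R)^-1 *: \sum_(j < n) h (Z j w).
Hypothesis XS : forall eps, 0 < eps -> whp P (fun n => [set w | mnorm (X n w - Sn n w) <= eps]).

Let S_sym : S^T = S.
Proof.
apply/matrixP => i k; rewrite mxE -!hS.
by apply: eq_Rintegral => z _; rewrite mulrC.
Qed.

Let hm i k : Q.-integrable setT (EFin \o (fun z => h z i 0 * h z k 0)).
Proof. by apply: integrable_square_mul; [exact: mh|exact: mh|exact: h2|exact: h2]. Qed.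

Let xi_sqr t z : dotv t (h z) ^+ 2 =
  \sum_i \sum_k (t i 0 * t k 0) * (h z i 0 * h z k 0).
Proof.
rewrite /dotv expr2 big_distrlr /=; apply: eq_bigr => i _.
by apply: eq_bigr => k _; ring.
Qed.

Let xi2_int t : Q.-integrable setT (EFin \o (fun z => dotv t (h z) ^+ 2)).
Proof.
under eq_fun do rewrite xi_sqr.
apply: integrable_EFin_sum => i _; apply: integrable_EFin_sum => k _.
exact: integrable_EFinZl.
Qed.

Let xi2E t : \int[Q]_z (dotv t (h z) ^+ 2) = dotv t (S *m t).
Proof.
under eq_Rintegral do rewrite xi_sqr.
rewrite Rintegral_sum; last first.
  by move=> i _; apply: integrable_EFin_sum => k _; exact: integrable_EFinZl.
rewrite /dotv; apply: eq_bigr => i _; rewrite mxE mulr_sumr.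
rewrite Rintegral_sum; last by move=> k _; exact: integrable_EFinZl.
by apply: eq_bigr => k _; rewrite RintegralZl// hS; ring.
Qed.

Let h1 i : Q.-integrable setT (EFin \o (fun z => h z i 0)).
Proof. by apply: square_integrable; [exact: mh|exact: h2]. Qed.

Let xi0 t : \int[Q]_z dotv t (h z) = 0.
Proof.
rewrite Rintegral_sum; last by move=> i _; exact: integrable_EFinZl.
by rewrite big1// => i _; rewrite RintegralZl// h0 mulr0.
Qed.

Let mSn n : meas_vec (Sn n).
Proof.
move=> i; under eq_fun do rewrite mxE summxE.
by apply: measurable_funM => //; exact: (iid_measurable_sum iidZ n (mh i)).
Qed.

(** Slutsky's argument for bounded Lipschitz functions: X n and Sn n are close off an event of small
    probability, where the bound 1 on [phi] is used. *)
Let cvg_lip (phi : R -> R) t (l : R) : measurable_fun setT phi -> (forall x, `|phi x| <= 1) ->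
  (forall x y, `|phi x - phi y| <= `|x - y|) ->
  \int[P]_w phi (dotv t (Sn n w)) @[n --> \oo] --> l ->
  \int[P]_w phi (dotv t (X n w)) @[n --> \oo] --> l.
Proof.
move=> mphi phi1 lip cS; apply/cvgrPdist_le => e e0.
have e2 : 0 < e / 2 by rewrite divr_gt0.
pose c := r%:R * mnorm t + 1.
have c0 : 0 < c by rewrite ltr_wpDl// mulr_ge0.
have ec : 0 < e / (4 * c) by rewrite divr_gt0// mulr_gt0.
have e8 : 0 < e / 8 by rewrite divr_gt0.
move/cvgrPdist_le : cS => /(_ _ e2)[N1 _ H1].
have [N2 H2] := XS ec e8.
exists (maxn N1 N2) => // n /=; rewrite geq_max => /andP[n1 n2].
have [A [mA AX PA]] := H2 _ n2.
have mt (W : T -> 'cV[R]_r) : meas_vec W ->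
    measurable_fun setT (fun w => phi (dotv t (W w))).
  by move=> mW; apply: measurableT_comp => //; exact: measurable_dotv.
have := @Rintegral_approx _ _ _ P (fun w => phi (dotv t (Sn n w))) (fun w => phi (dotv t (X n w)))
  1 (e / 4) (e / 8) A (mt _ (mSn n)) (mt _ (mX n)) (fun w => phi1 _)
  (fun w => phi1 _) mA _ _ PA.
have e4 : 0 <= e / 4 by rewrite divr_ge0// ltW.
move=> /(_ e4) H.
have {}H : `|\int[P]_w phi (dotv t (Sn n w)) - \int[P]_w phi (dotv t (X n w))| <= e / 2.
  apply: le_trans (H _) _; last by lra.
  move=> w /AX/= XSw; apply: le_trans (lip _ _) _.
  rewrite -dotvBr; apply: le_trans (normr_dotv _ _) _.
  rewrite -(mnormN (Sn n w - X n w)) opprB; apply: (@le_trans _ _ (c * (e / (4 * c)))).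
    by rewrite ler_pM ?mulr_ge0// /c lerDl.
  by rewrite le_eqVlt; apply/orP; left; apply/eqP; field; rewrite gt_eqF.
rewrite -[_ - _](subrKA (\int[P]_w phi (dotv t (Sn n w)))).
rewrite [e]splitr; apply: le_trans (ler_normD _ _) _; apply: lerD => //.
exact: H1.
Qed.

Let dotvSn t n w : dotv t (Sn n w) = (Num.sqrt n%:R)^-1 * \sum_(j < n) dotv t (h (Z j w)).
Proof. by rewrite dotvZr dotv_sumr. Qed.

Let tight eta : 0 < eta -> exists K N, forall n, (N <= n)%N -> exists A, [/\ measurable A,
  A `<=` [set w | forall i, `|X n w i 0| <= K] & (P (~` A) <= eta%:E)%E].
Proof.
move=> eta0; have eta2 : 0 < eta / 2 by rewrite divr_gt0.
have [K K0 HK] := iid_vec_tail iidZ mh h2 h0 eta2.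
have [N HN] := XS ltr01 eta2.
(* The 1 is the distance allowed between X n and Sn n; the successor excludes the empty sample. *)
exists (1 + K), N.+1 => n Nn; have n0 : (0 < n)%N by exact: leq_trans Nn.
have [A [mA AS PA]] := HK _ n0; have [B [mB BX PB]] := HN _ (ltnW Nn).
exists (A `&` B); split; [exact: measurableI| |]; last first.
  by rewrite [eta]splitr; exact: probability_setCI_le.
move=> w [/AS/= Aw /BX/= Bw] i.
have s0 : 0 < Num.sqrt n%:R :> R by rewrite sqrtr_gt0 ltr0n.
rewrite -[X n w](subrK (Sn n w)) mxE; apply: le_trans (ler_normD _ _) _.
apply: lerD; first by apply: le_trans (mnorm_entry _ _ _) Bw.
rewrite /Sn mxE summxE normrM ger0_norm ?invr_ge0 ?(ltW s0)//.
by rewrite ler_pdivrMl// mulrC.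
Qed.

Lemma vector_CLT : cvg_dist_normal P X S.
Proof.
have Spd : forall t, t != 0 -> 0 < dotv t (S *m t).
  apply: psd_unitmx_pd => // t; rewrite -xi2E.
  by apply: Rintegral_ge0 => // z _; rewrite sqr_ge0.
have [d' [T' [P' [Y [mY HY]]]]] := gaussian_exists S_sym Spd.
have Yc t : \int[P']_w cos (dotv t (Y w)) = expR (- dotv t (S *m t) / 2).
  by have := HY t 0; rewrite cos0 mul1r => <-; apply: eq_Rintegral => w _; rewrite addr0.
have Ys t : \int[P']_w sin (dotv t (Y w)) = 0.
  (* A phase of -pi / 2 turns the cosine into a sine, and cos (-pi / 2) = 0 gives the vanishing
     imaginary part. *)
  have := HY t (- (pi / 2)); rewrite cosN cos_pihalf mul0r => <-.
  by apply: eq_Rintegral => w _; rewrite cosBpihalf.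
have mc t : measurable_fun setT (fun w => cos (dotv t (Y w))).
  by apply: measurableT_comp; [exact: measurable_cos|exact: measurable_dotv].
have ms t : measurable_fun setT (fun w => sin (dotv t (Y w))).
  by apply: measurableT_comp; [exact: measurable_sin|exact: measurable_dotv].
exists d', T', P', Y; split.
  split=> // t; split; rewrite unlock RintegralE ?Yc ?Ys//.
    exact: bounded_integrable (mc t) (fun w => cos_max _).
  exact: bounded_integrable (ms t) (fun w => sin_max _).
have clt t := iid_CLT_trig iidZ (measurable_dotv t mh) (xi2_int t) (xi0 t).
move=> f cf [M fM]; apply: (weak_cvg_of_trig mX mY _ _ tight cf fM).
- move=> t; rewrite Yc -xi2E; apply: (cvg_lip (phi := cos)) => //.
  + exact: measurable_cos.
  + exact: cos_max.
  + exact: normr_cosB_le.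
  + by under eq_fun do under eq_Rintegral do rewrite dotvSn; have [] := clt t.
- move=> t; rewrite Ys; apply: (cvg_lip (phi := sin)) => //.
  + exact: measurable_sin.
  + exact: sin_max.
  + exact: normr_sinB_le.
  + by under eq_fun do under eq_Rintegral do rewrite dotvSn; have [] := clt t.
Qed.

End vector_clt.

(** * Moments of the residual of the projection onto the span of [v] *)

Section projection.
Variables (dZ : measure_display) (Zs : measurableType dZ) (R : realType).
Variable Q : probability Zs R.
Variables (r m : nat) (psi : Zs -> 'cV[R]_r) (theta : 'cV[R]_r) (v : Zs -> 'cV[R]_m)
  (V : 'M[R]_m) (C : 'M[R]_(r, m)) (Sigma : 'M[R]_r).
Hypotheses (mpsi : meas_vec psi) (psi2 : sq_int Q psi) (mv : meas_vec v) (v2 : sq_int Q v).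
Hypotheses (psiE : forall i, \int[Q]_z psi z i 0 = theta i 0)
  (vE : forall i, \int[Q]_z v z i 0 = 0)
  (VE : forall i k, \int[Q]_z (v z i 0 * v z k 0) = V i k)
  (CE : forall i k, \int[Q]_z (psi z i 0 * v z k 0) = C i k)
  (Vu : V \in unitmx).
Let D : 'M[R]_(r, m) := C *m invmx V.
Let p z : 'cV[R]_r := D *m v z.

Let pE z i : p z i 0 = \sum_l D i l * v z l 0.
Proof. by rewrite mxE. Qed.

Let mp : meas_vec p.
Proof.
move=> i; under eq_fun do rewrite pE.
by apply: measurable_sum => l; exact: measurable_funM.
Qed.

Let square_add (f g : Zs -> R) : measurable_fun setT f -> measurable_fun setT g ->
  Q.-integrable setT (EFin \o (fun z => f z ^+ 2)) ->
  Q.-integrable setT (EFin \o (fun z => g z ^+ 2)) ->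
  Q.-integrable setT (EFin \o (fun z => (f z + g z) ^+ 2)).
Proof.
move=> mf mg fi gi.
have := integrable_EFinD (integrable_EFinD fi gi)
  (integrable_EFinZl 2 (integrable_square_mul mf mg fi gi)).
by congr (_.-integrable _ (EFin \o _)); apply/funext => z; ring.
Qed.

Let p2 i : Q.-integrable setT (EFin \o (fun z => p z i 0 ^+ 2)).
Proof.
have E z : p z i 0 ^+ 2 = \sum_l \sum_l' (D i l * D i l') * (v z l 0 * v z l' 0).
  rewrite pE expr2 big_distrlr /=; apply: eq_bigr => l _.
  by apply: eq_bigr => l' _; ring.
under eq_fun do rewrite E.
apply: integrable_EFin_sum => l _; apply: integrable_EFin_sum => l' _.
by apply: integrable_EFinZl; exact: sq_int_mul.
Qed.

Let q z i : R := psi z i 0 - theta i 0.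

Let c1 c : Q.-integrable setT (EFin \o (fun=> c : R)).
Proof. exact: finite_measure_integrable_cst. Qed.

Let mq i : measurable_fun setT (q ^~ i).
Proof. by apply: measurable_funB => //; exact: mpsi. Qed.

Let q2 i : Q.-integrable setT (EFin \o (fun z => q z i ^+ 2)).
Proof.
have mc : measurable_fun [set: Zs] (fun=> - theta i 0) by [].
exact: (square_add (mpsi i) mc (sq_int_entry i mpsi psi2) (c1 _)).
Qed.

Lemma residual_measurable : meas_vec (fun z => psi z - theta - C *m invmx V *m v z).
Proof.
move=> i; rewrite (_ : (fun z => _) = (fun z => q z i - p z i 0)).
  by apply: measurable_funB => //; exact: mp.
by apply/funext => z; rewrite !mxE.
Qed.

Let residualE z i : (psi z - theta - C *m invmx V *m v z) i 0 = q z i - p z i 0.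
Proof. by rewrite !mxE. Qed.

Lemma residual_square i :
  Q.-integrable setT (EFin \o (fun z => (psi z - theta - C *m invmx V *m v z) i 0 ^+ 2)).
Proof.
under eq_fun do rewrite residualE.
have mNp : measurable_fun setT (fun z => - p z i 0) by apply: measurableT_comp => //; exact: mp.
apply: (square_add (mq i) mNp (q2 i)).
by under eq_fun do rewrite sqrrN; exact: p2.
Qed.

Let psi1 i := sq_int_entry1 i mpsi psi2.
Let p1 i : Q.-integrable setT (EFin \o (fun z => p z i 0)).
Proof. by apply: square_integrable; [exact: mp|exact: p2]. Qed.

Let q1 i : Q.-integrable setT (EFin \o (q ^~ i)).
Proof. exact: square_integrable (mq i) (q2 i). Qed.

Let p0 i : \int[Q]_z p z i 0 = 0.
Proof.
under eq_Rintegral do rewrite pE.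
rewrite Rintegral_sum; last first.
  by move=> l _; apply: integrable_EFinZl; exact: sq_int_entry1.
by rewrite big1// => l _; rewrite RintegralZl ?vE ?mulr0//; exact: sq_int_entry1.
Qed.

Let q0 i : \int[Q]_z q z i = 0.
Proof. by rewrite RintegralB// Rintegral_cst1 psiE subrr. Qed.

Lemma residual_mean i : \int[Q]_z (psi z - theta - C *m invmx V *m v z) i 0 = 0.
Proof. by under eq_Rintegral do rewrite residualE; rewrite RintegralB// q0 p0 subrr. Qed.

Let qp i k : Q.-integrable setT (EFin \o (fun z => q z i * p z k 0)).
Proof. by apply: integrable_square_mul => //; exact: mp. Qed.

Let pp i k : Q.-integrable setT (EFin \o (fun z => p z i 0 * p z k 0)).
Proof. by apply: integrable_square_mul => //; exact: mp. Qed.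

Let qq i k : Q.-integrable setT (EFin \o (fun z => q z i * q z k)).
Proof. exact: integrable_square_mul. Qed.

Let psip i k : Q.-integrable setT (EFin \o (fun z => psi z i 0 * p z k 0)).
Proof. exact: integrable_square_mul (mpsi i) (mp k) (sq_int_entry i mpsi psi2) (p2 k). Qed.

(** The second moment D V D^T collapses to C D^T because D V = C, the normal equations of the
    projection. *)
Let int_pp i k : \int[Q]_z (p z i 0 * p z k 0) = (C *m D^T) i k.
Proof.
have E z : p z i 0 * p z k 0 = \sum_l' \sum_l (D i l * D k l') * (v z l 0 * v z l' 0).
  rewrite !pE big_distrlr /= exchange_big/=; apply: eq_bigr => l' _.
  by apply: eq_bigr => l _; ring.
under eq_Rintegral do rewrite E.
have vv l l' := sq_int_mul l l' mv v2 mv v2.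
rewrite Rintegral_sum; last first.
  by move=> l' _; apply: integrable_EFin_sum => l _; exact: integrable_EFinZl.
have -> : C = D *m V by rewrite mulmxKV.
rewrite mxE; apply: eq_bigr => l' _; rewrite !mxE mulr_suml.
rewrite Rintegral_sum; last by move=> l _; exact: integrable_EFinZl.
by apply: eq_bigr => l _; rewrite RintegralZl// VE; ring.
Qed.

Let int_psip i k : \int[Q]_z (psi z i 0 * p z k 0) = (C *m D^T) i k.
Proof.
have E z : psi z i 0 * p z k 0 = \sum_l D k l * (psi z i 0 * v z l 0).
  by rewrite pE mulr_sumr; apply: eq_bigr => l _; ring.
under eq_Rintegral do rewrite E.
have pv l := sq_int_mul i l mpsi psi2 mv v2.
rewrite Rintegral_sum; last by move=> l _; exact: integrable_EFinZl.
by rewrite mxE; apply: eq_bigr => l _; rewrite RintegralZl// CE !mxE; ring.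
Qed.

(** Orthogonality of the residual to the projection; centring by theta is harmless because [p] has
    mean zero. *)
Let int_qp i k : \int[Q]_z (q z i * p z k 0) = \int[Q]_z (p z i 0 * p z k 0).
Proof.
under eq_Rintegral do rewrite mulrBl.
rewrite RintegralB//; last exact: integrable_EFinZl.
by rewrite RintegralZl// p0 mulr0 subr0 int_psip int_pp.
Qed.

Let int_qq i k : \int[Q]_z (q z i * q z k) =
  \int[Q]_z (psi z i 0 * psi z k 0) - theta i 0 * theta k 0.
Proof.
have pp' := sq_int_mul i k mpsi psi2 mpsi psi2.
have E z : q z i * q z k = psi z i 0 * psi z k 0 - theta k 0 * psi z i 0 - theta i 0 * q z k.
  by rewrite /q; ring.
under eq_Rintegral do rewrite E.
have i1 := integrable_EFinZl (theta k 0) (psi1 i).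
rewrite RintegralB//; [|exact: integrable_EFinB|exact: integrable_EFinZl].
rewrite RintegralB// !RintegralZl// q0 mulr0 subr0 psiE.
by rewrite mulrC.
Qed.

(** Pythagoras: by [int_qp] both mixed moments equal the second moment of [p], so one copy of it is
    left with a minus sign. *)
Lemma residual_covariance i k :
  \int[Q]_z ((psi z - theta - C *m invmx V *m v z) i 0 *
             (psi z - theta - C *m invmx V *m v z) k 0) =
  covQ Q (fun z => psi z i 0) (fun z => psi z k 0)
  - covQ Q (fun z => (C *m invmx V *m v z) i 0) (fun z => (C *m invmx V *m v z) k 0).
Proof.
have covE f g : covQ Q f g = \int[Q]_z (f z * g z) - (\int[Q]_z f z) * (\int[Q]_z g z) by [].
rewrite !covE !psiE [in RHS](p0 i) mul0r subr0 -int_qq.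
have E z : (psi z - theta - C *m invmx V *m v z) i 0 *
    (psi z - theta - C *m invmx V *m v z) k 0 =
    (q z i * q z k - q z i * p z k 0) - (q z k * p z i 0 - p z i 0 * p z k 0).
  by rewrite !residualE; ring.
under eq_Rintegral do rewrite E.
rewrite RintegralB//; [|exact: integrable_EFinB|exact: integrable_EFinB].
rewrite RintegralB// RintegralB// !int_qp.
rewrite (_ : \int[Q]_z (p z k 0 * p z i 0) = \int[Q]_z (p z i 0 * p z k 0)).
  by rewrite subrr subr0.
by apply: eq_Rintegral => z _; rewrite mulrC.
Qed.

End projection.

Lemma small_step (R : realType) (a b eps : R) : 0 < a -> 0 <= b -> 0 < eps ->
  [/\ 0 < Num.min 1 (a + b / eps)^-1, Num.min 1 (a + b / eps)^-1 * a <= 1 &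
      b * Num.min 1 (a + b / eps)^-1 <= eps].
Proof.
move=> a0 b0 eps0; have c0 : 0 < a + b / eps by rewrite ltr_wpDr// divr_ge0// ltW.
have e0 : 0 < Num.min 1 (a + b / eps)^-1 by rewrite lt_min ltr01 invr_gt0.
have ec : Num.min 1 (a + b / eps)^-1 * (a + b / eps) <= 1.
  by rewrite -ler_pdivlMr// mul1r ge_min lexx orbT.
split => //.
  by apply: le_trans ec; rewrite ler_pM2l// lerDl divr_ge0// ltW.
rewrite -[leRHS]mul1r -ler_pdivrMr//; apply: le_trans ec.
by rewrite mulrAC mulrC ler_pM2l// lerDr ltW.
Qed.

Lemma EL_expansion_whp (R : realType)
    (dO : measure_display) (Omega : measurableType dO) (P : probability Omega R)
    (dZ : measure_display) (Zs : measurableType dZ) (Q : probability Zs R)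
    (Z : nat -> Omega -> Zs) (r m : nat)
    (psi : Zs -> 'cV[R]_r) (v : Zs -> 'cV[R]_m) (V : 'M[R]_m) (C : 'M[R]_(r, m))
    (uhat : nat -> Omega -> Zs -> 'cV[R]_m) (eps : R) :
  iid_law P Q Z -> meas_vec psi -> sq_int Q psi -> meas_vec v -> sq_int Q v ->
  (forall i, \int[Q]_z v z i 0 = 0) ->
  (forall i k, \int[Q]_z (v z i 0 * v z k 0) = V i k) -> V \in unitmx ->
  (forall i k, \int[Q]_z (psi z i 0 * v z k 0) = C i k) ->
  (forall n j, meas_vec (fun w => uhat n w (Z j w))) ->
  small_op P (fun n w => \big[Num.max/0]_(j < n) enorm (uhat n w (Z j w)))
             (fun n => Num.sqrt n%:R) ->
  ((fun n => (n%:R^-1)%:E *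
       \sum_(j < n) 'E_P[fun w => ((enorm (uhat n w (Z j w) - v (Z j w))) ^+ 2)%R])
     @ \oo --> 0)%E ->
  small_op P (fun n w => enorm (emean n (fun j => uhat n w (Z j w))
                                - emean n (fun j => v (Z j w))))
             (fun n => (Num.sqrt n%:R)^-1) ->
  0 < eps ->
  whp P (fun n => [set w |
    (exists! zeta, EL_solves n (fun j => uhat n w (Z j w)) zeta) /\
    forall zeta, EL_solves n (fun j => uhat n w (Z j w)) zeta ->
      enorm (EL_theta n (fun j => psi (Z j w)) (fun j => uhat n w (Z j w)) zeta
             - emean n (fun j => psi (Z j w))
             + emean n (fun j => C *m invmx V *m v (Z j w))) <=
        eps * (Num.sqrt n%:R)^-1]).
Proof.
move=> iidZ mpsi psi2 mv v2 vE VE Vu CE muh Hi Hiv Hv eps0.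
have ipsi := sq_int_integrable mpsi psi2; have iv := sq_int_integrable mv v2.
pose Mv := \int[Q]_z (enorm (v z) ^+ 2) + 1; pose Mp := \int[Q]_z (enorm (psi z) ^+ 2) + 1.
have Mv0 : 0 <= Mv by rewrite addr_ge0// Rintegral_ge0// => z _; rewrite sqr_ge0.
have Mp0 : 0 <= Mp by rewrite addr_ge0// Rintegral_ge0// => z _; rewrite sqr_ge0.
pose B K := 2 + m%:R + mnorm (invmx V) + mnorm C + K + 2 * Mv + Mp.
pose L := 4 + 2 * Mv + Mp.
(* The constants grow with [K] through [B K], so the error level is a function of [K]; its
   properties come from [small_step]. *)
pose e K := Num.min 1 (L * (100 * B K ^+ 10) + r%:R * (400 * B K ^+ 13 * L) / eps)^-1.
pose uh n w j := uhat n w (Z j w).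
pose Bd K n := [set w | [/\ (0 < n)%N, 0 <= K &
  forall i, `|\sum_(j < n) v (Z j w) i 0| <= K * Num.sqrt n%:R]].
pose G1 a n := [set w | forall j, (j < n)%N -> enorm (uh n w j) <= a * Num.sqrt n%:R].
pose G2 a n := [set w |
  enorm (emean n (uh n w) - emean n (fun j => v (Z j w))) <= a / Num.sqrt n%:R].
pose G3 a n := [set w | n%:R^-1 * \sum_(j < n) enorm (uh n w j - v (Z j w)) ^+ 2 <= a].
pose G4 a n := [set w | forall i k, `|n%:R^-1 * \sum_(j < n) (v (Z j w) i 0 * v (Z j w) k 0) - V i k| <= a].
pose G5 a n := [set w | forall i k, `|n%:R^-1 * \sum_(j < n) (psi (Z j w) i 0 * v (Z j w) k 0) - C i k| <= a].
pose G6 n := [set w | n%:R^-1 * \sum_(j < n) enorm (psi (Z j w)) ^+ 2 <= Mp].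
pose G7 n := [set w | n%:R^-1 * \sum_(j < n) enorm (v (Z j w)) ^+ 2 <= Mv].
have whp1 a : 0 < a -> whp P (G1 a).
  move/small_opP : Hi => Hi /Hi; apply: whpS => n w /= h j jn.
  apply: le_trans h; apply: le_trans (ler_norm _).
  exact: (le_bigmax _ (fun j : 'I_n => enorm (uhat n w (Z j w))) (Ordinal jn)).
have whp2 a : 0 < a -> whp P (G2 a).
  move/small_opP : Hv => Hv /Hv; apply: whpS => n w /= h.
  by apply: le_trans h; exact: ler_norm.
have whp3 a : 0 < a -> whp P (G3 a).
  have md n (j : nat) : measurable_fun setT (fun w => enorm (uh n w j - v (Z j w)) ^+ 2).
    apply: (@measurable_enorm_sqr _ _ _ m (fun w => uh n w j - v (Z j w))) => i.
    under eq_fun do rewrite mxE [X in _ + X]mxE.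
    apply: measurable_funB; first exact: muh.
    have [mZ _] := iidZ.
    exact: (measurableT_comp (mv i) (mZ j)).
  apply: whp_markov => [n|n w|].
  - by apply: measurable_funM => //; apply: measurable_sum => j; exact: md.
  - by rewrite mulr_ge0 ?invr_ge0// sumr_ge0// => j _; rewrite sqr_ge0.
  rewrite (_ : (fun n => _) = (fun n => (n%:R^-1)%:E *
       \sum_(j < n) 'E_P[fun w => ((enorm (uhat n w (Z j w) - v (Z j w))) ^+ 2)%R])%E)//.
  apply/funext => n; under eq_integral do rewrite EFinM -sumEFin.
  rewrite ge0_integralZl//; first last.
  - by move=> w _; apply: sume_ge0 => j _; rewrite lee_fin sqr_ge0.
  - by apply: emeasurable_sum => j; apply/measurable_EFinP; exact: md.
  congr (_ * _)%E; rewrite ge0_integral_sum//.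
  - by apply: eq_bigr => j _; rewrite unlock.
  - by move=> j; apply/measurable_EFinP; exact: md.
  - by move=> j w _; rewrite lee_fin sqr_ge0.
have whp4 a : 0 < a -> whp P (G4 a).
  move=> a0.
  have h (ik : 'I_m * 'I_m) := iid_LLN iidZ (sq_int_mul ik.1 ik.2 mv v2 mv v2) a0.
  by apply: whpS (whp_fin h) => n w /= hw i k; have := hw (i, k); rewrite VE.
have whp5 a : 0 < a -> whp P (G5 a).
  move=> a0.
  have h (ik : 'I_r * 'I_m) := iid_LLN iidZ (sq_int_mul ik.1 ik.2 mpsi psi2 mv v2) a0.
  by apply: whpS (whp_fin h) => n w /= hw i k; have := hw (i, k); rewrite CE.
have whp6 : whp P G6.
  apply: whpS (iid_LLN iidZ ipsi ltr01) => n w; rewrite /G6 /Mp /= ler_norml => /andP[_].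
  by rewrite lerBlDl.
have whp7 : whp P G7.
  apply: whpS (iid_LLN iidZ iv ltr01) => n w; rewrite /G7 /Mv /= ler_norml => /andP[_].
  by rewrite lerBlDl.
(* The implication makes this hold with high probability for negative [K] too, as [whp_bounded] asks
   for every [K]. *)
pose Good K n := [set w | 0 <= K -> (G1 (e K) n `&` (G2 (e K) n `&` (G3 (e K ^+ 2) n `&`
  (G4 (e K) n `&` (G5 (e K) n `&` (G6 n `&` G7 n)))))) w].
have eK K : 0 <= K -> [/\ 0 < e K, e K * (L * (100 * B K ^+ 10)) <= 1 &
    r%:R * (400 * B K ^+ 13 * L) * e K <= eps].
  move=> K0; have [c1 c2] := @EL_perturbation_const R r m V C K Mv Mp K0 Mv0 Mp0 _ _ erefl erefl.
  exact: (small_step c1 c2 eps0).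
apply: (@whp_bounded _ _ _ P Bd Good).
- move=> eta eta0.
  have [K K0 HK] := iid_vec_tail iidZ mv (fun i => sq_int_entry i mv v2) vE eta0.
  exists K, 1%N => n n0; have [A [mA AS PA]] := HK _ n0; exists A; split => //.
  by move=> w /AS h; split => //; exact: ltW.
- move=> K; have [K0|K0] := boolP (0 <= K); last first.
    by apply: whpS (whp_setT P) => n w _ K0'; rewrite K0' in K0.
  have [e0 _ _] := eK _ K0.
  have e20 : 0 < e K ^+ 2 by exact: exprn_gt0.
  apply: whpS (whpI (whp1 _ e0) (whpI (whp2 _ e0) (whpI (whp3 _ e20) (whpI (whp4 _ e0)
    (whpI (whp5 _ e0) (whpI whp6 whp7)))))) => n w h _; exact: h.
move=> K n w [[n0 K0 h7] /(_ K0)[h1 [h2 [h3 [h4 [h5 [h6 h6']]]]]]].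
have [e0 eL eE] := eK _ K0.
have [uniq bnd] := @EL_perturbation R r m V C K Mv Mp Vu K0 Mv0 Mp0 _ _ erefl erefl (e K) n
  (uh n w) (fun j => v (Z j w)) (fun j => psi (Z j w)) e0 eL n0 h1 h2 h3 h4 h5 h6 h6' h7.
split => // zeta /bnd /le_trans; apply.
by rewrite mulrA ler_wpM2r// invr_ge0 sqrtr_ge0.
Qed.

Theorem theorem2 (R : realType)
  (dO : measure_display) (Omega : measurableType dO) (P : probability Omega R)
  (dZ : measure_display) (Zs : measurableType dZ) (Q : probability Zs R)
  (Z : nat -> Omega -> Zs) (r m : nat)
  (psi : Zs -> 'cV[R]_r) (theta : 'cV[R]_r)
  (u v : Zs -> 'cV[R]_m) (W V : 'M[R]_m) (C : 'M[R]_(r, m)) (Sigma : 'M[R]_r)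
  (uhat : nat -> Omega -> Zs -> 'cV[R]_m) :
  (0 < m)%N ->
  iid_law P Q Z ->
  (* psi *)
  meas_vec psi -> sq_int Q psi ->
  (forall i, (\int[Q]_z (psi z i 0)%:E = (theta i 0)%:E)%E) ->
  (* u *)
  meas_vec u -> sq_int Q u ->
  (forall i, (\int[Q]_z (u z i 0)%:E = 0)%E) ->
  (forall i k, (\int[Q]_z (u z i 0 * u z k 0)%:E = (W i k)%:E)%E) ->
  W \in unitmx ->
  (* the estimator \hat u is a random function: \hat u_n(omega, .) *)
  (forall n j, meas_vec (fun w => uhat n w (Z j w))) ->
  (forall n j i k, (j < n)%N ->
     P.-integrable setT (fun w => (psi (Z j w) i 0 * uhat n w (Z j w) k 0)%:E)) ->
  (* (i) *)
  small_op P (fun n w => \big[Num.max/0]_(j < n) enorm (uhat n w (Z j w)))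
             (fun n => Num.sqrt n%:R) ->
  (* (ii) *)
  small_op P (fun n w => opnorm (n%:R^-1 *: \sum_(j < n)
                  (uhat n w (Z j w) *m (uhat n w (Z j w))^T) - W))
             (fun _ => 1) ->
  (* (iii) componentwise *)
  (forall i k, small_op P
     (fun n w => n%:R^-1 * \sum_(j < n)
        (psi (Z j w) i 0 * uhat n w (Z j w) k 0
         - fine ('E_P[fun w' => (psi (Z j w') i 0 * uhat n w' (Z j w') k 0)%R])%E))
     (fun _ => 1)) ->
  (* v *)
  meas_vec v -> sq_int Q v ->
  (forall i, (\int[Q]_z (v z i 0)%:E = 0)%E) ->
  (forall i k, (\int[Q]_z (v z i 0 * v z k 0)%:E = (V i k)%:E)%E) ->
  V \in unitmx ->
  (* (iv) *)
  ((fun n => (n%:R^-1)%:E *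
       \sum_(j < n) 'E_P[fun w => ((enorm (uhat n w (Z j w) - v (Z j w))) ^+ 2)%R])
     @ \oo --> 0)%E ->
  (* (v) *)
  small_op P (fun n w => enorm (emean n (fun j => uhat n w (Z j w))
                                - emean n (fun j => v (Z j w))))
             (fun n => (Num.sqrt n%:R)^-1) ->
  (* C = E(psi(Z) v(Z)^T) and Sigma = Var psi(Z) - Var phi(Z), phi = C V^-1 v *)
  (forall i k, (\int[Q]_z (psi z i 0 * v z k 0)%:E = (C i k)%:E)%E) ->
  (forall i k, Sigma i k =
     covQ Q (fun z => psi z i 0) (fun z => psi z k 0)
     - covQ Q (fun z => (C *m invmx V *m v z) i 0) (fun z => (C *m invmx V *m v z) k 0)) ->
  exists E : nat -> set Omega,
    (forall n, measurable (E n)) /\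
    ((fun n => P (E n)) @ \oo --> 1%:E)%E /\
    (forall n w, E n w -> exists! zeta : 'cV[R]_m,
        EL_solves n (fun j => uhat n w (Z j w)) zeta) /\
    (forall zeta : nat -> Omega -> 'cV[R]_m,
       (forall n w, E n w -> EL_solves n (fun j => uhat n w (Z j w)) (zeta n w)) ->
       small_op P
         (fun n w => enorm (EL_theta n (fun j => psi (Z j w)) (fun j => uhat n w (Z j w))
                              (zeta n w)
                            - emean n (fun j => psi (Z j w))
                            + emean n (fun j => C *m invmx V *m v (Z j w))))
         (fun n => (Num.sqrt n%:R)^-1) /\
       (Sigma \in unitmx ->
        (forall n, meas_vec (fun w => EL_theta n (fun j => psi (Z j w))
                                 (fun j => uhat n w (Z j w)) (zeta n w))) ->
        cvg_dist_normal P
          (fun n w => Num.sqrt n%:R *: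
             (EL_theta n (fun j => psi (Z j w)) (fun j => uhat n w (Z j w)) (zeta n w)
              - theta))
          Sigma)).
Proof.
move=> m0 iidZ mpsi psi2 psiE _ _ _ _ _ muh _ Hi _ _ mv v2 vE VE Vu Hiv Hv CE SigE.
have {}psiE i : \int[Q]_z psi z i 0 = theta i 0 by rewrite /Rintegral psiE.
have {}vE i : \int[Q]_z v z i 0 = 0 by rewrite /Rintegral vE.
have {}VE i k : \int[Q]_z (v z i 0 * v z k 0) = V i k by rewrite /Rintegral VE.
have {}CE i k : \int[Q]_z (psi z i 0 * v z k 0) = C i k by rewrite /Rintegral CE.
have key eps := @EL_expansion_whp R dO Omega P dZ Zs Q Z r m psi v V C uhat eps
  iidZ mpsi psi2 mv v2 vE VE Vu CE muh Hi Hiv Hv.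
(* The accuracy 1 is arbitrary: only existence and uniqueness are taken from this event. *)
have [E [mE PE EU]] := whp_measurable (key 1 ltr01).
exists E; split => //; split => //; split; first by move=> n w /EU[].
move=> zeta zetaS.
have whpE eps : 0 < eps -> whp P (fun n => [set w | enorm (EL_theta n (fun j => psi (Z j w))
      (fun j => uhat n w (Z j w)) (zeta n w) - emean n (fun j => psi (Z j w))
      + emean n (fun j => C *m invmx V *m v (Z j w))) <= eps * (Num.sqrt n%:R)^-1]).
  (* The bound for accuracy eps holds for all solutions, hence for the selected one wherever its
     event meets [E n]. *)
  move=> eps0; apply: whpS (whpI (whp_event mE PE) (key _ eps0)).
  by move=> n w [/zetaS zs [_]]; apply.
split.
  apply/small_opP => eps /whpE; apply: whpS => n w /=.
  by rewrite ger0_norm ?sqrtr_ge0.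
move=> Su mth.
apply: (@vector_CLT _ _ _ _ _ P Q Z iidZ r (fun z => psi z - theta - C *m invmx V *m v z)).
- exact: residual_measurable.
- by move=> i; exact: residual_square.
- by move=> i; exact: residual_mean.
- by move=> i k; rewrite (residual_covariance mpsi psi2 mv v2 psiE vE VE CE Vu) SigE.
- exact: Su.
- move=> n i; under eq_fun do rewrite mxE [X in _ * X]mxE [X in _ + X]mxE.
  by apply: measurable_funM => //; apply: measurable_funB => //; exact: mth.
move=> eps /whpE; apply: whpW; exists 1%N => n n0 w /= h.
have nr0 : 0 < n%:R :> R by rewrite ltr0n.
have s0 : 0 < Num.sqrt n%:R :> R by rewrite sqrtr_gt0.
have sn : (Num.sqrt n%:R)^-1 = Num.sqrt n%:R * n%:R^-1 :> R.
  by rewrite -[in X in _ * X^-1](sqr_sqrtr (ltW nr0)); field; rewrite gt_eqF.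
(* The normalized sum of residuals is sqrt n times the linear approximation of the estimator minus
   theta, so its distance to the normalized estimator is sqrt n times the error bounded in [h]. *)
have -> : (Num.sqrt n%:R)^-1 *: \sum_(j < n) (psi (Z j w) - theta - C *m invmx V *m v (Z j w)) =
    Num.sqrt n%:R *: (emean n (fun j => psi (Z j w)) - theta
      - emean n (fun j => C *m invmx V *m v (Z j w))).
  rewrite sn -scalerA; congr (_ *: _); rewrite /emean !sumrB !scalerBr sumr_const card_ord.
  by rewrite -[theta *+ n]scaler_nat scalerA mulVf ?gt_eqF// scale1r.
rewrite -scalerBr mnormZ gtr0_norm// -ler_pdivlMl// mulrC.
apply: le_trans (mnorm_le_enorm _) _; apply: le_trans h.
rewrite le_eqVlt; apply/orP; left; apply/eqP; congr enorm.
set a := EL_theta _ _ _ _; set b := emean _ _; set c := emean _ _.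
by apply/matrixP => i k; rewrite !mxE; ring.
Qed.
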